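(* Consider the random asymptotically affine controlled branching process $(X_n)$ of the context. Fix $\alpha>0$ in the interior of $\mathcal D_\Lambda$ and assume: (a) the law of $\log M$ is non-arithmetic, $\mathbf E|\log M|<\infty$, $\mu:=\mathbf E\log M\ge 0$, $\rho:=\Lambda'(\alpha)>\mu$, and $v_\alpha^2:=\Lambda''(\alpha)\in(0,\infty)$; (b) $\mathbf E X_0^\alpha<\infty$ and there are $C<\infty$ and $0\le\beta<\alpha$ with $\mathbf E|D(k)|^\alpha\le C(1+k^\beta)$ for all $k\in\mathbb N_0$; (c) for every $K\ge1$, $\mathbf P(\tau_K<\infty)>0$, where $\tau_K:=\inf\{n\ge0:X_n\ge K\}$. Then there is a nonnegative random variable $V_\infty$ with $\mathbf P_\alpha(V_\infty>0)>0$ such that $$\frac{X_n}{\Delta_n}\longrightarrow V_\infty\qquad \mathbf P_\alpha\text{-almost surely and in }L^\alpha(\mathbf P_\alpha).$$ Moreover, with $c_X(\alpha):=\mathbf E_\alpha[V_\infty^\alpha]\in(0,\infty)$ and $I(\rho):=\alpha\rho-\Lambda(\alpha)$, $$\lim_{n\to\infty}e^{-n\Lambda(\alpha)}\mathbf E[X_n^\alpha]=c_X(\alpha),$$ and for every $y\in\mathbb R$ $$\lim_{n\to\infty}\sqrt n\,e^{nI(\rho)}\,\mathbf P(X_n>e^{\rho n+y})=\frac{c_X(\alpha)e^{-\alpha y}}{\alpha v_\alpha\sqrt{2\pi}} .$$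
   Context: Notation: $\mathbb N=\{1,2,\dots\}$, $\mathbb N_0=\{0,1,2,\dots\}$. Model. $\xi_{n,j}$ ($n\ge0,j\ge1$) are i.i.d. copies of an $\mathbb N_0$-valued $\xi$ with mean $m:=\mathbf E\xi\in(0,\infty)$. The environmental marks $\mathcal E_n$, $n\ge0$, are i.i.d.; the marks, the offspring array and the $\mathbb N_0$-valued $X_0$ are independent. The mark $\mathcal E_n$ determines $A_n\in\mathbb N$, $B_n\in\mathbb N_0$ and a random map $C_n:\mathbb N_0\to\mathbb N_0$ with $C_n(0)=0$ (these three may be dependent on each other). The control is $\phi_n(k)=A_nC_n(k)+B_n$, and $$X_{n+1}=\sum_{j=1}^{\phi_n(X_n)}\xi_{n,j},\qquad n\ge0$$ (empty sums are $0$). A constant $\lambda\in(0,\infty)$ is fixed. Generic one-generation objects. $(A,B,C)$ has the law of a generation mark, $(\xi_j)_{j\ge1}$ is an independent copy of a row of the offspring array, $N(k):=AC(k)+B$, $\Psi(k):=\sum_{j=1}^{N(k)}\xi_j$, $M:=m\lambda A$, $D(k):=\Psi(k)-Mk$. Put $M_n:=m\lambda A_n$, $\Delta_n:=\prod_{j=0}^{n-1}M_j$, $\Lambda(\vartheta):=\log\mathbf E[M^\vartheta]$, $\mathcal D_\Lambda:=\{\vartheta\in\mathbb R:\Lambda(\vartheta)<\infty\}$. Tilted law. $\mathbf P_\alpha$ (expectation $\mathbf E_\alpha$) is the law under which the marks are tilted by $d\mathbf P_\alpha/d\mathbf P=\Delta_n^\alpha e^{-n\Lambda(\alpha)}$ on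 the first $n$ marks, for each $n$; conditional on the marks the offspring law is unchanged, and the law of $X_0$ and its independence are unchanged.
   Formalization: ''Non-arithmetic'' is taken to mean that log M is not supported on any translate a+hZ (h>0), not only on no hZ; otherwise the tail limit fails, e.g. ξ≡3, A uniform on {1,2}, B=0, C=id, λ=1, X_0=1. *)

(* Defs.v *)
From HB Require Import structures.
From mathcomp Require Export all_boot all_order all_algebra.
From mathcomp Require Export all_classical all_reals all_analysis.

Set Implicit Arguments.
Unset Strict Implicit.
Unset Printing Implicit Defensive.

Import Order.TTheory GRing.Theory Num.Theory.
Export numFieldNormedType.Exports.

Local Open Scope classical_set_scope.
Local Open Scope ring_scope.

Definition sigma_gen d d' (Omega : measurableType d) (T : measurableType d')
    (I : Type) (D : set I) (X : I -> Omega -> T) : set (set Omega) :=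
  <<s \bigcup_(i in D) preimage_set_system setT (X i) measurable >>.

Definition mutually_independent (R : realType) d d' (Omega : measurableType d)
    (T : measurableType d') (P : probability Omega R) (I : eqType)
    (X : I -> Omega -> T) : Prop :=
  forall (s : seq I) (U : I -> set T), uniq s ->
    (forall i, measurable (U i)) ->
    P (\bigcap_(i in [set` s]) (X i @^-1` U i)) =
    (\prod_(i <- s) P (X i @^-1` U i))%E.

(* For sigma-algebras, the product rule for pairs is the case where one of the
   three events is the whole space. *)
Definition independent3 (R : realType) d (Omega : measurableType d)
    (P : probability Omega R) (F1 F2 F3 : set (set Omega)) : Prop :=
  forall U1 U2 U3, F1 U1 -> F2 U2 -> F3 U3 ->
    P (U1 `&` U2 `&` U3) = (P U1 * P U2 * P U3)%E.

Definition same_law (R : realType) d d' (Omega : measurableType d)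
    (T : measurableType d') (P : probability Omega R)
    (X Y : Omega -> T) : Prop :=
  forall U, measurable U -> P (X @^-1` U) = P (Y @^-1` U).

(* [ctlC c k e] is the value at [k] of the map C encoded by the mark [e]. *)
Record control de (Env : measurableType de) := Control {
  ctlA : {mfun Env >-> nat};
  ctlB : {mfun Env >-> nat};
  ctlC : nat -> {mfun Env >-> nat};
  ctlA_gt0 : forall e, (0 < ctlA e)%N;
  ctlC0 : forall e, ctlC 0 e = 0 }.

(* Offspring variables are indexed from 0: [xi S n j] is the variable
   xi_{n,j+1} of the array (xi_{n,j})_{n >= 0, j >= 1}. *)
Record cbp d (Omega : measurableType d) de (Env : measurableType de) := CBP {
  ctl : control Env;
  X0 : {mfun Omega >-> nat};
  xi : nat -> nat -> {mfun Omega >-> nat};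
  mark : nat -> {mfun Omega >-> Env} }.

Section Process.
Context d (Omega : measurableType d) de (Env : measurableType de).
Variable S : cbp Omega Env.

Definition phi (n k : nat) (w : Omega) : nat :=
  (ctlA (ctl S) (mark S n w) * ctlC (ctl S) k (mark S n w)
   + ctlB (ctl S) (mark S n w))%N.

Definition Psi (n k : nat) (w : Omega) : nat :=
  (\sum_(j < phi n k w) xi S n j w)%N.

Fixpoint X (n : nat) (w : Omega) : nat :=
  if n is n'.+1 then Psi n' (X n' w) w else X0 S w.

Definition sigma_X0 : set (set Omega) :=
  sigma_gen [set: unit] (fun _ : unit => X0 S).

Definition xi_array (nj : nat * nat) : Omega -> nat := xi S nj.1 nj.2.

Definition sigma_xi : set (set Omega) := sigma_gen [set: nat * nat] xi_array.

Definition sigma_marks : set (set Omega) := sigma_gen [set: nat] (mark S).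

Definition sigma_first_marks (n : nat) : set (set Omega) :=
  sigma_gen [set i : nat | (i < n)%N] (mark S).

Variables (R : realType) (m lambda : R).

Definition M (n : nat) (w : Omega) : R :=
  m * lambda * (ctlA (ctl S) (mark S n w))%:R.

Definition Delta (n : nat) (w : Omega) : R := \prod_(j < n) M j w.

(* The generic one-generation objects are realised by generation 0. *)
Definition D (k : nat) (w : Omega) : R := (Psi 0 k w)%:R - M 0 w * k%:R.

Definition tau (K : nat) (w : Omega) : \bar R :=
  ereal_inf [set n%:R%:E | n in [set n : nat | (K <= X n w)%N]].

Variable P : probability Omega R.

Record cbp_law : Prop := CBPLaw {
  xi_same_law : forall n j, same_law P (xi S n j) (xi S 0 0);
  xi_indep : mutually_independent P xi_array;
  xi_mean : ('E_P[fun w => (xi S 0 0 w)%:R] = m%:E)%E;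
  xi_mean_gt0 : 0 < m;
  mark_same_law : forall n, same_law P (mark S n) (mark S 0);
  mark_indep : mutually_independent P (mark S);
  blocks_indep : independent3 P sigma_X0 sigma_xi sigma_marks }.

Definition Lambda_ext (theta : R) : \bar R :=
  (lne 'E_P[fun w => (M 0 w `^ theta)%R])%E.

Definition dom_Lambda : set R := [set theta | (Lambda_ext theta < +oo)%E].

Definition Lambda (theta : R) : R := fine (Lambda_ext theta).

(* Translates a + hZ are excluded as well as the groups hZ: otherwise log Delta_n
   lives on the lattice na + hZ and its large-deviation probabilities oscillate,
   even when a/h is irrational. *)
Definition nonarithmetic_logM : Prop :=
  ~ exists a h : R, 0 < h /\
    P [set w | exists z : int, ln (M 0 w) = a + z%:~R * h] = 1%E.

Record tilted_law (alpha : R) (Pa : probability Omega R) : Prop := TiltedLaw {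
  tilted_marks : forall n F, sigma_first_marks n F ->
    Pa F = (\int[P]_(w in F)
              (Delta n w `^ alpha * expR (- (n%:R * Lambda alpha)))%:E)%E;
  tilted_xi : forall F, sigma_xi F -> Pa F = P F;
  tilted_X0 : forall F, sigma_X0 F -> Pa F = P F;
  tilted_blocks_indep : independent3 Pa sigma_X0 sigma_xi sigma_marks }.

End Process.

(* Main.v *)
(* Under P_alpha the walk log Delta_n has drift rho and variance n v^2, and
   P(log Delta_n > rho n + b) = e^{-nI(rho)} E_alpha[e^{-alpha T_n}; T_n > b] with
   T_n = log Delta_n - rho n. The law of T_n, smoothed by a Fejer kernel of width 1/A,
   has a density with compactly supported Fourier transform, to which the local limit
   theorem applies by characteristic functions; since the tail probability is monotone in b,
   letting A tend to infinity gives
   sqrt n e^{nI(rho)} P(log Delta_n > rho n + b) -> e^{-alpha b} / (alpha v sqrt(2 pi)),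
   together with a bound of the same order for all n and b.

   Convexity of Lambda and rho > mu >= 0 force Lambda(alpha) > 0. Write V_n = X_n / Delta_n.
   Undoing the tilting, |V_{n+1} - V_n|^alpha has P_alpha-expectation
   O(e^{-n Lambda(alpha)} E[1 + X_n^beta]); Young's inequality
   x^beta <= d x^alpha + C_d with a threshold growing with n makes this geometrically small,
   so that V_n converges almost surely and in L^alpha. On {X_k >= K} the same estimates show
   that the fluctuations after time k are small compared with V_k when K is large, so the
   limit is not a.s. zero.

   Finally X_n differs from X_k Delta_n / Delta_k by the sum over j in [k, n) of the noise
   of generation j times Delta_n / Delta_{j+1}, two independent factors. The uniform tail
   bound makes the contribution of the noise to sqrt n e^{nI(rho)} P(X_n > e^{rho n + y})
   geometrically small in k, and the main term is evaluated by dominated convergence,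
   conditionally on X_k. *)
From HB Require Import structures.
From mathcomp Require Import measurable_realfun.
From mathcomp Require Import ring lra.
Require Import Defs.

Set Implicit Arguments.
Unset Strict Implicit.
Unset Printing Implicit Defensive.

Import Order.TTheory GRing.Theory Num.Theory.
Local Open Scope classical_set_scope.
Local Open Scope ring_scope.

(** * Independence and change of measure *)

(** The exponent alpha may be below 1, so there is no Minkowski inequality to add up the noises.
    Sums are cut with positive weights of total at most 1 instead: an error above t forces one term
    above its share of t, and the alpha-th power of a sum is at most the sum of the alpha-th powers
    of the terms divided by their weights. The weights are geometric and cost one factor [decay] per
    generation, while the moments of the normalized noise gain four; the surplus pays for the
    quotient of square roots left by a noise that enters late, and for the geometric sums. Compact
    support of the transformed kernel is what lets a merely non-arithmetic law through: the modulus
    of the characteristic function must stay below 1 on compact sets away from 0, and nothing is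
    asked at infinity. Characteristic functions are pairs of cosine and sine integrals. Conditioning
    on the population is a sum over its values, and the tilted law enters through its density on
    finitely many marks. *)

Section indep_pair.
Context d d1 d2 (T : measurableType d) (T1 : measurableType d1)
  (T2 : measurableType d2) (R : realType) (P : probability T R).

Definition indep_rv (X : T -> T1) (Y : T -> T2) : Prop :=
  forall U V, measurable U -> measurable V ->
    P (X @^-1` U `&` Y @^-1` V) = (P (X @^-1` U) * P (Y @^-1` V))%E.

Section mfun_case.
Variables (X : {mfun T >-> T1}) (Y : {mfun T >-> T2}).
Hypothesis XY : indep_rv X Y.

Let Z (w : T) : T1 * T2 := (X w, Y w).

Let mZ : measurable_fun setT Z.
Proof. by apply/measurable_fun_pairP; split. Qed.

Let Z' : {mfun T >-> (T1 * T2)%type} :=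
  HB.pack Z (isMeasurableFun.Build _ _ _ _ Z mZ).

Let distrZ A : measurable A ->
  (distribution P X \x distribution P Y)%E A = distribution P Z' A.
Proof.
by apply: product_measure_unique => U V mU mV /=; rewrite /distribution/pushforward -XY.
Qed.

(** The law of the pair agrees with the product of the two laws on rectangles, hence everywhere;
    Tonelli on the product then gives an iterated expectation over the same space. *)
Lemma indep_mfun_ge0_fubini (h : T1 * T2 -> \bar R) : measurable_fun setT h ->
  (forall z, 0 <= h z)%E ->
  (\int[P]_w h (X w, Y w) = \int[P]_w \int[P]_w' h (X w, Y w'))%E.
Proof.
move=> mh h0.
transitivity (\int[distribution P Z']_z h z)%E.
  by rewrite ge0_integral_distribution.
rewrite (eq_measure_integral (distribution P X \x distribution P Y)%E); last first.
  by move=> A mA _; exact/esym/distrZ.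
rewrite fubini_tonelli1//= ge0_integral_distribution//=.
- apply: eq_integral => w _ /=; rewrite /fubini_F ge0_integral_distribution//.
  exact: measurableT_comp.
- exact: measurable_fun_fubini_tonelli_F.
- by move=> x; apply: integral_ge0.
Qed.

(** Integrability comes first, from the nonnegative case applied to the absolute value; then Fubini
    applies to the signed product. *)
Lemma indep_mfun_expectationM (f : T1 -> R) (g : T2 -> R) :
  measurable_fun setT f -> measurable_fun setT g ->
  P.-integrable setT (EFin \o (f \o X)) -> P.-integrable setT (EFin \o (g \o Y)) ->
  P.-integrable setT (EFin \o (fun w => f (X w) * g (Y w))) /\
  (\int[P]_w (f (X w) * g (Y w))%:E =
   \int[P]_w (f (X w))%:E * \int[P]_w (g (Y w))%:E)%E.
Proof.
move=> mf mg /integrableP[mfX ifX] /integrableP[mgY igY].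
have mfg : measurable_fun setT (fun z : T1 * T2 => (f z.1 * g z.2)%:E).
  by apply/measurable_EFinP; apply: measurable_funM; exact: measurableT_comp.
have mfX' : measurable_fun setT (fun w => `|f (X w)|%:E).
  by apply/measurable_EFinP; apply: measurableT_comp => //; exact: measurableT_comp.
have mgY' : measurable_fun setT (fun w => `|g (Y w)|%:E).
  by apply/measurable_EFinP; apply: measurableT_comp => //; exact: measurableT_comp.
have ifg : P.-integrable setT (EFin \o (fun w => f (X w) * g (Y w))).
  apply/integrableP; split.
    exact: (measurableT_comp mfg mZ).
  rewrite (indep_mfun_ge0_fubini (h := fun z => `|(f z.1 * g z.2)%:E|%E))//; last first.
    exact: measurableT_comp.
  under eq_integral => w _.
    under eq_integral => w' _ do rewrite /= normrM EFinM.
    rewrite ge0_integralZl//=.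
    over.
  rewrite ge0_integralZr//=; last exact: integral_ge0.
  by rewrite lte_mul_pinfty//; [exact: integral_ge0|rewrite ge0_fin_numE//; exact: integral_ge0].
split => //.
transitivity (\int[distribution P Z']_z (f z.1 * g z.2)%:E)%E.
  by rewrite integral_distribution.
rewrite (eq_measure_integral (distribution P X \x distribution P Y)%E); last first.
  by move=> A mA _; exact/esym/distrZ.
have ifg' : (distribution P X \x distribution P Y)%E.-integrable setT
    (fun z : T1 * T2 => (f z.1 * g z.2)%:E).
  apply/integrableP; split => //.
  rewrite (eq_measure_integral (distribution P Z')); last first.
    by move=> A mA _; exact: distrZ.
  rewrite ge0_integral_distribution//; last exact: measurableT_comp.
  by move/integrableP : ifg => [].
rewrite -(fubini1 ifg')/=.
have igD : (distribution P Y).-integrable setT (EFin \o g).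
  apply: integrable_pushforward => //; first exact/measurable_EFinP.
  by apply/integrableP; split.
under eq_integral => x _.
  rewrite /fubini_F /=.
  under eq_integral do rewrite EFinM.
  rewrite integralZl//.
  over.
have igE : (\int[distribution P Y]_y (g y)%:E)%E = (\int[P]_w (g (Y w))%:E)%E.
  by rewrite integral_distribution//; [exact/measurable_EFinP|apply/integrableP; split].
rewrite -igE -(fineK (integrable_fin_num _ igD))//= integralZr//.
- congr (_ * _)%E; rewrite integral_distribution//; [exact/measurable_EFinP|].
  by apply/integrableP; split.
- apply: integrable_pushforward => //; first exact/measurable_EFinP.
  by apply/integrableP; split.
Qed.

End mfun_case.

Lemma indep_ge0_fubini (X : T -> T1) (Y : T -> T2) (h : T1 * T2 -> \bar R) :
  measurable_fun setT X -> measurable_fun setT Y -> indep_rv X Y ->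
  measurable_fun setT h -> (forall z, 0 <= h z)%E ->
  (\int[P]_w h (X w, Y w) = \int[P]_w \int[P]_w' h (X w, Y w'))%E.
Proof.
move=> mX mY XY.
exact: (@indep_mfun_ge0_fubini (HB.pack X (isMeasurableFun.Build _ _ _ _ X mX))
   (HB.pack Y (isMeasurableFun.Build _ _ _ _ Y mY))).
Qed.

Lemma indep_expectationM (X : T -> T1) (Y : T -> T2) (f : T1 -> R) (g : T2 -> R) :
  measurable_fun setT X -> measurable_fun setT Y -> indep_rv X Y ->
  measurable_fun setT f -> measurable_fun setT g ->
  P.-integrable setT (EFin \o (f \o X)) -> P.-integrable setT (EFin \o (g \o Y)) ->
  P.-integrable setT (EFin \o (fun w => f (X w) * g (Y w))) /\
  (\int[P]_w (f (X w) * g (Y w))%:E =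
   \int[P]_w (f (X w))%:E * \int[P]_w (g (Y w))%:E)%E.
Proof.
move=> mX mY XY.
exact: (@indep_mfun_expectationM (HB.pack X (isMeasurableFun.Build _ _ _ _ X mX))
   (HB.pack Y (isMeasurableFun.Build _ _ _ _ Y mY))).
Qed.

End indep_pair.

(** A preimage is the countable union over [k] of its pieces where [Y] equals [k]. This is how a
    random population size is inserted into quantities indexed by a deterministic one. *)
Lemma measurable_fun_select d d' (T : measurableType d) (T' : measurableType d')
    (Y : T -> nat) (f : nat -> T -> T') :
  measurable_fun setT Y -> (forall k, measurable_fun setT (f k)) ->
  measurable_fun setT (fun w => f (Y w) w).
Proof.
move=> mY mf _ V mV; rewrite setTI.
rewrite (_ : _ @^-1` V = \bigcup_k (Y @^-1` [set k] `&` f k @^-1` V)).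
  apply: bigcupT_measurable => k; apply: measurableI.
    by rewrite -[X in measurable X]setTI; exact: mY.
  by rewrite -[X in measurable X]setTI; exact: mf.
apply/seteqP; split => [w /= Vw|w [k _ [/= <-]]//].
by exists (Y w).
Qed.

Import HBNNSimple.

Section same_law.
Context d d1 d2 (T : measurableType d) (T' : measurableType d1)
  (T1 : measurableType d2) (R : realType).

(* With [Z] the identity of a sub-sigma-algebra, this says that [w] is the
   density of [nu] with respect to [mu] on that sub-sigma-algebra. *)
Lemma density_ge0_integral (mu nu : {measure set T -> \bar R}) (Z : T -> T1)
    (w : T -> R) : measurable_fun setT Z -> measurable_fun setT w ->
  (forall x, 0 <= w x) ->
  (forall V, measurable V ->
     nu (Z @^-1` V) = \int[mu]_(x in Z @^-1` V) (w x)%:E)%E ->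
  forall h : T1 -> \bar R, measurable_fun setT h -> (forall z, 0 <= h z)%E ->
  (\int[nu]_x h (Z x) = \int[mu]_x (h (Z x) * (w x)%:E))%E.
Proof.
move=> mZ mw w0 nuE h mh h0.
pose g := nnsfun_approx measurableT mh.
have gh z : (g n z)%:E @[n --> \oo] --> h z by exact: cvg_nnsfun_approx.
have mpre V : measurable V -> measurable (Z @^-1` V).
  by move=> mV; rewrite -[X in measurable X]setTI; exact: mZ.
have mgZ n : measurable_fun setT (fun x => (g n (Z x))%:E).
  by apply/measurable_EFinP; exact: measurableT_comp.
transitivity (limn (fun n => \int[nu]_x (g n (Z x))%:E)%E).
  rewrite -monotone_convergence//.
  - by apply: eq_integral => x _; apply/esym/cvg_lim => //; exact: gh.
  - by move=> n x _; rewrite lee_fin.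
  - by move=> x _ a b ab; rewrite lee_fin; exact/lefP/nd_nnsfun_approx.
transitivity (limn (fun n => \int[mu]_x ((g n (Z x))%:E * (w x)%:E))%E); last first.
  rewrite -monotone_convergence//.
  - apply: eq_integral => x _; apply/cvg_lim => //.
    by apply: cvgeZr => //; exact: gh.
  - by move=> n; apply: emeasurable_funM => //; exact/measurable_EFinP.
  - by move=> n x _; rewrite mule_ge0// lee_fin.
  - move=> x _ a b ab; rewrite lee_wpmul2r// lee_fin//.
    exact/lefP/nd_nnsfun_approx.
congr (limn _); apply/funext => n.
have mI y : measurable_fun setT (fun x => (y * \1_(g n @^-1` [set y]) (Z x))%:E).
  apply/measurable_EFinP; apply: measurable_funM => //.
  by apply: measurableT_comp.
transitivity (\int[nu]_x (\sum_(y \in range (g n)) (y * \1_(g n @^-1` [set y]) (Z x))%:E))%E.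
  by apply: eq_integral => x _; rewrite fsumEFin// -fimfunE.
transitivity (\int[mu]_x (\sum_(y \in range (g n))
    ((y * \1_(g n @^-1` [set y]) (Z x))%:E * (w x)%:E)))%E; last first.
  apply: eq_integral => x _; rewrite -ge0_mule_fsuml.
    by rewrite fsumEFin// -fimfunE.
  by move=> y; exact: nnfun_muleindic_ge0.
rewrite ge0_integral_fsum//; last by move=> *; exact: nnfun_muleindic_ge0.
rewrite ge0_integral_fsum//; last 2 first.
- by move=> y; apply: emeasurable_funM => //; exact/measurable_EFinP.
- by move=> y x _; rewrite mule_ge0//; [exact: nnfun_muleindic_ge0|rewrite lee_fin].
apply: eq_fsbigr => y /[!inE] -[x _ <-].
have [->|] := eqVneq (g n x) 0.
  under eq_integral do rewrite mul0r.
  under [RHS]eq_integral do rewrite mul0r mul0e.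
  by rewrite !integral0.
move=> _; set V := g n @^-1` _.
have mV : measurable V by rewrite /V.
have indE z : \1_V (Z z) = \1_(Z @^-1` V) z :> R by rewrite !indicE.
under eq_integral do rewrite indE EFinM.
rewrite ge0_integralZl//; last 2 first.
- by apply/measurable_EFinP; exact/measurable_indic/mpre.
- by rewrite lee_fin.
under [RHS]eq_integral do rewrite indE EFinM -muleA.
rewrite ge0_integralZl//; last 3 first.
- by apply: emeasurable_funM; apply/measurable_EFinP => //; exact/measurable_indic/mpre.
- by move=> z _; rewrite mule_ge0// lee_fin.
- by rewrite lee_fin.
congr (_ * _)%E.
rewrite integral_indic//=; last exact: mpre.
rewrite setIT nuE// [LHS]integral_mkcond; apply: eq_integral => z _.
by rewrite epatch_indic muleC.
Qed.

Lemma same_law_ge0_integral (P : probability T R) (X Y : T -> T1) :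
  measurable_fun setT X -> measurable_fun setT Y -> same_law P X Y ->
  forall h : T1 -> \bar R, measurable_fun setT h -> (forall z, 0 <= h z)%E ->
  (\int[P]_x h (X x) = \int[P]_x h (Y x))%E.
Proof.
move=> mX mY XY h mh h0.
pose X' : {mfun T >-> T1} := HB.pack X (isMeasurableFun.Build _ _ _ _ X mX).
pose Y' : {mfun T >-> T1} := HB.pack Y (isMeasurableFun.Build _ _ _ _ Y mY).
transitivity (\int[distribution P X']_z h z)%E.
  by rewrite ge0_integral_distribution.
transitivity (\int[distribution P Y']_z h z)%E.
  by apply: eq_measure_integral => A mA _; exact: XY.
by rewrite ge0_integral_distribution.
Qed.

End same_law.

Section indep_sigma.
Context d (T : measurableType d) (R : realType) (P : probability T R).

Definition indep_sets (F G : set (set T)) : Prop :=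
  forall A B, F A -> G B -> P (A `&` B) = (P A * P B)%E.

Lemma indep_sets_sym F G : indep_sets F G -> indep_sets G F.
Proof. by move=> FG A B GA FB; rewrite setIC FG// muleC. Qed.

(** For fixed [B] both sides are finite measures in [A]: the restriction of [P] to [B] and the
    multiple of [P] by [P B]. They agree on a pi-system, hence on the sigma-algebra it generates. *)
Lemma indep_sets_sigmal F G : F `<=` measurable -> G `<=` measurable ->
  F setT -> setI_closed F -> indep_sets F G -> indep_sets <<s F >> G.
Proof.
move=> Fm Gm FT FI FG A B FA GB.
have mB := Gm _ GB.
pose m2 : {measure set T -> \bar R} := mscale (NngNum (fine_ge0 (measure_ge0 P B))) P.
transitivity (mrestr P mB A) => //.
rewrite (@g_sigma_algebra_measure_unique _ _ _ F Fm (fun=> setT) _ _ (mrestr P mB) m2)//.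
- by rewrite /m2 /= /mscale/= fineK ?fin_num_measure// muleC.
- by rewrite bigcup_const//; exists 0%N.
- move=> C FC; rewrite /m2 /= /mscale /mrestr/= fineK ?fin_num_measure// muleC.
  exact: FG.
- by move=> k; rewrite /= /mrestr/= setTI ltey_eq fin_num_measure.
Qed.

Lemma indep_sets_sigma F G : F `<=` measurable -> G `<=` measurable ->
  F setT -> setI_closed F -> G setT -> setI_closed G ->
  indep_sets F G -> indep_sets <<s F >> <<s G >>.
Proof.
move=> Fm Gm FT FI GT GI FG.
apply: indep_sets_sigmal => //.
  by apply: smallest_sub => //; exact: sigma_algebra_measurable.
by apply/indep_sets_sym/indep_sets_sigmal => //; exact/indep_sets_sym.
Qed.

Section family.
Context d' (T' : measurableType d') (I : choiceType) (X : I -> T -> T').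
Hypothesis mX : forall i, measurable_fun setT (X i).

(** The pi-system behind [sigma_gen]. Duplicate-free lists and total families [U] match the shape in
    which [mutually_independent] is stated. *)
Definition cylinders (J : set I) : set (set T) :=
  [set A | exists s : seq I, exists U : I -> set T',
    [/\ uniq s, forall i, i \in s -> J i, forall i, measurable (U i) &
      A = \bigcap_(i in [set` s]) (X i @^-1` U i)]].

Lemma cylindersT J : cylinders J setT.
Proof.
exists [::], (fun=> setT); split => //.
by rewrite set_nil bigcap_set0.
Qed.

Lemma cylindersI J : setI_closed (cylinders J).
Proof.
move=> _ _ [s [U [us sJ mU ->]]] [t [V [ut tJ mV ->]]].
(* An index outside one of the lists is constrained there by the whole space. *)
pose W i := (if i \in s then U i else setT) `&` (if i \in t then V i else setT).
exists (undup (s ++ t)), W; split.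
- exact: undup_uniq.
- by move=> i; rewrite mem_undup mem_cat => /orP[/sJ|/tJ].
- by move=> i; apply: measurableI; case: ifP.
- apply/seteqP; split=> [w [sw tw] i _|w stw].
    by split; case: ifPn => //= h; [exact: sw|exact: tw].
  split=> i /= h; have := stw i; rewrite /= mem_undup mem_cat h ?orbT /W /= h.
    by move=> /(_ isT)[].
  by move=> /(_ isT)[].
Qed.

Lemma cylinders_measurable J : cylinders J `<=` measurable.
Proof.
move=> _ [s [U [_ _ mU ->]]]; rewrite bigcap_seq.
by apply: bigsetI_measurable => i _; rewrite -[X in measurable X]setTI; exact: mX.
Qed.

Lemma sub_sigma_cylinders J : sigma_gen J X `<=` <<s cylinders J >>.
Proof.
apply: smallest_sub; first exact: smallest_sigma_algebra.
move=> A [i Ji [V mV <-]]; apply: sub_sigma_algebra.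
exists [:: i], (fun=> V); split => //.
  by move=> j; rewrite inE => /eqP ->.
by rewrite set_cons1 bigcap_set1 setTI.
Qed.

(** Two cylinders over disjoint index sets form one cylinder over the concatenated list, where the
    product rule splits; the pi-system argument does the rest. *)
Lemma sigma_gen_indep J K : J `&` K `<=` set0 -> mutually_independent P X ->
  indep_sets (sigma_gen J X) (sigma_gen K X).
Proof.
move=> JK indX A B /sub_sigma_cylinders JA /sub_sigma_cylinders KB.
apply: (@indep_sets_sigma (cylinders J) (cylinders K)) => //;
  try exact: cylinders_measurable; try exact: cylindersT; try exact: cylindersI.
move=> _ _ [s [U [us sJ mU ->]]] [t [V [ut tK mV ->]]].
pose W i := if i \in s then U i else V i.
have st i : i \in t -> i \notin s.
  by move=> it; apply/negP => is_; exact: (JK i (conj (sJ _ is_) (tK _ it))).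
have mW i : measurable (W i) by rewrite /W; case: ifP.
rewrite !indX// (_ : _ `&` _ = \bigcap_(i in [set` s ++ t]) (X i @^-1` W i)); last first.
  apply/seteqP; split=> [w [sw tw] i|w stw].
    rewrite /= mem_cat /W => /orP[si|ti]; first by rewrite si; exact: sw.
    by rewrite (negPf (st _ ti)); exact: tw.
  split=> i /= h; have := stw i; rewrite /= mem_cat h ?orbT /W => /(_ isT).
    by rewrite h.
  by rewrite (negPf (st _ h)).
rewrite indX//; last first.
  rewrite cat_uniq us ut andbT/=; apply/hasPn => i it; exact: st.
rewrite big_cat/=; congr (_ * _)%E; rewrite !big_seq; apply: eq_bigr => i.
  by rewrite /W => ->.
by move=> it; rewrite /W (negPf (st _ it)).
Qed.

Lemma sigma_gen_measurable J : sigma_gen J X `<=` measurable.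
Proof.
apply: smallest_sub; first exact: sigma_algebra_measurable.
by move=> A [i Ji [V mV <-]]; exact: mX.
Qed.

End family.

End indep_sigma.


(** * Sub-sigma-algebras generated by selected variables of the process *)

Section history.
Context d (Omega : measurableType d) de (Env : measurableType de).
Variable S : cbp Omega Env.

(* The initial state is included when [b] holds. *)
Definition history_rect (b : bool) (J : set (nat * nat)) (K : set nat) :
    set (set Omega) :=
  [set A | exists A0 A1 A2, [/\ sigma_X0 S A0, sigma_gen J (xi_array S) A1,
     sigma_gen K (mark S) A2, (b = false -> A0 = setT) & A = A0 `&` A1 `&` A2]].

(** The space [Omega] with a smaller sigma-algebra, so that [measurable_fun (setT : set (history b J
    K)) f] expresses measurability of [f] with respect to the selected variables. *)
Definition history b J K : measurableType _ :=
  g_sigma_algebraType (history_rect b J K).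

Lemma sigma_gen_sub d' (T' : measurableType d') (I : Type) (J J' : set I)
    (X : I -> Omega -> T') : J `<=` J' -> sigma_gen J X `<=` sigma_gen J' X.
Proof.
move=> JJ'; apply: smallest_sub; first exact: smallest_sigma_algebra.
move=> A [i Ji JA]; apply: sub_sigma_algebra; exists i => //; exact: JJ'.
Qed.

Lemma sigma_genT d' (T' : measurableType d') (I : Type) (J : set I)
    (X : I -> Omega -> T') : sigma_gen J X setT.
Proof. exact: (@measurableT _ (g_sigma_algebraType _)). Qed.

Lemma sigma_genI d' (T' : measurableType d') (I : Type) (J : set I)
    (X : I -> Omega -> T') : setI_closed (sigma_gen J X).
Proof. by move=> A B FA FB; exact: (@measurableI _ (g_sigma_algebraType _)). Qed.

Lemma history_rectT b J K : history_rect b J K setT.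
Proof.
by exists setT, setT, setT; split; rewrite ?setIT//; exact: sigma_genT.
Qed.

Lemma history_rectI b J K : setI_closed (history_rect b J K).
Proof.
move=> _ _ [A0 [A1 [A2 [hA0 hA1 hA2 bA ->]]]] [B0 [B1 [B2 [hB0 hB1 hB2 bB ->]]]].
exists (A0 `&` B0), (A1 `&` B1), (A2 `&` B2); split; try exact: sigma_genI.
- by move=> bF; rewrite bA// bB// setIT.
- by rewrite setIACA; congr (_ `&` _); rewrite setIACA.
Qed.

Lemma history_rect_measurable b J K : history_rect b J K `<=` measurable.
Proof.
move=> _ [A0 [A1 [A2 [hA0 hA1 hA2 _ ->]]]].
apply: measurableI; first apply: measurableI.
- by apply: sigma_gen_measurable hA0 => i; exact: measurable_funP.
- by apply: sigma_gen_measurable hA1 => i; exact: measurable_funP.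
- by apply: sigma_gen_measurable hA2 => i; exact: measurable_funP.
Qed.

Lemma history_measurable b J K : <<s history_rect b J K >> `<=` measurable.
Proof.
apply: smallest_sub; first exact: sigma_algebra_measurable.
exact: history_rect_measurable.
Qed.

Lemma history_rect_sub (b b' : bool) J J' K K' : (b -> b') -> J `<=` J' -> K `<=` K' ->
  history_rect b J K `<=` history_rect b' J' K'.
Proof.
move=> bb' JJ' KK' _ [A0 [A1 [A2 [hA0 hA1 hA2 bA ->]]]].
exists A0, A1, A2; split=> //; [exact: sigma_gen_sub hA1|exact: sigma_gen_sub hA2|].
by move=> b'F; apply: bA; apply/negP => /bb'; rewrite b'F.
Qed.

Lemma measurable_fun_history b J K d' (T' : measurableType d')
    (f : Omega -> T') : measurable_fun (setT : set (history b J K)) f ->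
  measurable_fun setT f.
Proof.
by move=> mf _ V mV; apply: (@history_measurable b J K); exact: mf.
Qed.

Lemma history_preimage b J K d' (T' : measurableType d') (f : Omega -> T') V :
  measurable_fun (setT : set (history b J K)) f -> measurable V ->
  <<s history_rect b J K >> (f @^-1` V).
Proof. by move=> mf mV; rewrite -[X in _ X]setTI; exact: mf. Qed.

Lemma measurable_X0_history J K : measurable_fun (setT : set (history true J K)) (X0 S).
Proof.
move=> _ V mV; apply: sub_sigma_algebra.
exists (setT `&` X0 S @^-1` V), setT, setT; split; rewrite ?setIT//; try exact: sigma_genT.
by apply: sub_sigma_algebra; exists tt => //; exists V.
Qed.

Lemma measurable_xi_history b J K n j : J (n, j) ->
  measurable_fun (setT : set (history b J K)) (xi S n j).
Proof.
move=> Jnj _ V mV; apply: sub_sigma_algebra.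
exists setT, (setT `&` xi S n j @^-1` V), setT; split; rewrite ?setIT ?setTI//; try exact: sigma_genT.
by apply: sub_sigma_algebra; exists (n, j) => //; exists V => //; rewrite setTI.
Qed.

Lemma measurable_mark_history b J K n : K n ->
  measurable_fun (setT : set (history b J K)) (mark S n).
Proof.
move=> Kn _ V mV; apply: sub_sigma_algebra.
exists setT, setT, (setT `&` mark S n @^-1` V); split; rewrite ?setIT ?setTI//; try exact: sigma_genT.
by apply: sub_sigma_algebra; exists n => //; exists V => //; rewrite setTI.
Qed.

Variables (R : realType) (P : probability Omega R).
Hypothesis xi_ind : mutually_independent P (xi_array S).
Hypothesis mark_ind : mutually_independent P (mark S).
Hypothesis blocks : independent3 P (sigma_X0 S) (sigma_xi S) (sigma_marks S).

(** On rectangles the three blocks separate, and inside each block disjoint index sets give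
    independence. The first condition lets at most one side use the initial state; the other side
    then contributes the whole space to that block. *)
Lemma history_indep (b b' : bool) J J' K K' : ~~ (b && b') ->
  J `&` J' `<=` set0 -> K `&` K' `<=` set0 ->
  indep_sets P <<s history_rect b J K >> <<s history_rect b' J' K' >>.
Proof.
move=> bb' JJ' KK'; apply: indep_sets_sigma; try exact: history_rect_measurable;
  try exact: history_rectT; try exact: history_rectI.
move=> _ _ [A0 [A1 [A2 [hA0 hA1 hA2 bA ->]]]] [B0 [B1 [B2 [hB0 hB1 hB2 bB ->]]]].
have sub1 L A : sigma_gen L (xi_array S) A -> sigma_xi S A by exact: sigma_gen_sub.
have sub2 L A : sigma_gen L (mark S) A -> sigma_marks S A by exact: sigma_gen_sub.
rewrite setIACA (setIACA A0 A1).
rewrite !blocks//; try (by apply: sigma_genI); try exact: sub1; try exact: sub2.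
- rewrite (sigma_gen_indep _ JJ' xi_ind hA1 hB1); last by move=> i; exact: measurable_funP.
  rewrite (sigma_gen_indep _ KK' mark_ind hA2 hB2); last by move=> i; exact: measurable_funP.
  have -> : (P (A0 `&` B0) = P A0 * P B0)%E.
    case: b b' bA bB bb' => [] [] // bA bB _.
    + by rewrite bB// setIT probability_setT mule1.
    + by rewrite bA// setTI probability_setT mul1e.
    + by rewrite bA// setTI probability_setT mul1e.
  rewrite (muleACA (P A0)). rewrite [LHS]muleACA. by [].
- exact: sub1 hB1.
- exact: sub2 hB2.
- exact: sub1 hA1.
- exact: sub2 hA2.
- by apply: sigma_genI; [exact: sub1 hA1|exact: sub1 hB1].
- by apply: sigma_genI; [exact: sub2 hA2|exact: sub2 hB2].
Qed.

Lemma history_indep_rv (b b' : bool) J J' K K' d1 (T1 : measurableType d1)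
    d2 (T2 : measurableType d2) (X : Omega -> T1) (Y : Omega -> T2) :
  ~~ (b && b') -> J `&` J' `<=` set0 -> K `&` K' `<=` set0 ->
  measurable_fun (setT : set (history b J K)) X ->
  measurable_fun (setT : set (history b' J' K')) Y -> indep_rv P X Y.
Proof.
move=> bb' JJ' KK' mX mY U V mU mV.
by apply: (history_indep bb' JJ' KK'); exact: history_preimage.
Qed.

End history.

(** * Measurability and independence of the past of the process *)

Section nat_valued.
Context d d' (T : measurableType d) (T' : measurableType d') (R : realType).

Lemma measurable_fun_nat_comp (f : nat -> T') (Y : T -> nat) :
  measurable_fun setT Y -> measurable_fun setT (fun w => f (Y w)).
Proof. by move=> mY; apply: (measurableT_comp _ mY). Qed.

Lemma measurable_fun_nat2_comp (f : nat -> nat -> T') (Y Z : T -> nat) :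
  measurable_fun setT Y -> measurable_fun setT Z ->
  measurable_fun setT (fun w => f (Y w) (Z w)).
Proof.
move=> mY mZ; apply: (@measurable_fun_select _ _ _ _ Y (fun k w => f k (Z w))) => // k.
by apply: (measurableT_comp _ mZ).
Qed.

Lemma measurable_fun_prod_nat2 (f : nat * nat -> T') : measurable_fun setT f.
Proof.
apply: (eq_measurable_fun (fun z : nat * nat => f (z.1, z.2))) => [[]//|].
apply: (@measurable_fun_select _ _ _ _ (fst : nat * nat -> nat) (fun k z => f (k, z.2))) => //.
move=> k; exact: (measurableT_comp (f := fun l => f (k, l))).
Qed.

(** Replaces conditioning on a discrete variable: on each piece of the integral the random index [Y]
    becomes a constant. *)
Lemma ge0_integral_nat_fibers (mu : {measure set T -> \bar R}) (G : set T)
    (Y : T -> nat) (f : T -> \bar R) :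
  measurable G -> measurable_fun setT Y -> measurable_fun setT f ->
  (forall w, 0 <= f w)%E ->
  (\int[mu]_(w in G) f w =
   \sum_(k <oo) \int[mu]_(w in G `&` Y @^-1` [set k]) f w)%E.
Proof.
move=> mG mY mf f0.
rewrite -ge0_integral_bigcup//.
- rewrite -setI_bigcupr (_ : \bigcup_i _ = setT) ?setIT//.
  by apply/seteqP; split=> // w _; exists (Y w).
- move=> k; apply: measurableI => //.
  by rewrite -[X in measurable X]setTI; exact: mY.
- exact: measurable_funTS.
- apply/trivIsetP => i j _ _ ij; apply/seteqP; split=> // w [[_ /= Yi] [_ /= Yj]].
  by move: ij; rewrite -Yi -Yj eqxx.
Qed.

End nat_valued.

Section process_measurability.
Context d (Omega : measurableType d) de (Env : measurableType de).
Variable S : cbp Omega Env.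
Variables (R : realType) (m lambda : R).

Definition row_sum (n N : nat) (w : Omega) : nat := (\sum_(j < N) xi S n j w)%N.

Definition markA (n : nat) (w : Omega) : nat := ctlA (ctl S) (mark S n w).

(* [noise n k] is a copy of [D k] driven by generation [n]. *)
Definition noise (n k : nat) (w : Omega) : R :=
  (Psi S n k w)%:R - M S m lambda n w * k%:R.

Definition Delta_from (k n : nat) (w : Omega) : R :=
  \prod_(k <= j < n) M S m lambda j w.

Variables (b : bool) (J : set (nat * nat)) (K : set nat).
Local Notation H := (history S b J K).

Lemma measurable_row_sum n N : (forall j, (j < N)%N -> J (n, j)) ->
  measurable_fun (setT : set H) (row_sum n N).
Proof.
elim: N => [|N IH] hJ.
  rewrite (_ : row_sum n 0 = cst 0%N)//.
  by apply/funext => w; rewrite /row_sum big_ord0.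
rewrite (_ : row_sum n N.+1 = (fun w => (row_sum n N w + xi S n N w)%N)); last first.
  by apply/funext => w; rewrite /row_sum big_ord_recr.
apply: (@measurable_fun_nat2_comp _ _ H) => //.
  by apply: IH => j jN; apply: hJ; rewrite (ltn_trans jN).
by apply: measurable_xi_history; exact: hJ.
Qed.

Lemma measurable_markA n : K n -> measurable_fun (setT : set H) (markA n).
Proof.
by move=> Kn; apply: (measurableT_comp (f := ctlA (ctl S))) => //; exact: measurable_mark_history.
Qed.

Lemma measurable_phi n k : K n -> measurable_fun (setT : set H) (phi S n k).
Proof.
move=> Kn; apply: (@measurable_fun_nat2_comp _ _ H _ addn).
  apply: (@measurable_fun_nat2_comp _ _ H _ muln); first exact: measurable_markA.
  by apply: (measurableT_comp (f := ctlC (ctl S) k)) => //; exact: measurable_mark_history.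
by apply: (measurableT_comp (f := ctlB (ctl S))) => //; exact: measurable_mark_history.
Qed.

Lemma measurable_Psi n k : K n -> (forall j, J (n, j)) ->
  measurable_fun (setT : set H) (Psi S n k).
Proof.
move=> Kn Jn; apply: (@measurable_fun_select _ _ H _ (phi S n k) (row_sum n)).
  exact: measurable_phi.
by move=> N; exact: measurable_row_sum.
Qed.

Lemma measurable_M n : K n -> measurable_fun (setT : set H) (M S m lambda n).
Proof.
move=> Kn; apply: (@measurable_fun_nat_comp _ _ H _ (fun a => m * lambda * a%:R)).
exact: measurable_markA.
Qed.

Lemma measurable_noise n k : K n -> (forall j, J (n, j)) ->
  measurable_fun (setT : set H) (noise n k).
Proof.
move=> Kn Jn; apply: measurable_funB.
  by apply: (@measurable_fun_nat_comp _ _ H _ (fun a => a%:R : R)); exact: measurable_Psi.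
by apply: measurable_funM => //; exact: measurable_M.
Qed.

Lemma measurable_Delta_from k n : (forall j, (k <= j < n)%N -> K j) ->
  measurable_fun (setT : set H) (Delta_from k n).
Proof.
elim: n => [|n IH] Kn.
  rewrite (_ : Delta_from k _ = cst 1)//.
  by apply/funext => w; rewrite /Delta_from big_geq.
have [kn|nk] := leqP k n; last first.
  rewrite (_ : Delta_from k _ = cst 1)//.
  by apply/funext => w; rewrite /Delta_from big_geq.
rewrite (_ : Delta_from k n.+1 = (fun w => Delta_from k n w * M S m lambda n w)); last first.
  by apply/funext => w; rewrite /Delta_from big_nat_recr.
apply: measurable_funM; last by apply: measurable_M; apply: Kn; rewrite kn/=.
by apply: IH => j /andP[kj jn]; apply: Kn; rewrite kj ltnW.
Qed.

End process_measurability.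

Lemma Delta_fromE d (Omega : measurableType d) de (Env : measurableType de)
    (S : cbp Omega Env) (R : realType) (m lambda : R) n w :
  Delta S m lambda n w = Delta_from S m lambda 0 n w.
Proof. by rewrite /Delta /Delta_from big_mkord. Qed.

Lemma measurable_X_history d (Omega : measurableType d) de (Env : measurableType de)
    (S : cbp Omega Env) (J : set (nat * nat)) (K : set nat) n :
  (forall i, (i < n)%N -> K i) -> (forall i j, (i < n)%N -> J (i, j)) ->
  measurable_fun (setT : set (history S true J K)) (X S n).
Proof.
elim: n => [|n IH] Kn Jn; first exact: measurable_X0_history.
apply: (@measurable_fun_select _ _ (history S true J K) _ (X S n) (Psi S n)).
  by apply: IH => *; [apply: Kn|apply: Jn]; exact: ltnW.
by move=> k; apply: measurable_Psi => *; [apply: Kn|apply: Jn].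
Qed.

Section laws.
Context d (Omega : measurableType d) de (Env : measurableType de).
Variable S : cbp Omega Env.
Variables (R : realType) (m lambda : R) (P : probability Omega R).
Hypothesis law_P : cbp_law S m P.

Let mfun_of b J K d' (T' : measurableType d') (f : Omega -> T') :
  measurable_fun (setT : set (history S b J K)) f -> measurable_fun setT f.
Proof. exact: measurable_fun_history. Qed.

Lemma law_indep_rv (b b' : bool) J J' K K' d1 (T1 : measurableType d1)
    d2 (T2 : measurableType d2) (X : Omega -> T1) (Y : Omega -> T2) :
  ~~ (b && b') -> J `&` J' `<=` set0 -> K `&` K' `<=` set0 ->
  measurable_fun (setT : set (history S b J K)) X ->
  measurable_fun (setT : set (history S b' J' K')) Y -> indep_rv P X Y.
Proof.
by case: law_P => _ xii _ _ _ mi bi; exact: history_indep_rv.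
Qed.

Lemma indep_ge0_integral (b b' : bool) J J' K K' (G : set Omega) (f : Omega -> \bar R) :
  ~~ (b && b') -> J `&` J' `<=` set0 -> K `&` K' `<=` set0 ->
  <<s history_rect S b J K >> G ->
  measurable_fun (setT : set (history S b' J' K')) f -> (forall w, 0 <= f w)%E ->
  (\int[P]_(w in G) f w = P G * \int[P]_w f w)%E.
Proof.
move=> bb' JJ' KK' hG hf f0.
have mG : measurable G by exact: history_measurable hG.
have mf : measurable_fun setT f by exact: mfun_of hf.
have h1 : measurable_fun (setT : set (history S b J K)) (\1_G : Omega -> R).
  exact: (@measurable_indic _ (history S b J K)).
(* The absolute values make [h] nonnegative everywhere, as the iterated integral formula demands;
   they do not change the values actually taken. *)
pose h (z : R * \bar R) := (`|z.1%:E| * `|z.2|)%E.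
have mh : measurable_fun setT h.
  apply: emeasurable_funM; apply: measurableT_comp => //.
  by apply/measurable_EFinP; exact: measurable_fst.
transitivity (\int[P]_w h (\1_G w, f w))%E.
  rewrite integral_mkcond; apply: eq_integral => w _.
  by rewrite epatch_indic /h/= muleC ger0_norm// gee0_abs.
rewrite (@indep_ge0_fubini _ _ _ _ _ _ _ P (\1_G : Omega -> R) f)//; last 2 first.
- exact: (law_indep_rv bb' JJ' KK').
- by move=> z; rewrite /h mule_ge0.
under eq_integral => w _.
  rewrite /h /=.
  under eq_integral do rewrite ger0_norm// gee0_abs//.
  rewrite ge0_integralZl//.
  over.
rewrite ge0_integralZr//; last 2 first.
- exact/measurable_EFinP/measurable_indic.
- exact: integral_ge0.
by rewrite integral_indic// setIT.
Qed.

(** Induction on the length: the last summand is independent of the partial row and distributed as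
    [xi S 0 0], so it can be integrated out. [h] is general because the induction hypothesis is
    applied to the averaged function. *)
Lemma row_sum_ge0_integral n N (h : nat -> \bar R) : (forall k, 0 <= h k)%E ->
  (\int[P]_w h (row_sum S n N w) = \int[P]_w h (row_sum S 0 N w))%E.
Proof.
have mrow k L : measurable_fun setT (row_sum S k L).
  by apply: (@mfun_of false setT setT); exact: measurable_row_sum.
elim: N h => [|N IH] h h0.
  by apply: eq_integral => w _; rewrite /row_sum !big_ord0.
have step k : (\int[P]_w h (row_sum S k N.+1 w) =
    \int[P]_w \int[P]_w' h (row_sum S k N w + xi S 0 0 w')%N)%E.
  transitivity (\int[P]_w (fun z : nat * nat => h (z.1 + z.2)%N) (row_sum S k N w, xi S k N w))%E.
    by apply: eq_integral => w _; rewrite /row_sum big_ord_recr.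
  have ind : indep_rv P (row_sum S k N) (xi S k N).
    apply: (@law_indep_rv false false [set nj | nj.1 = k /\ (nj.2 < N)%N]
      [set nj | nj = (k, N)] set0 set0) => //.
    - by move=> [a c] /= [[_ cN] [_ E]]; move: cN; rewrite E ltnn.
    - by apply: measurable_row_sum.
    - exact: measurable_xi_history.
  transitivity (\int[P]_w \int[P]_w' h (row_sum S k N w + xi S k N w')%N)%E.
    by apply: (@indep_ge0_fubini _ _ _ _ _ _ _ P _ _ (fun z : nat * nat => h (z.1 + z.2)%N)
      (mrow k N) _ ind (measurable_fun_prod_nat2 _)).
  apply: eq_integral => w _.
  apply: (@same_law_ge0_integral _ _ _ _ _ P (xi S k N) (xi S 0 0) _ _ _
    (fun x => h (row_sum S k N w + x)%N)) => //.
  by case: law_P => xs *; exact: xs.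
rewrite !step (IH (fun x => \int[P]_w' h (x + xi S 0 0 w')%N)%E)// => k.
exact: integral_ge0.
Qed.

(** The mark and the population it produces are dependent, so it is their joint law that must be
    shown free of the generation. Where the control equals [L], the population is a row sum of fixed
    length, independent of the mark. *)
Lemma markA_Psi_ge0_integral n k (h : nat -> nat -> \bar R) : (forall a x, 0 <= h a x)%E ->
  (\int[P]_w h (markA S n w) (Psi S n k w) = \int[P]_w h (markA S 0 w) (Psi S 0 k w))%E.
Proof.
move=> h0.
pose N e := (ctlA (ctl S) e * ctlC (ctl S) k e + ctlB (ctl S) e)%N.
pose g L (z : Env * nat) := (if N z.1 == L then h (ctlA (ctl S) z.1) z.2 else 0)%E.
have mN : measurable_fun setT N.
  by apply: measurable_fun_nat2_comp => //; exact: measurable_fun_nat2_comp.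
have mg L : measurable_fun setT (g L).
  pose G (x : nat) (z : Env * nat) := (if x == L then h (ctlA (ctl S) z.1) z.2 else 0)%E.
  apply: (@measurable_fun_select _ _ _ _ (N \o fst) G) => [|x].
    exact: measurableT_comp.
  rewrite /G; case: eqP => _ //.
  apply: (@measurable_fun_nat2_comp _ _ _ _ h) => //.
  exact: measurableT_comp.
have g0 L z : (0 <= g L z)%E by rewrite /g; case: ifP.
have mrow i L : measurable_fun setT (row_sum S i L).
  by apply: (@mfun_of false setT setT); exact: measurable_row_sum.
suff E i : (\int[P]_w h (markA S i w) (Psi S i k w) =
    \sum_(L <oo) \int[P]_w \int[P]_w' g L (mark S 0 w, row_sum S 0 L w'))%E by rewrite !E.
rewrite (@ge0_integral_nat_fibers _ _ _ _ setT (phi S i k))//; last 2 first.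
- by apply: (@mfun_of false setT setT); exact: measurable_phi.
- apply: (@mfun_of false setT setT).
  apply: (@measurable_fun_nat2_comp _ _ (history S false setT setT)); first exact: measurable_markA.
  exact: measurable_Psi.
apply: eq_eseriesr => L _.
transitivity (\int[P]_w g L (mark S i w, row_sum S i L w))%E.
  rewrite integral_mkcond; apply: eq_integral => w _.
  rewrite setTI patchE /g /N/= -/(phi S i k w).
  have [pL|pL] := eqVneq (phi S i k w) L; first by rewrite mem_set// /Psi pL.
  by rewrite memNset//=; exact/eqP.
have ind : indep_rv P (mark S i) (row_sum S i L).
  apply: (@law_indep_rv false false set0 setT setT set0) => //; try by move=> a [].
  - exact: measurable_mark_history.
  - exact: measurable_row_sum.
transitivity (\int[P]_w \int[P]_w' g L (mark S i w, row_sum S i L w'))%E.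
  exact: (indep_ge0_fubini (measurable_funP _) (mrow i L) ind (mg L) (g0 L)).
under eq_integral do rewrite (@row_sum_ge0_integral i L (fun x => g L (mark S i _, x)))//.
apply: (@same_law_ge0_integral _ _ _ _ _ P (mark S i) (mark S 0) _ _ _
    (fun e => \int[P]_w' g L (e, row_sum S 0 L w'))%E) => //.
- by case: law_P => _ _ _ _ ms *; exact: ms.
- apply: (@measurable_fun_fubini_tonelli_F _ _ _ _ _ P (fun z => g L (z.1, row_sum S 0 L z.2))) => //.
  apply: (measurableT_comp (mg L)); apply/measurable_fun_pairP; split => //=.
    exact: measurable_fst.
  by apply: (measurableT_comp (mrow 0 L)); exact: measurable_snd.
- by move=> e; exact: integral_ge0.
Qed.

Definition past n : set (set Omega) :=
  history_rect S true [set ij | (ij.1 < n)%N] [set i | (i < n)%N].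

Lemma noise_ge0_integral n k (h : R -> \bar R) : (forall x, 0 <= h x)%E ->
  (\int[P]_w h (noise S m lambda n k w) = \int[P]_w h (D S m lambda k w))%E.
Proof.
move=> h0.
exact: (markA_Psi_ge0_integral n k (h := fun a x => h (x%:R - m * lambda * a%:R * k%:R))).
Qed.

Lemma past_measurable n : <<s past n >> `<=` measurable.
Proof. exact: history_measurable. Qed.

Lemma measurable_X n : measurable_fun setT (X S n).
Proof. by apply: (@mfun_of true setT setT); exact: measurable_X_history. Qed.

(** The Markov property in integrated form. On the part of [G] where [X S n] equals [k], still an
    event of the past, the noise is a function of generation [n] alone, which is independent of the
    past; it has the law of [D k]. *)
Lemma noise_ge0_integral_past n (G : set Omega) (h : R -> \bar R) :
  <<s past n >> G -> measurable_fun setT h -> (forall x, 0 <= h x)%E ->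
  (\int[P]_(w in G) h (noise S m lambda n (X S n w) w) =
   \sum_(k <oo) P (G `&` X S n @^-1` [set k]) * \int[P]_w h (D S m lambda k w))%E.
Proof.
move=> hG mh h0.
have mG := past_measurable hG.
have mnoise k : measurable_fun setT (noise S m lambda n k).
  by apply: (@mfun_of false setT setT); exact: measurable_noise.
rewrite (@ge0_integral_nat_fibers _ _ _ _ _ (X S n))//; last 2 first.
- exact: measurable_X.
- apply: (measurableT_comp mh).
  by apply: (@measurable_fun_select _ _ _ _ (X S n)); first exact: measurable_X.
apply: eq_eseriesr => k _.
have hGk : <<s past n >> (G `&` X S n @^-1` [set k]).
  apply: (@measurableI _ (g_sigma_algebraType (past n))) => //.
  by apply: history_preimage => //; exact: measurable_X_history.
transitivity (\int[P]_(w in G `&` X S n @^-1` [set k]) h (noise S m lambda n k w))%E.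
  by apply: eq_integral => w; rewrite inE => -[_ /= ->].
rewrite (@indep_ge0_integral true false _ [set ij | ij.1 = n] _ [set n] _ _ _ _ _ hGk)//.
- by rewrite noise_ge0_integral.
- by move=> [i j] /= [+ E]; rewrite E ltnn.
- by move=> i /= [+ E]; rewrite E ltnn.
- apply: (measurableT_comp mh); exact: measurable_noise.
Qed.

End laws.

(** * Change of measure from P to the tilted law *)

Section density_measure.
Local Open Scope ereal_scope.
Context d (T : measurableType d) (R : realType) (mu : {measure set T -> \bar R}).
Variable f : T -> \bar R.

(** The proofs [mf] and [f0] are arguments so that the measure structure declared below can be
    attached to the term. *)
Definition density_measure (mf : measurable_fun setT f) (f0 : forall x, 0 <= f x)
  (A : set T) : \bar R := \int[mu]_(x in A) f x.

Hypotheses (mf : measurable_fun setT f) (f0 : forall x, 0 <= f x).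

Let density0 : density_measure mf f0 set0 = 0.
Proof. by rewrite /density_measure integral_set0. Qed.

Let density_ge0 A : 0 <= density_measure mf f0 A.
Proof. exact: integral_ge0. Qed.

Let density_sigma_additive : semi_sigma_additive (density_measure mf f0).
Proof.
move=> F mF tF mUF; rewrite /density_measure/= ge0_integral_bigcup//=; last first.
  exact: measurable_funTS.
by apply: is_cvg_ereal_nneg_natsum_cond => n _ _; exact: integral_ge0.
Qed.

HB.instance Definition _ := isMeasure.Build _ _ _ (density_measure mf f0)
  density0 density_ge0 density_sigma_additive.

End density_measure.

Section tilting.
Context d (Omega : measurableType d) de (Env : measurableType de).
Variable S : cbp Omega Env.
Variables (R : realType) (m lambda alpha : R) (P Pa : probability Omega R).
Hypothesis law_P : cbp_law S m P.
Hypothesis law_Pa : tilted_law S m lambda P alpha Pa.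
Local Notation Lam := (Lambda S m lambda P alpha).
Local Notation Delta := (Delta S m lambda).

Definition tilt n (w : Omega) : R := Delta n w `^ alpha * expR (- (n%:R * Lam)).

(* All the offspring variables are included: the tilting does not affect them. *)
Definition known n : set (set Omega) := history_rect S true setT [set i | (i < n)%N].

Lemma tilt_ge0 n w : 0 <= tilt n w.
Proof. by rewrite mulr_ge0 ?powR_ge0 ?expR_ge0. Qed.

Lemma measurable_Delta_history b J K n : (forall i, (i < n)%N -> K i) ->
  measurable_fun (setT : set (history S b J K)) (Delta n).
Proof.
move=> Kn; rewrite (_ : Delta n = Delta_from S m lambda 0 n); last first.
  by apply/funext => w; rewrite Delta_fromE.
by apply: measurable_Delta_from => j /andP[_ jn]; exact: Kn.
Qed.

Lemma measurable_tilt_history b J K n : (forall i, (i < n)%N -> K i) ->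
  measurable_fun (setT : set (history S b J K)) (tilt n).
Proof.
move=> Kn; apply: measurable_funM => //.
apply: (measurableT_comp (f := (@powR R)^~ alpha)); first exact: measurable_powR.
exact: measurable_Delta_history.
Qed.

Lemma measurable_tilt n : measurable_fun setT (tilt n).
Proof.
by apply: (@measurable_fun_history _ _ _ _ S false setT setT); exact: measurable_tilt_history.
Qed.

(** [tilted_law] gives the density on events of the first [n] marks. It extends to events that also
    involve the initial state and all offspring variables, since these blocks are independent of the
    marks under both laws and have the same law under both; measures that agree on rectangles
    agree. *)
Lemma tilt_known n A : <<s known n >> A -> (Pa A = \int[P]_(w in A) (tilt n w)%:E)%E.
Proof.
move=> hA.
have mt : measurable_fun setT (EFin \o tilt n) by apply/measurable_EFinP; exact: measurable_tilt.
have t0 w : (0 <= (EFin \o tilt n) w)%E by rewrite lee_fin tilt_ge0.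
apply: (@g_sigma_algebra_measure_unique _ _ _ (known n) _ (fun=> setT) _ _
  Pa (density_measure P mt t0)) => //.
- exact: history_rect_measurable.
- by move=> _; exact: history_rectT.
- by rewrite bigcup_const//; exists 0%N.
- exact: history_rectI.
- move=> _ [A0 [A1 [A2 [hA0 hA1 hA2 _ ->]]]].
  rewrite /density_measure/=.
  have hA2' : sigma_marks S A2 by exact: sigma_gen_sub hA2.
  rewrite (tilted_blocks_indep law_Pa hA0 hA1 hA2').
  rewrite (tilted_X0 law_Pa hA0) (tilted_xi law_Pa hA1) (tilted_marks law_Pa hA2).
  have -> : (P A0 * P A1 = P (A0 `&` A1))%E.
    rewrite -[in RHS](setIT (A0 `&` A1)) (blocks_indep law_P hA0 hA1).
      by rewrite probability_setT mule1.
    exact: sigma_genT.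
  have h01 : <<s history_rect S true setT set0 >> (A0 `&` A1).
    apply: sub_sigma_algebra; exists A0, A1, setT; split => //; last by rewrite setIT.
    exact: sigma_genT.
  have h2 : measurable A2 by apply: sigma_gen_measurable hA2 => i; exact: measurable_funP.
  have h2' : <<s history_rect S false set0 [set i | (i < n)%N] >> A2.
    apply: sub_sigma_algebra; exists setT, setT, A2; split; rewrite ?setIT ?setTI//; exact: sigma_genT.
  (* The indicator of [A2] goes into the integrand, which then depends on marks only and is
     independent of the event built from the other two blocks. *)
  rewrite [RHS](_ : _ = \int[P]_(w in A0 `&` A1) (tilt n w * \1_A2 w)%:E)%E; last first.
    rewrite [LHS]integral_mkcond [RHS]integral_mkcond; apply: eq_integral => w _.
    rewrite !patchE in_setI; case: (w \in A0 `&` A1) => //=; rewrite indicE.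
    by case: (w \in A2); rewrite ?mulr1 ?mulr0.
  rewrite (indep_ge0_integral law_P (b':=false) (J':=set0) (K':=[set i | (i < n)%N]) _ _ _ h01)//; last 2 first.
  + apply/measurable_EFinP; apply: measurable_funM; first exact: measurable_tilt_history.
    exact: (@measurable_indic _ (history S _ _ _)).
  + by move=> w; rewrite lee_fin mulr_ge0 ?tilt_ge0.
  congr (_ * _)%E; rewrite [LHS]integral_mkcond; apply: eq_integral => w _.
  rewrite patchE indicE; case: (w \in A2); rewrite ?mulr1 ?mulr0//.
- by move=> k; rewrite ltey_eq fin_num_measure.
Qed.

Lemma tilt_integral n d' (T : measurableType d') (Z : Omega -> T) (h : T -> \bar R) :
  measurable_fun (setT : set (history S true setT [set i | (i < n)%N])) Z ->
  measurable_fun setT h -> (forall z, 0 <= h z)%E ->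
  (\int[Pa]_w h (Z w) = \int[P]_w (h (Z w) * (tilt n w)%:E))%E.
Proof.
move=> mZ mh h0.
apply: (@density_ge0_integral _ _ _ _ _ P Pa Z (tilt n)) => //.
- exact: measurable_fun_history mZ.
- exact: measurable_tilt.
- exact: tilt_ge0.
- by move=> V mV; apply: tilt_known; exact: history_preimage.
Qed.

End tilting.

(** * The Fejer kernel *)

Section lebesgue_affine.
Context (R : realType).
Local Notation mu := (@lebesgue_measure R).

Lemma lebesgue_measure_affine_preimage (k c a b : R) : k != 0 ->
  (mu `]a, b] = `|k|%:E * mu ((fun x => (k * x + c)%R) @^-1` `]a, b]))%E.
Proof.
move=> k0; have [kp|kn|kE] := ltgtP 0 k; last by rewrite -kE eqxx in k0.
- rewrite (_ : _ @^-1` _ = `](a - c) / k, (b - c) / k]%classic); last first.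
    apply/seteqP; split=> x /=; rewrite !in_itv/= ltr_pdivrMr// ler_pdivlMr//; lra.
  rewrite !lebesgue_measure_itv/= !lte_fin ltr_pM2r ?invr_gt0// ltrD2r.
  case: ifPn => h; last by rewrite mule0.
  by rewrite -!EFinB -EFinM gtr0_norm//; congr EFin; field.
- rewrite (_ : _ @^-1` _ = `[(b - c) / k, (a - c) / k[%classic); last first.
    apply/seteqP; split=> x /=; rewrite !in_itv/= ltr_ndivlMr// ler_ndivrMr//; lra.
  rewrite !lebesgue_measure_itv/= !lte_fin ltr_nM2r ?invr_lt0// ltrD2r.
  case: ifPn => h; last by rewrite mule0.
  by rewrite -!EFinB -EFinM ltr0_norm//; congr EFin; field; rewrite ltr0_neq0.
Qed.

(** The image of Lebesgue measure under the affine map, multiplied by the modulus of [k], gives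
    every half-open interval its length, so it is Lebesgue measure. *)
Lemma ge0_integral_affine (k c : R) (f : R -> \bar R) : k != 0 ->
  measurable_fun setT f -> (forall x, 0 <= f x)%E ->
  (\int[mu]_x f x = `|k|%:E * \int[mu]_x f (k * x + c)%R)%E.
Proof.
move=> k0 mf f0.
pose phi (x : measurableTypeR R) : measurableTypeR R := k * x + c.
have mphi : measurable_fun setT phi.
  by apply: measurable_funD => //; exact: measurable_funM.
pose phi' : {mfun measurableTypeR R >-> measurableTypeR R} :=
  HB.pack phi (isMeasurableFun.Build _ _ _ _ phi mphi).
pose nu m : {measure set (measurableTypeR R) -> \bar R} :=
  mscale (NngNum (normr_ge0 k))
    (measure_function_pushforward__canonical__measure_function_Measure mu m).
transitivity (\int[nu _ mphi]_x f x)%E.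
  apply: eq_measure_integral => A mA _; apply: lebesgue_measure_unique => // X.
  case=> -[a b] /= ab <-.
  rewrite /nu /= /mscale/= /pushforward/=.
  exact: lebesgue_measure_affine_preimage.
by rewrite ge0_integral_mscale// ge0_integral_pushforward.
Qed.

Lemma integrable_affine (k c : R) (f : R -> R) : k != 0 ->
  mu.-integrable setT (EFin \o f) ->
  mu.-integrable setT (EFin \o (fun x => f (k * x + c))).
Proof.
move=> k0 /integrableP[mf f0]; apply/integrableP; split.
  apply: (measurableT_comp mf).
  by apply: measurable_funD => //; exact: measurable_funM.
move: f0; rewrite (@ge0_integral_affine k c)//; last exact: measurableT_comp.
move=> h; rewrite -(@lte_pmul2l _ `|k|%:E)// ?lte_fin ?normr_gt0//.
by rewrite mulry gtr0_sg ?normr_gt0// mul1e.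
Qed.

Lemma integral_affine (k c : R) (f : R -> R) : k != 0 ->
  mu.-integrable setT (EFin \o f) ->
  (\int[mu]_x (f x)%:E = `|k|%:E * \int[mu]_x (f (k * x + c)%R)%:E)%E.
Proof.
move=> k0 fi; have fi' := integrable_affine c k0 fi.
have mf := measurable_int _ fi.
have -> : (\int[mu]_x (f (k * x + c)%R)%:E = (\int[mu]_x (EFin \o f)^\+ (k * x + c)%R)
    - (\int[mu]_x (EFin \o f)^\- (k * x + c)%R))%E.
  by rewrite [LHS]integralE; congr (_ - _)%E; apply: eq_integral => x _; rewrite ?funeposE ?funenegE.
rewrite [in LHS]integralE (@ge0_integral_affine k c _ k0 (measurable_funepos mf))//.
rewrite (@ge0_integral_affine k c _ k0 (measurable_funeneg mf))//.
apply/esym/muleBr => //; apply: fin_num_adde_defl; rewrite fin_numN.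
have := integrable_neg_fin_num measurableT fi'.
by congr (_ \is a fin_num); apply: eq_integral => x _; rewrite ?funenegE.
Qed.

End lebesgue_affine.

Section ftc.
Context (R : realType).
Local Notation mu := (@lebesgue_measure R).
Implicit Types f F : R -> R.

Lemma is_derive_continuous f (x df : R) : is_derive x 1 f df -> {for x, continuous f}.
Proof. by move=> h; apply/differentiable_continuous/derivable1_diffP; exact: ex_derive. Qed.

Lemma ge0_FTC2y f F (a l : R) : (forall x, a <= x -> 0 <= f x) ->
  (forall x, a <= x -> is_derive x 1 F (f x)) ->
  (forall x, a <= x -> {for x, continuous f}) ->
  F x @[x --> +oo] --> l ->
  (\int[mu]_(x in `[a, +oo[) (f x)%:E = (l - F a)%:E)%E.
Proof.
move=> f0 dF cf Fl; rewrite (@ge0_continuous_FTC2y _ f F a l)//.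
- apply/continuous_within_itvcyP; split.
    by move=> x; rewrite in_itv/= andbT => /ltW; exact: cf.
  by apply: cvg_at_right_filter; exact: cf.
- by move=> x /ltW ax; have [] := dF x ax.
- by apply: cvg_at_right_filter; exact: is_derive_continuous (dF a (lexx a)).
- move=> x; rewrite in_itv/= andbT => /ltW ax.
  by rewrite derive1E; have [_ ->] := dF x ax.
Qed.

Lemma FTC2 f F (a b : R) : a <= b -> (forall x : R, is_derive x 1 F (f x)) -> continuous f ->
  (\int[mu]_(x in `[a, b]) (f x)%:E = (F b - F a)%:E)%E.
Proof.
rewrite le_eqVlt => /predU1P[<- _ _|ab dF cf].
  by rewrite set_itv1 integral_set1 subrr.
have cF x : {for x, continuous F} by exact: is_derive_continuous (dF x).
rewrite (@continuous_FTC2 _ f F a b)//.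
- by apply: continuous_subspaceT.
- split; first by move=> x _; have [] := dF x.
  + by apply: cvg_at_right_filter; exact: cF.
  + by apply: cvg_at_left_filter; exact: cF.
- by move=> x _; rewrite derive1E; have [_ ->] := dF x.
Qed.

End ftc.

Section fejer.
Context (R : realType).
Local Notation mu := (@lebesgue_measure R).
Implicit Types (A s x u : R).

(** For positive [A], the probability density whose Fourier transform is the triangle of height 1 on
    [[-A, A]]; the value at 0 is the limit there. *)
Definition fejer A x : R :=
  if x == 0 then A / (2 * pi) else (1 - cos (A * x)) / (pi * A * x ^+ 2).

Lemma fejer_ge0 A x : 0 <= A -> 0 <= fejer A x.
Proof.
move=> A0; rewrite /fejer; case: ifP => _; first by rewrite divr_ge0// mulr_ge0// pi_ge0.
by rewrite divr_ge0 ?subr_ge0 ?cos_le1// mulr_ge0 ?sqr_ge0// mulr_ge0// pi_ge0.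
Qed.

Lemma fejerN A x : fejer A (- x) = fejer A x.
Proof. by rewrite /fejer oppr_eq0 mulrN cosN sqrrN. Qed.

Lemma measurable_inv_sqr : measurable_fun setT (fun x : R => x ^- 2).
Proof.
rewrite (_ : (fun _ => _) = (fun x => (x ^+ 2) `^ (-1))); last first.
  by apply/funext => x; rewrite powR_inv1// sqr_ge0.
apply: (@measurableT_comp _ _ _ _ _ _ ((@powR R) ^~ (-1))); first exact: measurable_powR.
exact: measurable_funX.
Qed.

Lemma measurable_fejer A : measurable_fun setT (fejer A).
Proof.
apply: measurable_fun_ifT => //.
  by apply: (measurable_fun_eqr) => //.
apply: measurable_funM.
  apply: measurable_funB => //.
  apply: (@measurableT_comp _ _ _ _ _ _ (@cos R)).
    by apply: continuous_measurable_fun; exact: continuous_cos.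
  exact: measurable_funM.
rewrite (_ : (fun _ => _^-1) = (fun x => (pi * A)^-1 * x ^- 2)); last first.
  by apply/funext => x; rewrite invfM.
by apply: measurable_funM => //; exact: measurable_inv_sqr.
Qed.

Instance is_derive_expR_scale (k x : R) :
  is_derive x 1 (fun y => expR (k * y)) (k * expR (k * x)).
Proof.
have h : is_derive x 1 (fun y : R => k * y) k by apply: is_derive_eq; rewrite /GRing.scale/= mulr1.
by apply: is_derive_eq; rewrite mulrC.
Qed.

Instance is_derive_cos_scale (k x : R) :
  is_derive x 1 (fun y => cos (k * y)) (- (k * sin (k * x))).
Proof.
have h : is_derive x 1 (fun y : R => k * y) k by apply: is_derive_eq; rewrite /GRing.scale/= mulr1.
apply: is_derive_eq; by rewrite mulNr mulrC.
Qed.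

Instance is_derive_sin_scale (k x : R) :
  is_derive x 1 (fun y => sin (k * y)) (k * cos (k * x)).
Proof.
have h : is_derive x 1 (fun y : R => k * y) k by apply: is_derive_eq; rewrite /GRing.scale/= mulr1.
apply: is_derive_eq; by rewrite mulrC.
Qed.

Lemma is_derive_fejer_antiderivative A x u : x != 0 -> A != 0 ->
  is_derive u 1 (fun y => (1 - A^-1 * y) * sin (x * y) * x^-1 - cos (x * y) * (A * x ^+ 2)^-1)
    ((1 - A^-1 * u) * cos (x * u)).
Proof.
move=> x0 A0; apply: is_derive_eq; rewrite /GRing.scale/=.
by field; rewrite x0 A0.
Qed.

(** The second summand is the real part of the antiderivative of a complex exponential, with the
    sign reversed. *)
Lemma is_derive_laplace_antiderivative A s x : s != 0 -> s ^+ 2 + A ^+ 2 != 0 ->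
  is_derive x 1 (fun y => - (expR (- s * y) * s^-1) +
     expR (- s * y) * (s * cos (A * y) - A * sin (A * y)) * (s ^+ 2 + A ^+ 2)^-1)
    ((1 - cos (A * x)) * expR (- s * x)).
Proof.
move=> s0 sA0; apply: is_derive_eq; rewrite /GRing.scale/=.
by field; rewrite s0 sA0.
Qed.

Lemma is_derive_gamma2_antiderivative s x : x != 0 ->
  is_derive s 1 (fun y => - ((y * x^-1 + x ^- 2) * expR (- x * y)))
    (s * expR (- x * s)).
Proof.
move=> x0; apply: is_derive_eq; rewrite /GRing.scale/=.
by field.
Qed.

Lemma is_derive_atan_scale A s : 0 < A ->
  is_derive s 1 (fun y => atan (A^-1 * y)) (A * (s ^+ 2 + A ^+ 2)^-1).
Proof.
move=> A0.
have h : is_derive s 1 (fun y : R => A^-1 * y) A^-1 by apply: is_derive_eq; rewrite /GRing.scale/= mulr1.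
apply: is_derive_eq; field.
by rewrite !gt_eqF// ltr_wpDl ?sqr_ge0// exprn_gt0.
Qed.

Lemma is_derive_inv_scale k x : x != 0 ->
  is_derive x 1 (fun y => - (k * y^-1)) (k * x ^- 2).
Proof.
move=> x0.
have h : is_derive x 1 (fun y : R => y^-1) (- x ^- 2).
  by have := is_deriveV x0 (is_derive_id x 1); rewrite /GRing.scale/= mulr1.
apply: is_derive_eq; rewrite /GRing.scale/=; field; exact: x0.
Qed.

(** Fourier inversion for the triangle, on its positive half by symmetry. The antiderivative comes
    from integration by parts and divides by [x], whence the separate case of 0. *)
Lemma fejer_fourier A x : 0 < A ->
  (\int[mu]_(u in `[0%R, A]) ((1 - A^-1 * u) * cos (x * u))%:E = (pi * fejer A x)%:E)%E.
Proof.
move=> A0; have A0' : A != 0 by rewrite gt_eqF.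
have pi0 : pi != 0 :> R by rewrite gt_eqF// pi_gt0.
have cf : continuous (fun u => (1 - A^-1 * u) * cos (x * u)).
  by move=> u; apply: is_derive_continuous.
have [->|x0] := eqVneq x 0.
  have dF (u : R) : is_derive u 1 (fun u => u - A^-1 * u ^+ 2 / 2) ((1 - A^-1 * u) * cos (0 * u)).
    by apply: is_derive_eq; rewrite /GRing.scale/= mul0r cos0; field; exact: A0'.
  rewrite (FTC2 (ltW A0) dF); last by move=> u; apply: is_derive_continuous.
  rewrite /fejer eqxx; congr EFin; move: pi0; move: (@pi R) => p p0.
  by field; rewrite p0.
have dF (u : R) := is_derive_fejer_antiderivative u x0 A0'.
rewrite (FTC2 (ltW A0) dF cf).
rewrite /fejer (negPf x0) !mulr0 cos0 sin0 mulVf// (mulrC x A); congr EFin.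
by move: (@pi R) pi0 => p p0; field; rewrite A0' p0 x0.
Qed.

Lemma cvgr_expR_scale k : 0 < k -> expR (- k * x) @[x --> +oo] --> (0 : R).
Proof.
move=> k0; rewrite (_ : (fun x => _) = (fun x => (expR \o -%R) (k * x))); last first.
  by apply/funext => x /=; rewrite mulNr.
apply: (@cvg_comp _ _ _ (fun x => k * x) (expR \o -%R) _ (+oo)).
  exact: gt0_cvgMry.
exact: cvgr_expR.
Qed.

Lemma laplace_1Bcos A s : 0 < A -> 0 < s ->
  (\int[mu]_(x in `[0%R, +oo[) ((1 - cos (A * x)) * expR (- s * x))%:E =
   (A ^+ 2 / (s * (s ^+ 2 + A ^+ 2)))%:E)%E.
Proof.
move=> A0 s0; have s0' : s != 0 by rewrite gt_eqF.
have sA : s ^+ 2 + A ^+ 2 != 0 by rewrite gt_eqF// addr_gt0// exprn_gt0.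
rewrite (@ge0_FTC2y _ _ _ _ 0 _ (fun x _ => is_derive_laplace_antiderivative x s0' sA)).
- by rewrite !mulr0 expR0 cos0 sin0; congr EFin; field; rewrite s0' sA.
- by move=> x _; rewrite mulr_ge0 ?expR_ge0// subr_ge0 cos_le1.
- by move=> x _; apply: is_derive_continuous.
have e0 := cvgr_expR_scale s0.
apply/cvgr0Pnorm_lt => e ep.
(* The oscillating factor is at most [s + A] in modulus, so the antiderivative is at most this
   constant times [expR (- s * x)]. *)
have C0 : 0 < s^-1 + (s + A) * (s ^+ 2 + A ^+ 2)^-1.
  by rewrite addr_gt0 ?invr_gt0// mulr_gt0 ?invr_gt0 ?addr_gt0// exprn_gt0.
move/cvgr0Pnorm_lt: e0 => /(_ (e / (s^-1 + (s + A) * (s ^+ 2 + A ^+ 2)^-1))).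
rewrite divr_gt0// => /(_ isT); apply: filterS => x.
rewrite ger0_norm ?expR_ge0// ltr_pdivlMr//; apply: le_lt_trans.
rewrite -mulrN -[X in _ + X]mulrA -mulrDr normrM (ger0_norm (expR_ge0 _)).
rewrite ler_wpM2l ?expR_ge0//.
rewrite (le_trans (ler_normD _ _))// normrN (ger0_norm (ltW _)) ?invr_gt0// lerD2l.
rewrite normrM (@ger0_norm _ (_^-1)) ?invr_ge0 ?addr_ge0 ?sqr_ge0//.
rewrite ler_wpM2r ?invr_ge0 ?addr_ge0 ?sqr_ge0//.
rewrite (le_trans (ler_normB _ _))// !normrM (gtr0_norm s0) (gtr0_norm A0).
by rewrite lerD// ler_piMr ?cos_max ?sin_max// ltW.
Qed.

(** Writes the factor [x ^- 2] of the kernel as a superposition of exponentials, against which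
    [1 - cos] has an explicit integral. *)
Lemma gamma2_integral x : 0 < x ->
  (\int[mu]_(s in `[0%R, +oo[) (s * expR (- x * s))%:E = (x ^- 2)%:E)%E.
Proof.
move=> x0; have x0' : x != 0 by rewrite gt_eqF.
rewrite (@ge0_FTC2y _ _ _ _ 0 _ (fun s _ => is_derive_gamma2_antiderivative s x0')).
- by rewrite !mulr0 mul0r add0r expR0 mulr1 opprK add0r.
- by move=> s s0; rewrite mulr_ge0 ?expR_ge0.
- by move=> s _; apply: is_derive_continuous.
have e0 := cvgr_expR_scale x0.
have x20 : 0 < x / 2 by rewrite divr_gt0.
have e1 := cvgr_expR_scale x20.
rewrite -oppr0; apply: cvgN; rewrite (_ : 0 = (2 / x ^+ 2) * 0 + x ^- 2 * 0); last by rewrite !mulr0 addr0.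
apply: (@squeeze_cvgr _ _ _ _ (cst 0) (fun s => (2 / x ^+ 2) * expR (- (x / 2) * s) + x ^- 2 * expR (- x * s))).
- near=> s; have s0 : 0 <= s by near: s; exact: nbhs_pinfty_ge.
  apply/andP; split; first by rewrite mulr_ge0 ?expR_ge0// addr_ge0 ?invr_ge0 ?sqr_ge0// mulr_ge0 ?invr_ge0 ?ltW.
  rewrite mulrDl lerD2r.
  (* One half of the exponential absorbs the linear factor, because [y * expR (- y)] is at most 1
     for nonnegative [y]. *)
  have -> : expR (- x * s) = expR (- (x / 2) * s) * expR (- (x / 2) * s).
    by rewrite -expRD; congr expR; field.
  rewrite mulrA ler_wpM2r ?expR_ge0//.
  have h : (x / 2 * s) * expR (- (x / 2) * s) <= 1.
    rewrite mulNr expRN ler_pdivrMr ?expR_gt0// mul1r.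
    by rewrite (le_trans _ (expR_ge1Dx _))// lerDr.
  rewrite (_ : s * x^-1 * _ = (2 / x ^+ 2) * (x / 2 * s * expR (- (x / 2) * s))); last by field.
  by rewrite ler_piMr// divr_ge0 ?sqr_ge0.
- by rewrite !mulr0 addr0; exact: cvg_cst.
- by apply: cvgD; apply: cvgMr.
Unshelve. all: by end_near. Qed.

Lemma integral_poisson A : 0 < A ->
  (\int[mu]_(s in `[0%R, +oo[) (A / (s ^+ 2 + A ^+ 2))%:E = (pi / 2)%:E)%E.
Proof.
move=> A0; have sA s : s ^+ 2 + A ^+ 2 != 0.
  by rewrite gt_eqF// ltr_wpDl ?sqr_ge0// exprn_gt0.
have f0 s : 0 <= s -> 0 <= A / (s ^+ 2 + A ^+ 2).
  by move=> _; rewrite divr_ge0 ?ltW// ltr_wpDl ?sqr_ge0// exprn_gt0.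
have dF s : 0 <= s -> is_derive s 1 (fun s => atan (A^-1 * s)) (A / (s ^+ 2 + A ^+ 2)).
  by move=> _; exact: is_derive_atan_scale.
rewrite (ge0_FTC2y (l := pi / 2) f0 dF).
- by rewrite mulr0 atan0 subr0.
- move=> s _; apply: (@cvgM _ _ _ _ (cst A)); first exact: cvg_cst.
  apply: cvgV => //; apply: cvgD; last exact: cvg_cst.
  exact: exprn_continuous.
apply: (@cvg_comp _ _ _ (fun x => A^-1 * x) (@atan R) _ (+oo)); last exact: cvgy_atan.
by apply: gt0_cvgMry; rewrite ?invr_gt0//; exact: cvg_id.
Qed.

Lemma integral_inv_sqr (k a : R) : 0 <= k -> 0 < a ->
  (\int[mu]_(x in `[a, +oo[) (k * x ^- 2)%:E = (k / a)%:E)%E.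
Proof.
move=> k0 a0; have pos x : a <= x -> x != 0 by move=> ax; rewrite gt_eqF// (lt_le_trans a0).
have f0 x : a <= x -> 0 <= k * x ^- 2.
  by move=> _; rewrite mulr_ge0 ?invr_ge0 ?sqr_ge0.
have dF x : a <= x -> is_derive x 1 (fun x => - (k * x^-1)) (k * x ^- 2).
  by move=> ax; apply: is_derive_inv_scale; exact: pos.
rewrite (ge0_FTC2y (l := 0) f0 dF).
- by rewrite sub0r opprK.
- move=> x ax; apply: (@cvgM _ _ _ _ (cst k)); first exact: cvg_cst.
  apply: cvgV; first by rewrite expf_neq0// pos.
  exact: exprn_continuous.
- rewrite -oppr0 -(mulr0 k); apply: cvgN; apply: cvgMr.
  by apply/gtr0_cvgV0; [exact: nbhs_pinfty_gt|exact: cvg_id].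
Qed.

Lemma ge0_even_integral (f : R -> R) : measurable_fun setT f -> (forall x, 0 <= f x) ->
  (forall x, f (- x) = f x) ->
  (\int[mu]_x (f x)%:E = 2%:E * \int[mu]_(x in `[0%R, +oo[) (f x)%:E)%E.
Proof.
move=> mf f0 fN.
have mfE : measurable_fun setT (EFin \o f) by exact/measurable_EFinP.
have -> : setT = `]-oo, 0%R[%classic `|` `[0%R, +oo[%classic :> set R.
  apply/seteqP; split=> // x _ /=; rewrite !in_itv/= andbT.
  by have [x0|x0] := ltP x 0; [left|right].
rewrite ge0_integral_setU//=; last 3 first.
- exact: measurable_funTS.
- by move=> x _; rewrite lee_fin.
- apply/disj_setPS => x [/=]; rewrite !in_itv/= andbT => x0.
  by move=> /(lt_le_trans x0); rewrite ltxx.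
have -> : (\int[mu]_(x in `]-oo, 0%R[) (f x)%:E = \int[mu]_(x in `[0%R, +oo[) (f x)%:E)%E.
  rewrite -integral_itv_obnd_cbnd; last exact: measurable_funTS.
  rewrite [LHS]integral_mkcond [RHS]integral_mkcond.
  rewrite (@ge0_integral_affine _ (-1) 0)//; last 2 first.
  - by apply/(measurable_restrictT _ _).1 => //; exact: measurable_funTS.
  - by move=> x; apply: erestrict_ge0 => y _; rewrite lee_fin.
  rewrite normrN1 mul1e; apply: eq_integral => x _.
  rewrite !patchE mulN1r addr0 fN.
  have -> : (- x \in `]-oo, 0[%classic) = (x \in `]0, +oo[%classic).
    by apply/idP/idP; rewrite !inE/= !in_itv/= andbT oppr_lt0.
  by [].
by rewrite -mule2n mule_natl.
Qed.

Lemma integral_indic_itvoy (g : R -> R) : measurable_fun setT g ->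
  (\int[mu]_s (\1_(`]0%R, +oo[ : set R) s * g s)%:E = \int[mu]_(s in `[0%R, +oo[) (g s)%:E)%E.
Proof.
move=> mg; rewrite -integral_itv_obnd_cbnd; last exact/measurable_EFinP/measurable_funTS.
rewrite [RHS]integral_mkcond; apply: eq_integral => s _.
by rewrite patchE indicE; case: (s \in _); rewrite ?mul1r ?mul0r.
Qed.

(** Tonelli: with [x ^- 2] written as the integral of [s * expR (- x * s)], the integral in [x] is
    the Laplace transform of [1 - cos]. What remains is the Cauchy density in [s], integrated by the
    arctangent. The open half-line keeps [x] and [s] away from 0. *)
Lemma fejer_halfline A : 0 < A ->
  (\int[mu]_(x in `[0%R, +oo[) (fejer A x)%:E = (2^-1)%:E)%E.
Proof.
move=> A0; have pi0 : 0 < pi :> R := pi_gt0 R.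
have mI : measurable_fun setT (\1_(`]0%R, +oo[ : set R) : R -> R) by exact: measurable_indic.
have mcos : measurable_fun setT (@cos R).
  by apply: continuous_measurable_fun; exact: continuous_cos.
pose f (z : R * R) : \bar R := (\1_(`]0%R, +oo[ : set R) z.1 * (\1_(`]0%R, +oo[ : set R) z.2 *
  (z.2 * ((1 - cos (A * z.1)) * expR (- z.2 * z.1)) / (pi * A))))%:E.
have m1 : measurable_fun setT (fst : R * R -> R) by exact: measurable_fst.
have m2 : measurable_fun setT (snd : R * R -> R) by exact: measurable_snd.
have mf : measurable_fun setT f.
  apply/measurable_EFinP; apply: measurable_funM; first exact: (measurableT_comp mI).
  apply: measurable_funM; first exact: (measurableT_comp mI).
  apply: measurable_funM => //; apply: measurable_funM => //; apply: measurable_funM.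
    apply: measurable_funB => //; apply: (measurableT_comp mcos).
    exact: measurable_funM.
  apply: (measurableT_comp (@measurable_expR R)); apply: measurable_funM => //.
  exact: measurableT_comp.
have f0 z : (0 <= f z)%E.
  rewrite lee_fin mulr_ge0// !indicE; have [z2|] := boolP (z.2 \in _); last by rewrite mul0r.
  move: z2; rewrite inE/= in_itv/= andbT => /ltW z2.
  by rewrite mul1r divr_ge0 ?mulr_ge0 ?expR_ge0 ?subr_ge0 ?cos_le1// ltW.
have mfe := measurable_fejer A.
rewrite -integral_indic_itvoy//.
transitivity (\int[mu]_x \int[mu]_s f (x, s))%E.
  apply: eq_integral => x _; rewrite /f/= indicE.
  have [x0|_] := boolP (x \in _); last first.
    rewrite mul0r; under eq_integral do rewrite mul0r.
    by rewrite integral0.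
  move: x0; rewrite inE/= in_itv/= andbT => x0.
  under eq_integral do rewrite mul1r.
  rewrite (@integral_indic_itvoy (fun s => s * ((1 - cos (A * x)) * expR (- s * x)) / (pi * A))); last first.
    apply: measurable_funM => //; apply: measurable_funM => //; apply: measurable_funM => //.
    apply: (measurableT_comp (@measurable_expR R)); apply: measurable_funM => //.
  apply/esym; transitivity (\int[mu]_(s in `[0%R, +oo[) (((1 - cos (A * x)) / (pi * A))%:E * (s * expR (- x * s))%:E))%E.
    apply: eq_integral => s _; rewrite -EFinM; congr EFin.
    by rewrite (_ : - s * x = - x * s); [ring|rewrite !mulNr mulrC].
  rewrite ge0_integralZl//=; last 3 first.
  - apply/measurable_EFinP; apply: measurable_funM => //.
    apply: (measurableT_comp (@measurable_expR R)); exact: measurable_funM.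
  - by move=> s; rewrite in_itv/= andbT => s0; rewrite lee_fin mulr_ge0 ?expR_ge0.
  - by rewrite lee_fin divr_ge0 ?subr_ge0 ?cos_le1// ltW// mulr_gt0.
  rewrite gamma2_integral// mul1r -EFinM; congr EFin.
  rewrite /fejer gt_eqF//; move: (@pi R) pi0 => p p0.
  by field; rewrite !gt_eqF.
transitivity (\int[mu]_s \int[mu]_x f (x, s))%E.
  exact: (@fubini_tonelli _ _ _ _ _ mu mu f mf f0).
transitivity (\int[mu]_s (\1_(`]0%R, +oo[ : set R) s * (pi^-1 * (A / (s ^+ 2 + A ^+ 2))))%:E)%E.
  apply: eq_integral => s _; rewrite /f/= indicE.
  have [s0|_] := boolP (s \in _); last first.
    rewrite mul0r; under eq_integral do rewrite mul0r mulr0.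
    by rewrite integral0.
  move: s0; rewrite inE/= in_itv/= andbT => s0.
  under eq_integral do rewrite mul1r.
  rewrite (@integral_indic_itvoy (fun x => s * ((1 - cos (A * x)) * expR (- s * x)) / (pi * A))); last first.
    apply: measurable_funM => //; apply: measurable_funM => //; apply: measurable_funM => //.
      apply: measurable_funB => //; apply: (measurableT_comp mcos).
      exact: measurable_funM.
    by apply: (measurableT_comp (@measurable_expR R)); apply: measurable_funM.
  transitivity (\int[mu]_(x in `[0%R, +oo[) ((s / (pi * A))%:E * ((1 - cos (A * x)) * expR (- s * x))%:E))%E.
    by apply: eq_integral => x _; rewrite -EFinM; congr EFin; ring.
  rewrite ge0_integralZl//=; last 2 first.
  - apply/measurable_EFinP; apply: measurable_funM => //.
      apply: measurable_funB => //; apply: (measurableT_comp mcos).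
      exact: measurable_funM.
    by apply: (measurableT_comp (@measurable_expR R)); exact: measurable_funM.
  - by rewrite lee_fin divr_ge0 ?ltW// mulr_gt0.
  rewrite laplace_1Bcos// mul1r -EFinM; congr EFin; move: (@pi R) pi0 => p p0; field.
  by rewrite !gt_eqF// addr_gt0// exprn_gt0.
have mpoi : measurable_fun setT (fun s : R => A / (s ^+ 2 + A ^+ 2)).
  apply: continuous_measurable_fun => s.
  apply: (@cvgM _ _ _ _ (cst A)); first exact: cvg_cst.
  apply: cvgV; first by rewrite gt_eqF// ltr_wpDl ?sqr_ge0// exprn_gt0.
  by apply: cvgD; [exact: exprn_continuous|exact: cvg_cst].
rewrite integral_indic_itvoy; last exact: measurable_funM.
under eq_integral do rewrite EFinM.
rewrite ge0_integralZl//=; last 3 first.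
- by apply/measurable_EFinP; exact: measurable_funTS.
- by move=> s _; rewrite lee_fin divr_ge0 ?ltW// ltr_wpDl ?sqr_ge0// exprn_gt0.
- by rewrite lee_fin invr_ge0 ltW.
by rewrite integral_poisson// -EFinM; congr EFin; move: (@pi R) pi0 => p p0; field; rewrite gt_eqF.
Qed.

Lemma fejer_total A : 0 < A -> (\int[mu]_x (fejer A x)%:E = 1)%E.
Proof.
move=> A0; rewrite ge0_even_integral.
- by rewrite fejer_halfline// -EFinM mulfV.
- exact: measurable_fejer A.
- by move=> x; apply: fejer_ge0; exact: ltW.
- exact: fejerN.
Qed.

(** Since [1 - cos] is at most 2, the kernel is at most [2 / (pi * A)] times [x ^- 2]; integrating
    from [e] and doubling by symmetry gives the constant 4. *)
Lemma fejer_tail A (e : R) : 0 < A -> 0 < e ->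
  (\int[mu]_(x in ~` `[(- e)%R, e]) (fejer A x)%:E <= (4 / (pi * A * e))%:E)%E.
Proof.
move=> A0 e0; have pi0 : 0 < pi :> R := pi_gt0 R.
have mfe := measurable_fejer A.
have mC : measurable (~` `[- e, e] : set R) by exact: measurableC.
pose g x := \1_(~` `[- e, e] : set R) x * fejer A x.
have mg : measurable_fun setT g by apply: measurable_funM => //; exact: measurable_indic.
have g0 x : 0 <= g x by rewrite mulr_ge0// fejer_ge0// ltW.
rewrite [leLHS](_ : _ = \int[mu]_x (g x)%:E)%E; last first.
  rewrite integral_mkcond; apply: eq_integral => x _.
  by rewrite patchE /g indicE; case: (x \in _); rewrite ?mul1r ?mul0r.
rewrite ge0_even_integral//; last first.
  move=> x; rewrite /g fejerN !indicE; congr (_%:R * _); congr nat_of_bool.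
  apply/idP/idP; rewrite !inE/= !in_itv/= => /negP h; apply/negP; apply: contra h; lra.
rewrite (_ : 4 / (pi * A * e) = 2 * (2 / (pi * A) / e)); last first.
  by move: (@pi R) pi0 => p p0; field; rewrite !gt_eqF.
rewrite EFinM lee_wpmul2l//.
rewrite -integral_inv_sqr//; last by rewrite divr_ge0// ltW// mulr_gt0.
rewrite [leLHS]integral_mkcond [leRHS]integral_mkcond.
apply: ge0_le_integral => //.
- by move=> x _; apply: erestrict_ge0 => y _; rewrite lee_fin.
- by apply/(measurable_restrictT _ _).1 => //; exact/measurable_EFinP/measurable_funTS.
- apply/(measurable_restrictT _ _).1 => //.
  by apply/measurable_EFinP/measurable_funTS/measurable_funM => //; exact: measurable_inv_sqr.
move=> x _; rewrite !patchE.
have p0 y : 0 <= 2 / (pi * A) * y ^- 2.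
  by rewrite mulr_ge0 ?invr_ge0 ?sqr_ge0// divr_ge0// ltW// mulr_gt0.
case: ifPn => [|_]; last by case: ifPn => // _; rewrite lee_fin.
rewrite inE/= in_itv/= andbT => x0; rewrite /g indicE.
have [|_] := boolP (x \in _); last by rewrite mul0r; case: ifPn => // _; rewrite lee_fin.
rewrite inE/= in_itv/= => /negP; rewrite negb_and -!ltNge => h.
have ex : e < x by move: h => /orP[]; lra.
rewrite mem_set/= ?in_itv/= ?andbT ?(ltW ex)// lee_fin mul1r /fejer gt_eqF ?(lt_trans e0)//.
rewrite invfM mulrA ler_wpM2r ?invr_ge0 ?sqr_ge0// ler_wpM2r//.
  by rewrite invr_ge0 ltW// mulr_gt0.
by have := cos_geN1 (A * x); lra.
Qed.

End fejer.

(** * A local limit theorem for smoothed laws *)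

Section planar_norm.
Context (R : realType).
Implicit Types a b c d x y : R.

(** Complex numbers are handled as pairs of reals; this is the modulus. *)
Definition nrm2 a b : R := Num.sqrt (a ^+ 2 + b ^+ 2).

Lemma nrm2_ge0 a b : 0 <= nrm2 a b. Proof. exact: sqrtr_ge0. Qed.

Lemma sqr_nrm2 a b : nrm2 a b ^+ 2 = a ^+ 2 + b ^+ 2.
Proof. by rewrite sqr_sqrtr// addr_ge0 ?sqr_ge0. Qed.

Lemma le_nrm2 a b x : 0 <= x -> a ^+ 2 + b ^+ 2 <= x ^+ 2 -> nrm2 a b <= x.
Proof. by move=> x0 h; rewrite -(ler_pXn2r (n := 2)) ?nnegrE ?nrm2_ge0// sqr_nrm2. Qed.

(** Lagrange's identity: the squares of the two sides differ by [(a * d - b * c) ^+ 2]. *)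
Lemma nrm2_cauchy_schwarz a b c d : `|a * c + b * d| <= nrm2 a b * nrm2 c d.
Proof.
rewrite -(ler_pXn2r (n := 2)) ?nnegrE ?mulr_ge0 ?nrm2_ge0//.
rewrite real_normK ?num_real// exprMn !sqr_nrm2.
have := sqr_ge0 (a * d - b * c); nra.
Qed.

Lemma nrm2D a b c d : nrm2 (a + c) (b + d) <= nrm2 a b + nrm2 c d.
Proof.
apply: le_nrm2; first by rewrite addr_ge0 ?nrm2_ge0.
have := ler_norm (a * c + b * d); move/le_trans/(_ (nrm2_cauchy_schwarz a b c d)).
move=> h; have -> : (nrm2 a b + nrm2 c d) ^+ 2 =
    (a ^+ 2 + b ^+ 2) + (c ^+ 2 + d ^+ 2) + 2 * (nrm2 a b * nrm2 c d).
  by rewrite sqrrD !sqr_nrm2; ring.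
nra.
Qed.

Lemma nrm2M a b c d : nrm2 (a * c - b * d) (b * c + a * d) = nrm2 a b * nrm2 c d.
Proof.
rewrite /nrm2 -sqrtrM ?addr_ge0 ?sqr_ge0//; congr Num.sqrt; ring.
Qed.

Lemma nrm2_ler a b : `|a| <= nrm2 a b.
Proof.
rewrite -(ler_pXn2r (n := 2)) ?nnegrE ?nrm2_ge0// real_normK ?num_real// sqr_nrm2.
by rewrite lerDl sqr_ge0.
Qed.

Lemma nrm2_lei a b : `|b| <= nrm2 a b.
Proof.
rewrite -(ler_pXn2r (n := 2)) ?nnegrE ?nrm2_ge0// real_normK ?num_real// sqr_nrm2.
by rewrite lerDr sqr_ge0.
Qed.

Lemma nrm2_real a : 0 <= a -> nrm2 a 0 = a.
Proof. by move=> a0; rewrite /nrm2 expr0n addr0 sqrtr_sqr ger0_norm. Qed.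

(* The sequence [(c n, s n)] is the sequence of powers of [C + i S]. *)
Definition planar_powers (C S : R) (c s : nat -> R) : Prop :=
  [/\ c 0%N = 1, s 0%N = 0 &
    forall n, c n.+1 = c n * C - s n * S /\ s n.+1 = s n * C + c n * S].

Lemma nrm2_powers (C S : R) (c s : nat -> R) n : planar_powers C S c s ->
  nrm2 (c n) (s n) = nrm2 C S ^+ n.
Proof.
move=> [c0 s0 cs]; elim: n => [|n IH]; first by rewrite c0 s0 expr0 nrm2_real.
by have [-> ->] := cs n; rewrite nrm2M IH exprSr.
Qed.

(** The telescoping bound for the difference of two n-th powers of numbers of modulus at most 1. The
    base [w] is real because it will be a Gaussian factor. *)
Lemma powers_dist (C S : R) (c s : nat -> R) (w : R) n : planar_powers C S c s -> 0 <= w <= 1 ->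
  nrm2 C S <= 1 -> nrm2 (c n - w ^+ n) (s n) <= n%:R * nrm2 (C - w) S.
Proof.
move=> [c0 s0 cs] /andP[w0 w1] CS1; elim: n => [|n IH].
  by rewrite c0 s0 expr0 subrr nrm2_real// mul0r.
have [-> ->] := cs n.
have -> : c n * C - s n * S - w ^+ n.+1 =
    ((c n - w ^+ n) * C - s n * S) + w ^+ n * (C - w) by rewrite exprSr; ring.
have -> : s n * C + c n * S = (s n * C + (c n - w ^+ n) * S) + w ^+ n * S by ring.
rewrite (le_trans (nrm2D _ _ _ _))// nrm2M -natr1 mulrDl mul1r lerD//.
  by rewrite (le_trans _ IH)// ler_piMr ?nrm2_ge0.
have -> : nrm2 (w ^+ n * (C - w)) (w ^+ n * S) = w ^+ n * nrm2 (C - w) S.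
  have := nrm2M (w ^+ n) 0 (C - w) S; rewrite !mul0r subr0 add0r => ->.
  by rewrite nrm2_real// exprn_ge0.
by rewrite ler_piMl ?nrm2_ge0// exprn_ile1.
Qed.

End planar_norm.

Lemma cvg_inv_sqrtn (R : realType) : (Num.sqrt n%:R)^-1 @[n --> \oo] --> (0 : R).
Proof.
apply/gtr0_cvgV0.
  by exists 1%N => // n /= n0; rewrite sqrtr_gt0 ltr0n.
apply/cvgryPge => a; exists (Num.truncn (a ^+ 2)).+1 => // n /= an.
rewrite (le_trans (ler_norm a))// -sqrtr_sqr ler_wsqrtr// ltW// (lt_le_trans (truncnS_gt _))//.
by rewrite ler_nat.
Qed.

(** * Powers of a characteristic function at arguments of order one over the square root of n *)

Section characteristic_function.
Context (R : realType).
Variables (C S : R -> R) (v K : R).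
Hypotheses (v0 : 0 < v) (K0 : 0 <= K).
Hypotheses (contC : continuous C) (contS : continuous S).
Hypothesis taylor : forall t, nrm2 (C t - (1 - v ^+ 2 * t ^+ 2 / 2)) (S t) <= K * `|t| ^+ 3.
Hypothesis modulus_lt1 : forall t, t != 0 -> nrm2 (C t) (S t) < 1.

Lemma modulus_le1 t : nrm2 (C t) (S t) <= 1.
Proof.
have [->|t0] := eqVneq t 0; last exact/ltW/modulus_lt1.
have h := taylor 0; rewrite normr0 !expr0n/= !mulr0 mul0r subr0 in h.
have hc := le_trans (nrm2_ler _ _) h; have hs := le_trans (nrm2_lei _ _) h.
move: hc; rewrite normr_le0 subr_eq0 => /eqP ->.
by move: hs; rewrite normr_le0 => /eqP ->; rewrite nrm2_real.
Qed.

Lemma modulus_near0 : exists2 e, 0 < e &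
  forall t, 0 <= t <= e -> nrm2 (C t) (S t) <= 1 - v ^+ 2 / 4 * t ^+ 2.
Proof.
(* The first bound keeps [1 - v ^+ 2 * t ^+ 2 / 2] nonnegative; the second makes the cubic remainder
   at most half of the quadratic term. *)
exists (Num.min (v^-1) (v ^+ 2 / (4 * (K + 1)))).
  by rewrite lt_min invr_gt0 v0/= divr_gt0 ?exprn_gt0// mulr_gt0// ltr_wpDl.
move=> t /andP[t0]; rewrite le_min => /andP[t1 t2].
have tv : v * t <= 1 by move: t1; rewrite -[v^-1]mul1r ler_pdivlMr// mulrC.
have tK : K * t <= v ^+ 2 / 4.
  have K1 : 0 < K + 1 by rewrite ltr_wpDl.
  have : (K + 1) * t <= v ^+ 2 / 4.
    move: t2; rewrite ler_pdivlMr ?mulr_gt0// => h; rewrite ler_pdivlMr//; lra.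
  by apply: le_trans; rewrite ler_wpM2r// lerDl.
have vt2 : v ^+ 2 * t ^+ 2 <= 1.
  by rewrite -exprMn exprn_ile1// mulr_ge0// ltW.
have h := nrm2D (C t - (1 - v ^+ 2 * t ^+ 2 / 2)) (S t) (1 - v ^+ 2 * t ^+ 2 / 2) 0.
rewrite subrK addr0 in h; apply: (le_trans h).
rewrite nrm2_real; last lra.
have := taylor t; rewrite (ger0_norm t0) => ht.
have : K * t ^+ 3 <= v ^+ 2 / 4 * t ^+ 2.
  by rewrite exprS mulrA ler_wpM2r ?sqr_ge0.
lra.
Qed.

(** Near 0 the quadratic term gives the bound. On the remaining compact interval the modulus has a
    maximum below 1, which a small enough [k] accommodates. *)
Lemma modulus_gauss A : 0 < A -> exists2 k, 0 < k &
  forall t, 0 <= t <= A -> nrm2 (C t) (S t) <= expR (- (k * t ^+ 2)).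
Proof.
move=> A0; have [e e0 near0] := modulus_near0.
have [k k0 kP] : exists2 k, 0 < k & forall t, 0 <= t <= A ->
    nrm2 (C t) (S t) <= 1 - k * t ^+ 2.
  have [Ae|eA] := leP A e.
    exists (v ^+ 2 / 4); first by rewrite divr_gt0 ?exprn_gt0.
    by move=> t /andP[t0 tA]; apply: near0; rewrite t0 (le_trans tA).
  have cont : {within `[e, A], continuous (fun t => nrm2 (C t) (S t))}.
    apply: continuous_subspaceT => t.
    apply: (@continuous_comp _ _ _ (fun t => C t ^+ 2 + S t ^+ 2) Num.sqrt).
      apply: (@continuousD _ _ _ (fun t => C t ^+ 2) (fun t => S t ^+ 2)).
        by apply: (@continuous_comp _ _ _ C (fun x => x ^+ 2)); [exact: contC|exact: exprn_continuous].
      by apply: (@continuous_comp _ _ _ S (fun x => x ^+ 2)); [exact: contS|exact: exprn_continuous].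
    exact: sqrt_continuous.
  have [p pI pmax] := EVT_max (ltW eA) cont.
  have p1 : nrm2 (C p) (S p) < 1.
    apply: modulus_lt1; move: pI; rewrite in_itv/= => /andP[ep _].
    by rewrite gt_eqF// (lt_le_trans e0).
  exists (Num.min (v ^+ 2 / 4) ((1 - nrm2 (C p) (S p)) / A ^+ 2)).
    by rewrite lt_min !divr_gt0 ?exprn_gt0// subr_gt0.
  move=> t /andP[t0 tA].
  have [te|et] := leP t e.
    rewrite (le_trans (near0 t _)) ?t0// lerD2l lerN2 ler_wpM2r ?sqr_ge0//.
    by rewrite ge_min lexx.
  have := pmax t; rewrite in_itv/= (ltW et) tA => /(_ isT) h.
  apply: (le_trans h); rewrite lerBrDl -lerBrDr.
  apply: (@le_trans _ _ ((1 - nrm2 (C p) (S p)) / A ^+ 2 * t ^+ 2)).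
    by rewrite ler_wpM2r ?sqr_ge0// ge_min lexx orbT.
  rewrite mulrAC ler_pdivrMr ?exprn_gt0// ler_wpM2l ?subr_ge0 ?(ltW p1)//.
  by rewrite ler_pXn2r ?nnegrE// ltW.
exists k => // t tA; rewrite (le_trans (kP t tA))//.
by rewrite (le_trans _ (expR_ge1Dx _)).
Qed.

Variables (c s : nat -> R -> R).
Hypothesis powers : forall t, planar_powers (C t) (S t) (c ^~ t) (s ^~ t).

(** Both quantities are n-th powers, the second of [expR (- x)] with [x] the quadratic term. One
    factor is off by the Taylor remainder plus the second-order error of the exponential, at most
    [x ^+ 2]. *)
Lemma gauss_approx t n :
  nrm2 (c n t - expR (- (n%:R * (v ^+ 2 * t ^+ 2 / 2)))) (s n t) <=
    n%:R * (K * `|t| ^+ 3 + (v ^+ 2 * t ^+ 2 / 2) ^+ 2).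
Proof.
set x := v ^+ 2 * t ^+ 2 / 2; have x0 : 0 <= x by rewrite divr_ge0// mulr_ge0 ?sqr_ge0.
have e0 := expR_gt0 (- x).
have e1 : 1 - x <= expR (- x) by exact: expR_ge1Dx.
have e2 : expR (- x) <= 1 - x + x ^+ 2.
  have x1 : 0 < 1 + x by rewrite ltr_wpDr.
  rewrite -(ler_pM2r x1).
  have h : expR (- x) * (1 + x) <= 1.
    have hx : expR (- x) * expR x = 1 by rewrite -expRD addNr expR0.
    by rewrite -[leRHS]hx ler_wpM2l ?(ltW e0)// expR_ge1Dx.
  rewrite (le_trans h)// (_ : _ * _ = 1 + x ^+ 3); last by ring.
  by rewrite lerDl exprn_ge0.
rewrite -mulrN expRM_natl (le_trans (powers_dist n (powers t) _ _))//.
- by rewrite ltW//= -expR0 ler_expR oppr_le0.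
- exact: modulus_le1.
rewrite ler_wpM2l//.
have -> : C t - expR (- x) = (C t - (1 - x)) + ((1 - x) - expR (- x)) by ring.
rewrite -[S t]addr0; apply: (le_trans (nrm2D _ _ _ _)).
apply: lerD; first exact: taylor.
apply: le_nrm2; first exact: sqr_ge0.
rewrite expr0n addr0 -(sqrrN (_ - _)) ler_pXn2r ?nnegrE ?sqr_ge0//; lra.
Qed.

(** At this argument one factor is off by at most order n to the power -3/2, so n factors are off by
    at most order one over the square root of n. *)
Lemma gauss_limit u : 0 <= u ->
  (c n (u / Num.sqrt n%:R) @[n --> \oo] --> expR (- (v ^+ 2 * u ^+ 2 / 2))) /\
  (s n (u / Num.sqrt n%:R) @[n --> \oo] --> (0 : R)).
Proof.
move=> u0; pose B := K * u ^+ 3 + (v ^+ 2 * u ^+ 2 / 2) ^+ 2.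
have B0 : 0 <= B by rewrite addr_ge0 ?sqr_ge0// mulr_ge0// exprn_ge0.
have main n : (0 < n)%N ->
    nrm2 (c n (u / Num.sqrt n%:R) - expR (- (v ^+ 2 * u ^+ 2 / 2))) (s n (u / Num.sqrt n%:R))
      <= B / Num.sqrt n%:R.
  move=> n0; have n0' : 0 < n%:R :> R by rewrite ltr0n.
  set q := Num.sqrt n%:R; have q0 : 0 < q by rewrite sqrtr_gt0.
  have qq : q ^+ 2 = n%:R by rewrite sqr_sqrtr// ltW.
  have q1 : 1 <= q by rewrite -sqrtr1 ler_wsqrtr// ler1n.
  have := gauss_approx (u / q) n; rewrite -qq.
  rewrite (_ : q ^+ 2 * (v ^+ 2 * (u / q) ^+ 2 / 2) = v ^+ 2 * u ^+ 2 / 2); last first.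
    by field; rewrite gt_eqF.
  move=> /le_trans; apply; rewrite ger0_norm; last by rewrite divr_ge0// ltW.
  rewrite (_ : q ^+ 2 * _ = (K * u ^+ 3 + (v ^+ 2 * u ^+ 2 / 2) ^+ 2 / q) / q); last first.
    by field; rewrite gt_eqF.
  rewrite ler_wpM2r ?invr_ge0 ?(ltW q0)// lerD2l.
  by rewrite ler_pdivrMr// ler_peMr ?sqr_ge0.
have lim0 : B / Num.sqrt n%:R @[n --> \oo] --> (0 : R).
  by rewrite -(mulr0 B); apply: cvgMr; exact: cvg_inv_sqrtn.
split.
- apply/cvgrPdist_le => e e0; move/cvgrPdist_le : lim0 => /(_ e e0) h.
  near=> n; rewrite distrC (le_trans (nrm2_ler _ (s n (u / Num.sqrt n%:R))))//.
  rewrite (le_trans (main n _))//; first by near: n; exists 1%N.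
  have : `|0 - B / Num.sqrt n%:R| <= e by near: n.
  by rewrite sub0r normrN; apply: le_trans; exact: ler_norm.
- apply/cvgrPdist_le => e e0; move/cvgrPdist_le : lim0 => /(_ e e0) h.
  near=> n; rewrite sub0r normrN.
  rewrite (le_trans (nrm2_lei (c n (u / Num.sqrt n%:R) - expR (- (v ^+ 2 * u ^+ 2 / 2))) _))//.
  rewrite (le_trans (main n _))//; first by near: n; exists 1%N.
  have : `|0 - B / Num.sqrt n%:R| <= e by near: n.
  by rewrite sub0r normrN; apply: le_trans; exact: ler_norm.
Unshelve. all: by end_near. Qed.

End characteristic_function.

Lemma prob_bounded_integrable d (T : measurableType d) (R : realType)
    (Q : probability T R) (f : T -> R) (B : R) :
  measurable_fun setT f -> (forall w, `|f w| <= B) -> Q.-integrable setT (EFin \o f).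
Proof.
move=> mf fB; apply: (@le_integrable _ _ _ Q setT measurableT _ (EFin \o cst B)).
- exact/measurable_EFinP.
- by move=> w _ /=; rewrite lee_fin (le_trans (fB w))// ler_norm.
- exact: finite_measure_integrable_cst.
Qed.

Section local_limit.
Context d (T : measurableType d) (R : realType) (Q : probability T R).
Variables (Y : nat -> T -> R) (C S : R -> R) (v K : R).
Local Notation mu := (@lebesgue_measure R).
Hypothesis mY : forall n, measurable_fun setT (Y n).
Hypotheses (v0 : 0 < v) (K0 : 0 <= K).
Hypotheses (contC : continuous C) (contS : continuous S).
Hypothesis taylor : forall t, nrm2 (C t - (1 - v ^+ 2 * t ^+ 2 / 2)) (S t) <= K * `|t| ^+ 3.
Hypothesis modulus_lt1 : forall t, t != 0 -> nrm2 (C t) (S t) < 1.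

Definition char_cos n t : R := (\int[Q]_w cos (t * Y n w))%R.
Definition char_sin n t : R := (\int[Q]_w sin (t * Y n w))%R.

Hypothesis powers : forall t, planar_powers (C t) (S t) (char_cos ^~ t) (char_sin ^~ t).

Let mcos : measurable_fun setT (@cos R).
Proof. by apply: continuous_measurable_fun; exact: continuous_cos. Qed.

Let msin : measurable_fun setT (@sin R).
Proof. by apply: continuous_measurable_fun; exact: continuous_sin. Qed.

Let cos_int n t : Q.-integrable setT (EFin \o (fun w => cos (t * Y n w))).
Proof.
apply: (@prob_bounded_integrable _ _ _ _ _ 1); last by move=> w; exact: cos_max.
by apply: (measurableT_comp mcos); exact: measurable_funM.
Qed.

Let sin_int n t : Q.-integrable setT (EFin \o (fun w => sin (t * Y n w))).
Proof.
apply: (@prob_bounded_integrable _ _ _ _ _ 1); last by move=> w; exact: sin_max.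
by apply: (measurableT_comp msin); exact: measurable_funM.
Qed.

(** Continuity is inherited from the one-step pair through the recursion. *)
Let char_continuous n : continuous (char_cos n) /\ continuous (char_sin n).
Proof.
elim: n => [|n [IHc IHs]].
  split=> t.
    by rewrite (_ : char_cos 0 = cst 1); [exact: cvg_cst|apply/funext => z; case: (powers z)].
  by rewrite (_ : char_sin 0 = cst 0); [exact: cvg_cst|apply/funext => z; case: (powers z)].
split=> t.
  rewrite (_ : char_cos n.+1 = (fun z => char_cos n z * C z - char_sin n z * S z)).
    by apply: (@continuousB _ _ _ (fun z => char_cos n z * C z) (fun z => char_sin n z * S z));
      apply: continuousM => //; [exact: IHc|exact: contC|exact: IHs|exact: contS].
  by apply/funext => z; case: (powers z) => _ _ /(_ n)[].
rewrite (_ : char_sin n.+1 = (fun z => char_sin n z * C z + char_cos n z * S z)).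
  by apply: (@continuousD _ _ _ (fun z => char_sin n z * C z) (fun z => char_cos n z * S z));
    apply: continuousM => //; [exact: IHs|exact: contC|exact: IHc|exact: contS].
by apply/funext => z; case: (powers z) => _ _ /(_ n)[].
Qed.

(* [smoothed A n x] is the density at [x] of the law of [Y n] convolved with the
   Fejer kernel. *)
Definition smoothed A n x : \bar R := (\int[Q]_w (fejer A (x - Y n w))%:E)%E.

(** On positive frequencies, the real part of the triangle times the phase at [x] times the
    characteristic function of [Y n]. *)
Definition fourier_density A x n u : R := \1_(`[0, A] : set R) u *
  ((1 - A^-1 * u) * (cos (x * u) * char_cos n u + sin (x * u) * char_sin n u)).

Lemma measurable_fourier_density A x n : measurable_fun setT (fourier_density A x n).
Proof.
have [cc cs] := char_continuous n.
apply: measurable_funM; first exact: measurable_indic.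
apply: measurable_funM; first by apply: measurable_funB => //; exact: measurable_funM.
apply: measurable_funD; apply: measurable_funM.
- by apply: (measurableT_comp mcos); exact: measurable_funM.
- exact: continuous_measurable_fun.
- by apply: (measurableT_comp msin); exact: measurable_funM.
- exact: continuous_measurable_fun.
Qed.

(** The kernel is replaced by its cosine representation and the integrals are exchanged; they
    converge absolutely because the frequencies are confined to [[0, A]]. *)
Lemma smoothedE A n x : 0 < A ->
  (smoothed A n x = (pi^-1)%:E * \int[mu]_u (fourier_density A x n u)%:E)%E.
Proof.
move=> A0; have pi0 : 0 < pi :> R := pi_gt0 R.
pose F (z : T * R) : \bar R :=
  (\1_(`[0, A] : set R) z.2 * ((1 - A^-1 * z.2) * cos ((x - Y n z.1) * z.2)))%:E.
have m1 : measurable_fun setT (fst : T * R -> T) by exact: measurable_fst.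
have m2 : measurable_fun setT (snd : T * R -> R) by exact: measurable_snd.
have mI : measurable_fun setT (\1_(`[0, A] : set R) : R -> R) by exact: measurable_indic.
have mF : measurable_fun setT F.
  apply/measurable_EFinP; apply: measurable_funM.
    exact: (measurableT_comp mI).
  apply: measurable_funM; first by apply: measurable_funB => //; exact: measurable_funM.
  apply: (measurableT_comp mcos); apply: measurable_funM => //.
  by apply: measurable_funB => //; exact: (measurableT_comp (mY n)).
have bF z : (`|F z| <= (\1_(`[0, A] : set R) z.2)%:E)%E.
  rewrite lee_fin indicE; have [|_] := boolP (z.2 \in _); last by rewrite mul0r normr0.
  rewrite inE/= in_itv/= => /andP[z0 zA]; rewrite mul1r normrM.
  have h0 : 0 <= A^-1 * z.2 by rewrite mulr_ge0// invr_ge0 ltW.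
  have h1 : A^-1 * z.2 <= 1 by rewrite ler_pdivrMl// mulr1.
  have := cos_max ((x - Y n z.1) * z.2).
  have : `|1 - A^-1 * z.2| <= 1 by rewrite ger0_norm; lra.
  by move=> ? ?; exact: mulr_ile1.
have leb : (\int[mu]_u (\1_(`[0%R, A] : set R) u)%:E = A%:E)%E.
  rewrite integral_indic//= setIT lebesgue_measure_itv/= lte_fin A0.
  by rewrite -EFinB subr0.
have iF : (Q \x mu)%E.-integrable setT F.
  apply/integrable12ltyP => //.
  apply: (@le_lt_trans _ _ (\int[Q]_w A%:E)%E); last first.
    by rewrite integral_cst//= (@probability_setT _ _ _ Q) mule1 ltry.
  apply: ge0_le_integral => //.
  - by move=> w _; exact: integral_ge0.
  - have mabsF : measurable_fun setT (abse \o F) by exact: measurableT_comp.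
    exact: (@measurable_fun_fubini_tonelli_F _ _ _ _ _ mu (abse \o F) mabsF (fun z => abse_ge0 _)).
  - move=> w _; rewrite -leb; apply: ge0_le_integral => //.
    + apply: measurableT_comp => //; exact: (measurableT_comp mF (measurable_pair1 w)).
    + by apply/measurable_EFinP; exact: measurable_indic.
transitivity (\int[Q]_w ((pi^-1)%:E * (pi * fejer A (x - Y n w))%:E))%E.
  by apply: eq_integral => w _; rewrite -EFinM mulrA mulVf ?gt_eqF// mul1r.
rewrite ge0_integralZl//; last 3 first.
- apply/measurable_EFinP; apply: measurable_funM => //.
  by apply: (measurableT_comp (measurable_fejer A)); exact: measurable_funB.
- by move=> w _; rewrite lee_fin mulr_ge0 ?fejer_ge0 ?ltW.
- by rewrite lee_fin invr_ge0 ltW.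
congr (_ * _)%E.
transitivity (\int[Q]_w \int[mu]_u F (w, u))%E.
  apply: eq_integral => w _; rewrite -fejer_fourier// [LHS]integral_mkcond.
  apply: eq_integral => u _; rewrite patchE /F/= indicE.
  by case: (u \in _); rewrite ?mul1r ?mul0r.
rewrite (Fubini iF).
apply: eq_integral => u _; rewrite /F/= /fourier_density.
under eq_integral do rewrite mulrA EFinM.
rewrite integralZl//; last first.
  apply: (@prob_bounded_integrable _ _ _ _ _ 1); last by move=> w; exact: cos_max.
  apply: (measurableT_comp mcos); apply: measurable_funM => //; exact: measurable_funB.
rewrite mulrA [RHS]EFinM; congr (_ * _)%E.
transitivity (\int[Q]_w (cos (x * u) * cos (u * Y n w) + sin (x * u) * sin (u * Y n w))%:E)%E.
  by apply: eq_integral => w _; rewrite mulrBl cosB (mulrC (Y n w)).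
under eq_integral do rewrite EFinD !EFinM.
rewrite integralD//; last 2 first.
- by apply: integrableZl => //; exact: cos_int.
- by apply: integrableZl => //; exact: sin_int.
rewrite !integralZl//; [|exact: sin_int|exact: cos_int].
rewrite /char_cos /char_sin /Rintegral EFinD !EFinM !fineK//.
- exact: integrable_fin_num (sin_int n u).
- exact: integrable_fin_num (cos_int n u).
Qed.

Lemma gauss_halfline k : 0 < k ->
  (\int[mu]_u (\1_(`[0%R, +oo[ : set R) u * expR (- (k * u ^+ 2)))%:E =
   (Num.sqrt pi / (2 * Num.sqrt k))%:E)%E.
Proof.
move=> k0; have q0 : 0 < Num.sqrt k by rewrite sqrtr_gt0.
have q2 : Num.sqrt k ^+ 2 = k by rewrite sqr_sqrtr// ltW.
have mI : measurable_fun setT (\1_(`[0%R, +oo[ : set R) : R -> R) by exact: measurable_indic.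
pose f u : R := \1_(`[0%R, +oo[ : set R) u * gauss_fun u.
have mf : measurable_fun setT f by apply: measurable_funM => //; exact: measurable_gauss_fun.
have f0 u : (0 <= (f u)%:E)%E by rewrite lee_fin mulr_ge0// gauss_fun_ge0.
have : (\int[mu]_u (f u)%:E = (Num.sqrt pi / 2)%:E)%E.
  rewrite -integral0y_gauss [RHS]integral_mkcond; apply: eq_integral => u _.
  by rewrite patchE /f indicE; case: (u \in _); rewrite ?mul1r ?mul0r.
rewrite (@ge0_integral_affine _ (Num.sqrt k) 0)//; [|by rewrite gt_eqF|exact/measurable_EFinP].
rewrite gtr0_norm//.
have -> : (\int[mu]_u (f (Num.sqrt k * u + 0))%:E =
    \int[mu]_u (\1_(`[0%R, +oo[ : set R) u * expR (- (k * u ^+ 2)))%:E)%E.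
  apply: eq_integral => u _; rewrite /f addr0 /gauss_fun exprMn q2; congr (_ * _)%:E.
  by rewrite !indicE; congr (nat_of_bool _)%:R; apply/idP/idP; rewrite !inE/= !in_itv/= !andbT pmulr_rge0.
move=> /(congr1 (fun z => (Num.sqrt k)^-1%:E * z)%E).
rewrite muleA -EFinM mulVf ?gt_eqF// mul1e => ->; rewrite -EFinM; congr EFin.
by move: (@pi R) => p; field; rewrite gt_eqF.
Qed.

Lemma integrable_gauss_halfline k : 0 < k ->
  mu.-integrable setT (fun u => (\1_(`[0%R, +oo[ : set R) u * expR (- (k * u ^+ 2)))%:E).
Proof.
move=> k0; apply/integrableP; split.
  apply/measurable_EFinP; apply: measurable_funM; first exact: measurable_indic.
  apply: (measurableT_comp (@measurable_expR R)); apply: measurableT_comp => //.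
  by apply: measurable_funM => //; exact: measurable_funX.
under eq_integral do rewrite gee0_abs ?lee_fin ?mulr_ge0 ?expR_ge0//.
by rewrite gauss_halfline// ltry.
Qed.

(** Rescaling the frequencies turns the n-th power of the bound on the modulus into a Gaussian in
    [u] free of [n] and [x]. It serves both the uniform bound and dominated convergence. *)
Lemma fourier_density_le A : 0 < A -> exists2 k, 0 < k &
  forall n (u x : R), (0 < n)%N -> `|fourier_density A x n (u / Num.sqrt n%:R)| <=
    \1_(`[0%R, +oo[ : set R) u * expR (- (k * u ^+ 2)).
Proof.
move=> A0; have [k k0 kP] := modulus_gauss v0 K0 contC contS taylor modulus_lt1 A0.
exists k => // n u x n0; have n0' : 0 < n%:R :> R by rewrite ltr0n.
set q := Num.sqrt n%:R; have q0 : 0 < q by rewrite sqrtr_gt0.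
have qq : q ^+ 2 = n%:R by rewrite sqr_sqrtr// ltW.
rewrite /fourier_density indicE; have [|_] := boolP (_ \in _); last first.
  by rewrite mul0r normr0 mulr_ge0// expR_ge0.
rewrite inE/= in_itv/= => /andP[t0 tA].
have u0 : 0 <= u by move: t0; rewrite pmulr_lge0// invr_gt0.
rewrite indicE mem_set/= ?in_itv/= ?u0// !mul1r normrM -[leRHS]mul1r.
set t := u / q; apply: ler_pM => //.
  have h0 : 0 <= A^-1 * t by rewrite mulr_ge0// invr_ge0 ltW.
  have h1 : A^-1 * t <= 1 by rewrite ler_pdivrMl// mulr1.
  by rewrite ger0_norm; lra.
rewrite (le_trans (nrm2_cauchy_schwarz _ _ _ _))//.
have -> : nrm2 (cos (x * t)) (sin (x * t)) = 1 by rewrite /nrm2 cos2Dsin2 sqrtr1.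
rewrite mul1r (nrm2_powers n (powers t)).
rewrite (_ : - (k * u ^+ 2) = n%:R * - (k * t ^+ 2)); last first.
  by rewrite -qq /t; field; rewrite gt_eqF.
by rewrite expRM_natl lerXn2r ?nnegrE ?nrm2_ge0 ?expR_ge0// kP// t0.
Qed.

Lemma smoothed_rescaled A n x : 0 < A -> (0 < n)%N ->
  ((Num.sqrt n%:R)%:E * smoothed A n x =
   (pi^-1)%:E * \int[mu]_u (fourier_density A x n (u / Num.sqrt n%:R))%:E)%E.
Proof.
move=> A0 n0; have n0' : 0 < n%:R :> R by rewrite ltr0n.
set q := Num.sqrt n%:R; have q0 : 0 < q by rewrite sqrtr_gt0.
have [k k0 kP] := fourier_density_le A0.
have fi : mu.-integrable setT (EFin \o fourier_density A x n).
  have qN0 : q != 0 by rewrite gt_eqF.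
  have gi := integrable_affine 0 qN0 (integrable_gauss_halfline k0).
  apply: (le_integrable _ _ _ gi) => //.
    by apply/measurable_EFinP; exact: measurable_fourier_density.
  move=> u _ /=; rewrite lee_fin [leRHS]ger0_norm; last by rewrite mulr_ge0// expR_ge0.
  have := kP n (q * u + 0) x n0; rewrite -/q addr0 mulrAC mulfV ?gt_eqF// mul1r.
  by [].
rewrite smoothedE// (@integral_affine _ q^-1 0 _ _ fi); last by rewrite invr_eq0 gt_eqF.
rewrite muleCA; congr (_ * _)%E.
rewrite muleA -EFinM gtr0_norm ?invr_gt0// mulfV ?gt_eqF// mul1e.
by apply: eq_integral => u _; rewrite addr0 mulrC.
Qed.

Lemma smoothed_bounded A : 0 < A -> exists2 B, 0 <= B &
  forall n x, ((Num.sqrt n%:R)%:E * smoothed A n x <= B%:E)%E.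
Proof.
move=> A0; have [k k0 kP] := fourier_density_le A0.
have pi0 : 0 < pi :> R := pi_gt0 R.
exists (pi^-1 * (Num.sqrt pi / (2 * Num.sqrt k))).
  by rewrite mulr_ge0 ?invr_ge0 ?(ltW pi0)// divr_ge0 ?sqrtr_ge0// mulr_ge0 ?sqrtr_ge0.
move=> [|n] x.
  rewrite sqrtr0 mul0e lee_fin.
  by rewrite mulr_ge0 ?invr_ge0 ?(ltW pi0)// divr_ge0 ?sqrtr_ge0// mulr_ge0 ?sqrtr_ge0.
rewrite smoothed_rescaled// EFinM -gauss_halfline// lee_wpmul2l ?lee_fin ?invr_ge0 ?(ltW pi0)//.
have gi := integrable_gauss_halfline k0.
have fm : measurable_fun setT (fun u : R => (fourier_density A x n.+1 (u / Num.sqrt n.+1%:R))%:E).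
  apply/measurable_EFinP; apply: (measurableT_comp (measurable_fourier_density A x n.+1)).
  exact: measurable_funM.
apply: le_integral => //.
- apply: (le_integrable _ _ _ gi) => // u _; rewrite lee_fin [leRHS]ger0_norm; first exact: kP.
  by rewrite mulr_ge0// expR_ge0.
- by move=> u _; rewrite lee_fin (le_trans (ler_norm _))// kP.
Qed.

Lemma fourier_density_limit A x u : 0 < A ->
  fourier_density A x n (u / Num.sqrt n%:R) @[n --> \oo] -->
    \1_(`[0%R, +oo[ : set R) u * expR (- (v ^+ 2 / 2 * u ^+ 2)).
Proof.
move=> A0; rewrite indicE; have [|u0] := boolP (u \in _); last first.
  rewrite [false%:R * _]mul0r; apply: cvg_near_cst.
  exists 1%N => // n /= n0; rewrite /fourier_density indicE memNset ?mul0r//=.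
  rewrite in_itv/= => /andP[t0 _]; move: u0; rewrite notin_setE/= in_itv/= andbT; apply.
  by move: t0; rewrite pmulr_lge0// invr_gt0 sqrtr_gt0 ltr0n.
rewrite inE/= in_itv/= andbT mul1r => u0.
have [cl sl] := gauss_limit K0 taylor modulus_lt1 powers u0.
have tl : u / Num.sqrt n%:R @[n --> \oo] --> (0 : R).
  by rewrite -(mulr0 u); apply: cvgMr; exact: cvg_inv_sqrtn.
have xt : x * (u / Num.sqrt n%:R) @[n --> \oo] --> (0 : R).
  by rewrite -(mulr0 x); apply: cvgMr.
have cosl : cos (x * (u / Num.sqrt n%:R)) @[n --> \oo] --> (1 : R).
  by have := @continuous_cos R 0; rewrite /continuous_at cos0; apply: cvg_comp.
have sinl : sin (x * (u / Num.sqrt n%:R)) @[n --> \oo] --> (0 : R).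
  by have := @continuous_sin R 0; rewrite /continuous_at sin0; apply: cvg_comp.
have main : (1 - A^-1 * (u / Num.sqrt n%:R)) *
    (cos (x * (u / Num.sqrt n%:R)) * char_cos n (u / Num.sqrt n%:R) +
     sin (x * (u / Num.sqrt n%:R)) * char_sin n (u / Num.sqrt n%:R)) @[n --> \oo] -->
    (1 - A^-1 * 0) * (1 * expR (- (v ^+ 2 * u ^+ 2 / 2)) + 0 * 0).
  apply: cvgM; first by apply: cvgB; [exact: cvg_cst|exact: cvgMr].
  by apply: cvgD; apply: cvgM.
rewrite (_ : v ^+ 2 / 2 * u ^+ 2 = v ^+ 2 * u ^+ 2 / 2); last by ring.
move: main; rewrite mulr0 subr0 mul1r mul1r mul0r addr0; apply: cvg_trans.
apply: near_eq_cvg; move/cvgrPdist_lt : tl => /(_ A A0); apply: filterS => n.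
rewrite sub0r normrN => h; rewrite /fourier_density indicE mem_set ?mul1r//=.
rewrite in_itv/= mulr_ge0 ?invr_ge0 ?sqrtr_ge0//=.
by rewrite (le_trans (ler_norm _))// ltW.
Qed.

(** Dominated convergence to a Gaussian integral on the half-line, evaluated at [v ^+ 2 / 2] and
    divided by [pi]. The limit depends neither on [A] nor on [x], which is what allows the smoothing
    to be undone. *)
Lemma smoothed_limit A x : 0 < A ->
  ((Num.sqrt n%:R)%:E * smoothed A n x)%E @[n --> \oo] -->
    ((v * Num.sqrt (2 * pi))^-1)%:E.
Proof.
move=> A0; have [k k0 kP] := fourier_density_le A0.
have pi0 : 0 < pi :> R := pi_gt0 R.
have v20 : 0 < v ^+ 2 / 2 by rewrite divr_gt0// exprn_gt0.
have -> : (((v * Num.sqrt (2 * pi))^-1)%:E = (pi^-1)%:E *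
    \int[mu]_u (\1_(`[0%R, +oo[ : set R) u * expR (- (v ^+ 2 / 2 * u ^+ 2)))%:E)%E.
  rewrite gauss_halfline// -EFinM; congr EFin.
  rewrite (sqrtrM _ (ler0n R 2)) (sqrtrM _ (sqr_ge0 v)) sqrtr_sqr gtr0_norm// sqrtrV//.
  have := sqr_sqrtr (ltW pi0); have : 0 < Num.sqrt pi :> R by rewrite sqrtr_gt0.
  have := sqr_sqrtr (ler0n R 2); have : 0 < Num.sqrt 2 :> R by rewrite sqrtr_gt0 ltr0n.
  move: (Num.sqrt pi) (Num.sqrt 2) => p q q0 qq p0 pp; rewrite -pp.
  rewrite -[in RHS]qq; field; by rewrite !gt_eqF.
(* Index 0 is skipped, since the rescaling divides by the square root of the index. *)
rewrite -(cvg_shiftn 1); under eq_fun do rewrite addn1 smoothed_rescaled//.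
apply: cvgeZl => //.
apply: (@dominated_cvg _ _ _ mu setT measurableT
    (fun n u => (fourier_density A x n.+1 (u / Num.sqrt n.+1%:R))%:E) _ _ _ _ _
    (integrable_gauss_halfline k0)).
- move=> n; apply/measurable_EFinP; apply: (measurableT_comp (measurable_fourier_density A x n.+1)).
  exact: measurable_funM.
- move=> u _; apply: cvg_EFin; first exact: nearW.
  have := @fourier_density_limit A x u A0; rewrite -(cvg_shiftn 1).
  by under eq_fun do rewrite addn1.
- by move=> u _.
- by move=> n u _; rewrite lee_fin kP.
Qed.

End local_limit.

(** * Exponential tails *)

Section exponential_tail.
Context (R : realType).
Variable alpha : R.
Hypothesis alpha0 : 0 < alpha.
Local Notation mu := (@lebesgue_measure R).

(** What undoing the tilting leaves of a tail event: the jump at 0 is the event, the exponential is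
    the inverse of the density up to normalisation. *)
Definition exp_tail (z : R) : R := \1_(`]0, +oo[ : set R) z * expR (- alpha * z).

Lemma exp_tailE (z : R) : exp_tail z = if 0 < z then expR (- (alpha * z)) else 0.
Proof.
rewrite /exp_tail indicE; have [z0|z0] := ltP 0 z.
  by rewrite mem_set ?mul1r ?mulNr//= in_itv/= z0.
by rewrite memNset ?mul0r//= in_itv/= andbT; apply/negP; rewrite -leNgt.
Qed.

Lemma exp_tail_ge0 (z : R) : 0 <= exp_tail z.
Proof. by rewrite mulr_ge0// expR_ge0. Qed.

Lemma exp_tail_le1 (z : R) : exp_tail z <= 1.
Proof.
rewrite exp_tailE; case: ifPn => // z0; rewrite -expR0 ler_expR oppr_le0.
by rewrite mulr_ge0// ltW.
Qed.

Lemma measurable_exp_tail : measurable_fun setT exp_tail.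
Proof.
apply: measurable_funM; first exact: measurable_indic.
by apply: (measurableT_comp (@measurable_expR R)); exact: measurable_funM.
Qed.

Lemma exp_tail_integral : (\int[mu]_u (exp_tail u)%:E = (alpha^-1)%:E)%E.
Proof.
have aN0 : alpha != 0 by rewrite gt_eqF.
rewrite integral_indic_itvoy; last first.
  by apply: (measurableT_comp (@measurable_expR R)); exact: measurable_funM.
have dF (x : R) : 0 <= x -> is_derive x 1 (fun y => - (expR (- alpha * y) * alpha^-1)) (expR (- alpha * x)).
  by move=> _; apply: is_derive_eq; rewrite /GRing.scale/=; field.
rewrite (ge0_FTC2y (l := 0) _ dF).
- by rewrite mulr0 expR0 mul1r sub0r opprK.
- by move=> x _; exact: expR_ge0.
- by move=> x _; apply: is_derive_continuous.
- rewrite -[0]oppr0 -(mul0r alpha^-1); apply: cvgN; apply: cvgMl.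
  exact: cvgr_expR_scale.
Qed.

Definition tail_conv (A y : R) : \bar R := (\int[mu]_u (exp_tail u * fejer A (u - y))%:E)%E.

Lemma tail_convE (A y : R) : 0 < A ->
  (tail_conv A y = \int[mu]_u (exp_tail (u + y) * fejer A u)%:E)%E.
Proof.
move=> A0; rewrite /tail_conv (@ge0_integral_affine _ 1 y)//.
- rewrite normr1 mul1e; apply: eq_integral => u _.
  by rewrite mul1r addrK.
- apply/measurable_EFinP; apply: measurable_funM; first exact: measurable_exp_tail.
  by apply: (measurableT_comp (measurable_fejer A)); exact: measurable_funB.
- by move=> u; rewrite lee_fin mulr_ge0 ?exp_tail_ge0// fejer_ge0// ltW.
Qed.

(** On the window the argument lies between [y] and [y + 2 * e]. The shift by [e] keeps it on the
    positive side, where monotonicity can replace the continuity that fails at 0. *)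
Lemma exp_tail_window (y e u : R) : `|u| <= e -> 0 < y ->
  expR (- (alpha * y)) * expR (- (2 * alpha * e)) <= exp_tail (u + (y + e)).
Proof.
rewrite ler_norml => /andP[u1 u2] y0; rewrite exp_tailE ifT; last lra.
rewrite -expRD ler_expR; have := mulr_ge0 (ltW alpha0) (_ : 0 <= e - u); rewrite subr_ge0 => /(_ u2); lra.
Qed.

Lemma exp_tail_window_le (y e u : R) : `|u| <= e ->
  exp_tail (u + (y - e)) <= expR (2 * alpha * e) * exp_tail y.
Proof.
rewrite ler_norml => /andP[u1 u2].
rewrite !exp_tailE; case: ifPn => [h|_]; last by rewrite mulr_ge0 ?expR_ge0//; case: ifPn => // _; rewrite expR_ge0.
rewrite ifT; last lra.
rewrite -expRD ler_expR; have := mulr_ge0 (ltW alpha0) (_ : 0 <= u + e); rewrite -[0 <= u + e]lerBlDr sub0r => /(_ u1); lra.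
Qed.

Lemma fejer_mass (A e : R) : 0 < A -> 0 < e ->
  ((1 - 4 / (pi * A * e))%:E <= \int[mu]_(x in `[(- e)%R, e]) (fejer A x)%:E)%E.
Proof.
move=> A0 e0; have mf := measurable_fejer A.
have h := fejer_tail A0 e0.
have mI : measurable (`[(- e)%R, e] : set R) by exact: measurable_itv.
have f0 x : (0 <= (fejer A x)%:E)%E by rewrite lee_fin fejer_ge0// ltW.
have := fejer_total A0.
rewrite -(setUv (`[(- e)%R, e] : set R)) ge0_integral_setU//=; last 3 first.
- exact: measurableC.
- by apply/measurable_EFinP; exact: measurable_funTS.
- by apply/disj_set2P; rewrite setICr.
by rewrite EFinB leeBlDr// => <-; rewrite leeD2l.
Qed.

Lemma le_tail_conv (A y e : R) : 0 < A -> 0 < e ->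
  ((exp_tail y * (expR (- (2 * alpha * e)) * (1 - 4 / (pi * A * e))))%:E <= tail_conv A (y + e))%E.
Proof.
move=> A0 e0; have mf := measurable_fejer A; have fge x := fejer_ge0 x (ltW A0).
have mET : measurable_fun setT (fun u : R => (exp_tail (u + (y + e)) * fejer A u)%:E).
  apply/measurable_EFinP; apply: measurable_funM => //.
  by apply: (measurableT_comp measurable_exp_tail); exact: measurable_funD.
rewrite [exp_tail y]exp_tailE; case: ifPn => [y0|_]; last first.
  by rewrite mul0r; apply: integral_ge0 => u _; rewrite lee_fin mulr_ge0 ?exp_tail_ge0.
rewrite tail_convE//.
apply: (@le_trans _ _ (\int[mu]_(u in `[(- e)%R, e]) (exp_tail (u + (y + e)) * fejer A u)%:E)%E); last first.
  apply: ge0_subset_integral => //.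
  by move=> u _; rewrite lee_fin mulr_ge0 ?exp_tail_ge0.
apply: (@le_trans _ _ (\int[mu]_(u in `[(- e)%R, e])
    ((expR (- (alpha * y)) * expR (- (2 * alpha * e)))%:E * (fejer A u)%:E))%E); last first.
  apply: ge0_le_integral => //.
  - by move=> u _; rewrite lee_fin mulr_ge0// mulr_ge0 ?expR_ge0.
  - by apply/measurable_EFinP; apply: measurable_funM => //; exact: measurable_funTS.
  - exact: measurable_funTS.
  - move=> u /=; rewrite in_itv/= => uI; rewrite lee_fin ler_wpM2r//.
    by apply: exp_tail_window => //; rewrite ler_norml.
rewrite ge0_integralZl//; last 2 first.
- by apply/measurable_EFinP; exact: measurable_funTS.
- by move=> u _; rewrite lee_fin.
rewrite mulrA EFinM lee_wpmul2l ?fejer_mass//.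
Qed.

(** For an upper bound the part outside the window cannot be dropped. It is kept as an integral, to
    be controlled once averaged over [Y n]. *)
Lemma tail_conv_le (A y e : R) : 0 < A -> 0 < e ->
  (tail_conv A (y - e) <= (expR (2 * alpha * e) * exp_tail y)%:E +
     \int[mu]_(u in ~` `[(- e)%R, e]) (exp_tail (u + (y - e)) * fejer A u)%:E)%E.
Proof.
move=> A0 e0; have mf := measurable_fejer A; have fge x := fejer_ge0 x (ltW A0).
have mET : measurable_fun setT (fun u : R => (exp_tail (u + (y - e)) * fejer A u)%:E).
  apply/measurable_EFinP; apply: measurable_funM => //.
  by apply: (measurableT_comp measurable_exp_tail); exact: measurable_funD.
rewrite tail_convE// -(setUv (`[(- e)%R, e] : set R)) ge0_integral_setU//=; last 4 first.
- exact: measurableC.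
- exact: measurable_funTS.
- by move=> u _; rewrite lee_fin mulr_ge0 ?exp_tail_ge0.
- by apply/disj_set2P; rewrite setICr.
apply: leeD => //.
apply: (@le_trans _ _ (\int[mu]_(u in `[(- e)%R, e])
    ((expR (2 * alpha * e) * exp_tail y)%:E * (fejer A u)%:E))%E).
  apply: ge0_le_integral => //.
  - by move=> u _; rewrite lee_fin mulr_ge0 ?exp_tail_ge0.
  - exact: measurable_funTS.
  - by apply/measurable_EFinP; apply: measurable_funM => //; exact: measurable_funTS.
  - move=> u /=; rewrite in_itv/= => uI; rewrite lee_fin ler_wpM2r//.
    by apply: exp_tail_window_le; rewrite ler_norml.
rewrite ge0_integralZl//; last 3 first.
- by apply/measurable_EFinP; exact: measurable_funTS.
- by move=> u _; rewrite lee_fin.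
- by rewrite lee_fin mulr_ge0 ?expR_ge0// exp_tail_ge0.
rewrite -[leRHS]mule1 lee_wpmul2l//; first by rewrite lee_fin mulr_ge0 ?expR_ge0// exp_tail_ge0.
rewrite -(fejer_total A0); apply: ge0_subset_integral => //.
- by apply/measurable_EFinP.
- by move=> u _; rewrite lee_fin.
Qed.

Context d (T : measurableType d) (Q : probability T R).
Variables (Y : nat -> T -> R) (kappa : R).
Hypothesis mY : forall n, measurable_fun setT (Y n).
Hypothesis kappa0 : 0 <= kappa.
Hypothesis bounded : forall A : R, 0 < A -> exists2 B, 0 <= B &
  forall n x, ((Num.sqrt n%:R)%:E * smoothed Q Y A n x <= B%:E)%E.
Hypothesis limit : forall A x : R, 0 < A ->
  ((Num.sqrt n%:R)%:E * smoothed Q Y A n x)%E @[n --> \oo] --> kappa%:E.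

Definition exp_mean n (b : R) : \bar R := (\int[Q]_w (exp_tail (Y n w - b))%:E)%E.

Let msm (A : R) n (g : R -> R) : 0 < A -> measurable_fun setT g ->
  measurable_fun setT (fun x : R => smoothed Q Y A n (g x)).
Proof.
move=> A0 mg; pose F (z : R * T) : \bar R := (fejer A (g z.1 - Y n z.2))%:E.
have mF : measurable_fun setT F.
  apply/measurable_EFinP; apply: (measurableT_comp (measurable_fejer A)).
  apply: measurable_funB.
    by apply: (measurableT_comp mg); exact: measurable_fst.
  by apply: (measurableT_comp (mY n)); exact: measurable_snd.
apply: (@measurable_fun_fubini_tonelli_F _ _ _ _ _ Q F mF) => z.
by rewrite lee_fin fejer_ge0// ltW.
Qed.

(** Exchanging the two integrals brings out the smoothed density of [Y n], to which the local limit
    theorem applies. *)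
Lemma tail_conv_mean (A b : R) n : 0 < A ->
  (\int[Q]_w tail_conv A (Y n w - b) = \int[mu]_u ((exp_tail u)%:E * smoothed Q Y A n (b + u)))%E.
Proof.
move=> A0; have fge x := fejer_ge0 x (ltW A0).
pose F (z : T * R) : \bar R := (exp_tail z.2 * fejer A (z.2 - (Y n z.1 - b)))%:E.
have mF : measurable_fun setT F.
  apply/measurable_EFinP; apply: measurable_funM.
    by apply: (measurableT_comp measurable_exp_tail); exact: measurable_snd.
  apply: (measurableT_comp (measurable_fejer A)); apply: measurable_funB.
    exact: measurable_snd.
  apply: measurable_funB => //.
  by apply: (measurableT_comp (mY n)); exact: measurable_fst.
have F0 z : (0 <= F z)%E by rewrite lee_fin mulr_ge0// exp_tail_ge0.
transitivity (\int[mu]_u \int[Q]_w F (w, u))%E.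
  exact: (@fubini_tonelli _ _ _ _ _ Q mu F mF F0).
apply: eq_integral => u _; rewrite /F/= /smoothed.
under eq_integral do rewrite EFinM.
rewrite ge0_integralZl//; last 3 first.
- apply/measurable_EFinP; apply: (measurableT_comp (measurable_fejer A)).
  by apply: measurable_funB => //; exact: measurable_funB.
- by move=> w _; rewrite lee_fin.
- by rewrite lee_fin exp_tail_ge0.
congr (_ * _)%E; apply: eq_integral => w _; congr (fejer A _)%:E; ring.
Qed.

Definition conv_mean (A b : R) n : \bar R :=
  ((Num.sqrt n%:R)%:E * \int[Q]_w tail_conv A (Y n w - b))%E.

Lemma conv_meanE (A b : R) n : 0 < A ->
  (conv_mean A b n = \int[mu]_u ((exp_tail u)%:E * ((Num.sqrt n%:R)%:E * smoothed Q Y A n (b + u))))%E.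
Proof.
move=> A0; rewrite /conv_mean tail_conv_mean// -ge0_integralZl//.
- by apply: eq_integral => u _; rewrite muleCA.
- apply: emeasurable_funM.
    by apply/measurable_EFinP; exact: measurable_exp_tail.
  by apply: msm => //; exact: measurable_funD.
- move=> u _; rewrite mule_ge0 ?lee_fin ?exp_tail_ge0//.
  by apply: integral_ge0 => w _; rewrite lee_fin fejer_ge0// ltW.
Qed.

Lemma conv_mean_bounded (A : R) : 0 < A -> exists2 B, 0 <= B &
  forall n b, (conv_mean A b n <= B%:E)%E.
Proof.
move=> A0; have [B B0 BP] := bounded A0.
exists (alpha^-1 * B); first by rewrite mulr_ge0// invr_ge0 ltW.
move=> n b; rewrite conv_meanE// EFinM -exp_tail_integral -ge0_integralZr//; last 2 first.
- by apply/measurable_EFinP; exact: measurable_exp_tail.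
- by move=> u _; rewrite lee_fin exp_tail_ge0.
 apply: ge0_le_integral => //.
  + move=> u _; rewrite mule_ge0 ?lee_fin ?exp_tail_ge0// mule_ge0 ?lee_fin ?sqrtr_ge0//.
    by apply: integral_ge0 => w _; rewrite lee_fin fejer_ge0// ltW.
  + apply: emeasurable_funM.
      by apply/measurable_EFinP; exact: measurable_exp_tail.
    apply: emeasurable_funM; first exact: measurable_cst.
    by apply: msm => //; exact: measurable_funD.
  + by apply/measurable_EFinP; apply: measurable_funM => //; exact: measurable_exp_tail.
  + by move=> u _; rewrite lee_wpmul2l// lee_fin exp_tail_ge0.
Qed.

Lemma conv_mean_limit (A b : R) : 0 < A ->
  conv_mean A b n @[n --> \oo] --> (kappa / alpha)%:E.
Proof.
move=> A0; have [B B0 BP] := bounded A0.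
have sge n x : (0 <= (Num.sqrt n%:R)%:E * smoothed Q Y A n x)%E.
  rewrite mule_ge0 ?lee_fin ?sqrtr_ge0//.
  by apply: integral_ge0 => w _; rewrite lee_fin fejer_ge0// ltW.
have iET (k : R) : 0 <= k -> mu.-integrable setT (fun u : R => ((exp_tail u)%:E * k%:E)%E).
  move=> k0; apply: integrableZr => //; apply/integrableP; split.
    by apply/measurable_EFinP; exact: measurable_exp_tail.
  under eq_integral do rewrite gee0_abs ?lee_fin ?exp_tail_ge0//.
  by rewrite exp_tail_integral ltry.
under eq_fun do rewrite conv_meanE//.
have -> : ((kappa / alpha)%:E = \int[mu]_u ((exp_tail u)%:E * kappa%:E))%E.
  rewrite ge0_integralZr//.
  - by rewrite exp_tail_integral -EFinM mulrC.
  - by apply/measurable_EFinP; exact: measurable_exp_tail.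
  - by move=> u _; rewrite lee_fin exp_tail_ge0.
apply: (@dominated_cvg _ _ _ mu setT measurableT _ _ _ _ _ _ (iET _ B0)).
- move=> n; apply: emeasurable_funM.
    by apply/measurable_EFinP; exact: measurable_exp_tail.
  apply: emeasurable_funM; first exact: measurable_cst.
  by apply: msm => //; exact: measurable_funD.
- by move=> u _; apply: cvgeZl => //; exact: limit.
- by move=> u _.
- move=> n u _; rewrite gee0_abs ?mule_ge0 ?lee_fin ?exp_tail_ge0//.
    by rewrite lee_wpmul2l// lee_fin exp_tail_ge0.
  by apply: integral_ge0 => w _; rewrite lee_fin fejer_ge0// ltW.
Qed.

Let mET n (b : R) : measurable_fun setT (fun w => (exp_tail (Y n w - b))%:E).
Proof.
apply/measurable_EFinP; apply: (measurableT_comp measurable_exp_tail).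
exact: measurable_funB.
Qed.

Lemma exp_mean_ge0 n (b : R) : (0 <= exp_mean n b)%E.
Proof. by apply: integral_ge0 => w _; rewrite lee_fin exp_tail_ge0. Qed.

Lemma exp_mean_le1 n (b : R) : (exp_mean n b <= 1)%E.
Proof.
rewrite -(@probability_setT _ _ _ Q) -[leRHS]mul1e -integral_cst//.
apply: ge0_le_integral => //.
- by move=> w _; rewrite lee_fin exp_tail_ge0.
- by move=> w _; rewrite lee_fin exp_tail_le1.
Qed.

Let mTC (A b : R) n : 0 < A -> measurable_fun setT (fun w => tail_conv A (Y n w - b)).
Proof.
move=> A0; have fge x := fejer_ge0 x (ltW A0).
pose F (z : T * R) : \bar R := (exp_tail z.2 * fejer A (z.2 - (Y n z.1 - b)))%:E.
have mF : measurable_fun setT F.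
  apply/measurable_EFinP; apply: measurable_funM.
    by apply: (measurableT_comp measurable_exp_tail); exact: measurable_snd.
  apply: (measurableT_comp (measurable_fejer A)); apply: measurable_funB.
    exact: measurable_snd.
  apply: measurable_funB => //.
  by apply: (measurableT_comp (mY n)); exact: measurable_fst.
have F0 z : (0 <= F z)%E by rewrite lee_fin mulr_ge0// exp_tail_ge0.
exact: (@measurable_fun_fubini_tonelli_F _ _ _ _ _ mu F mF F0).
Qed.

Let tail_conv_ge0 (A y : R) : 0 < A -> (0 <= tail_conv A y)%E.
Proof.
move=> A0; apply: integral_ge0 => u _.
by rewrite lee_fin mulr_ge0 ?exp_tail_ge0// fejer_ge0// ltW.
Qed.

Lemma exp_mean_le_conv (A e b : R) n : 0 < A -> 0 < e -> 4 / (pi * A * e) <= 1 ->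
  ((expR (- (2 * alpha * e)) * (1 - 4 / (pi * A * e)))%:E * ((Num.sqrt n%:R)%:E * exp_mean n b) <=
   conv_mean A (b - e) n)%E.
Proof.
move=> A0 e0 t1; rewrite muleCA lee_wpmul2l ?lee_fin ?sqrtr_ge0//.
rewrite -ge0_integralZl//; last 2 first.
- by move=> w _; rewrite lee_fin exp_tail_ge0.
- by rewrite lee_fin mulr_ge0 ?expR_ge0// subr_ge0.
apply: ge0_le_integral => //.
- by move=> w _; rewrite lee_fin mulr_ge0 ?exp_tail_ge0// mulr_ge0 ?expR_ge0// subr_ge0.
- exact: emeasurable_funM.
- exact: mTC.
- move=> w _; rewrite opprB addrA addrAC -EFinM mulrC; exact: le_tail_conv.
Qed.

Lemma exp_mean_bounded : exists2 B, 0 <= B &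
  forall n b, ((Num.sqrt n%:R)%:E * exp_mean n b <= B%:E)%E.
Proof.
(* Any [A] and [e] with [4 / (pi * A * e) < 1] serve; [A = 4] and [e = 1] give the value
   [1 / pi]. *)
have [B B0 BP] := conv_mean_bounded (ltr0n R 4).
have t1 : 4 / (pi * 4 * 1) < 1 :> R.
  by rewrite ltr_pdivrMr ?mul1r ?mulr1 ?mulr_gt0 ?pi_gt0//; have := pi_ge2 R; lra.
pose c : R := expR (- (2 * alpha * 1)) * (1 - 4 / (pi * 4 * 1)).
have c0 : 0 < c by rewrite mulr_gt0 ?expR_gt0// subr_gt0.
exists (c^-1 * B) => [|n b]; first by rewrite mulr_ge0// invr_ge0 ltW.
rewrite EFinM -lee_pdivrMl ?invr_gt0// invrK.
exact: le_trans (exp_mean_le_conv _ _ (ltr0n R 4) ltr01 (ltW t1)) (BP _ _).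
Qed.

(** Outside the window the kernel averages the shifted quantities [exp_mean n (b + e - u)], each
    controlled by the uniform bound [B]. This is why boundedness in [b] is established before the
    limit. *)
Lemma conv_le_exp_mean (B A e b : R) n : 0 <= B ->
  (forall n b, (Num.sqrt n%:R)%:E * exp_mean n b <= B%:E)%E -> 0 < A -> 0 < e ->
  (conv_mean A (b + e) n <= (expR (2 * alpha * e))%:E * ((Num.sqrt n%:R)%:E * exp_mean n b) +
    (B * (4 / (pi * A * e)))%:E)%E.
Proof.
move=> B0 BP A0 e0; have fge x := fejer_ge0 x (ltW A0).
have mD : measurable (~` `[(- e)%R, e] : set R) by exact: measurableC.
pose F (z : T * R) : \bar R := (exp_tail (z.2 + (Y n z.1 - (b + e))) *
  (\1_(~` `[(- e)%R, e]) z.2 * fejer A z.2))%:E.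
have mF : measurable_fun setT F.
  apply/measurable_EFinP; apply: measurable_funM.
    apply: (measurableT_comp measurable_exp_tail); apply: measurable_funD.
      exact: measurable_snd.
    apply: measurable_funB => //.
    by apply: (measurableT_comp (mY n)); exact: measurable_fst.
  apply: measurable_funM.
    apply: (@measurableT_comp _ _ _ _ _ _ (\1_(~` `[(- e)%R, e]) : R -> R)).
      exact: measurable_indic.
    exact: measurable_snd.
  by apply: (measurableT_comp (measurable_fejer A)); exact: measurable_snd.
have F0 z : (0 <= F z)%E by rewrite lee_fin !mulr_ge0// exp_tail_ge0.
have mG : measurable_fun setT (fun w => \int[mu]_u F (w, u))%E.
  exact: (@measurable_fun_fubini_tonelli_F _ _ _ _ _ mu F mF F0).
have G0 w : (0 <= \int[mu]_u F (w, u))%E by exact: integral_ge0.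
apply: (@le_trans _ _ ((Num.sqrt n%:R)%:E * \int[Q]_w
    ((expR (2 * alpha * e))%:E * (exp_tail (Y n w - b))%:E + \int[mu]_u F (w, u)))%E).
  rewrite lee_wpmul2l ?lee_fin ?sqrtr_ge0//; apply: ge0_le_integral => //.
  - by move=> w _; exact: tail_conv_ge0.
  - exact: mTC.
  - by apply: emeasurable_funD => //; exact: emeasurable_funM.
  - move=> w _; rewrite opprD addrA.
    apply: (le_trans (tail_conv_le _ A0 e0)); rewrite EFinM leeD2l//.
    rewrite integral_mkcond le_eqVlt; apply/orP; left; apply/eqP.
    apply: eq_integral => u _; rewrite patchE /F/= indicE opprD [(Y n w + (- b - e))%R]addrA.
    by case: (u \in _); rewrite ?mul1r ?mul0r ?mulr0.
rewrite ge0_integralD//; last 2 first.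
- by move=> w _; rewrite -EFinM lee_fin mulr_ge0 ?expR_ge0// exp_tail_ge0.
- exact: emeasurable_funM.
rewrite ge0_integralZl//; last first.
  by move=> w _; rewrite lee_fin exp_tail_ge0.
rewrite ge0_muleDr; last 2 first.
- rewrite mule_ge0 ?lee_fin ?expR_ge0//; exact: exp_mean_ge0.
- exact: integral_ge0.
rewrite muleCA leeD2l//.
have -> : (\int[Q]_w \int[mu]_u F (w, u) = \int[mu]_u \int[Q]_w F (w, u))%E.
  exact: (@fubini_tonelli _ _ _ _ _ Q mu F mF F0).
have mH : measurable_fun setT (fun u => \int[Q]_w F (w, u))%E.
  exact: (@measurable_fun_fubini_tonelli_G _ _ _ _ _ Q F mF F0).
have mI : measurable_fun setT (fun u : R => (\1_(~` `[(- e)%R, e]) u * fejer A u)%:E).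
  apply/measurable_EFinP; apply: measurable_funM; last exact: measurable_fejer.
  exact: measurable_indic.
have I0 u : 0 <= (\1_(~` `[(- e)%R, e]) u * fejer A u) :> R by exact: mulr_ge0.
rewrite -ge0_integralZl//; last first.
  by move=> u _; exact: integral_ge0.
apply: (@le_trans _ _ (\int[mu]_u (B%:E * (\1_(~` `[(- e)%R, e]) u * fejer A u)%:E))%E).
  apply: ge0_le_integral => //.
  - by move=> u _; rewrite mule_ge0 ?lee_fin ?sqrtr_ge0//; exact: integral_ge0.
  - exact: emeasurable_funM.
  - exact: emeasurable_funM.
  - move=> u _; rewrite /F/=.
    under eq_integral do rewrite EFinM.
    rewrite ge0_integralZr//; last 3 first.
    + apply/measurable_EFinP; apply: (measurableT_comp measurable_exp_tail).
      by apply: measurable_funD => //; exact: measurable_funB.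
    + by move=> w _; rewrite lee_fin exp_tail_ge0.
    + by rewrite lee_fin.
    rewrite muleA lee_wpmul2r ?lee_fin//.
    rewrite (_ : (\int[Q]_w _)%E = exp_mean n (b + e - u)%R); first exact: BP.
    by apply: eq_integral => w _; congr (exp_tail _)%:E; ring.
rewrite ge0_integralZl//; last by move=> u _; rewrite lee_fin.
rewrite EFinM lee_wpmul2l ?lee_fin//; apply: le_trans (fejer_tail A0 e0).
rewrite [leRHS]integral_mkcond le_eqVlt; apply/orP; left; apply/eqP.
apply: eq_integral => u _; rewrite patchE indicE.
by case: (u \in _); rewrite ?mul1r ?mul0r.
Qed.

Lemma exp_mean_limit (b : R) :
  Num.sqrt n%:R * fine (exp_mean n b) @[n --> \oo] --> kappa / alpha.
Proof.
have [B B0 BP] := exp_mean_bounded.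
have efin n c : exp_mean n c \is a fin_num.
  by rewrite ge0_fin_numE ?exp_mean_ge0// (le_lt_trans (exp_mean_le1 _ _))// ltry.
have cfin (A c : R) n : 0 < A -> conv_mean A c n \is a fin_num.
  move=> A0; have [D D0 DP] := conv_mean_bounded A0.
  rewrite ge0_fin_numE ?(le_lt_trans (DP _ _)) ?ltry//.
  by rewrite mule_ge0 ?lee_fin ?sqrtr_ge0//; apply: integral_ge0 => w _; exact: tail_conv_ge0.
have clim (A c : R) : 0 < A -> fine (conv_mean A c n) @[n --> \oo] --> kappa / alpha.
  by move=> A0; exact: fine_cvg (conv_mean_limit c A0).
set L := kappa / alpha; have L0 : 0 <= L by rewrite divr_ge0// ltW.
(* With [A = e ^- 2] the kernel mass outside [[-e, e]] is of order [e], so a single parameter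
   tending to 0 controls both the window and the tail. *)
have tail_small (e : R) : 0 < e -> 4 / (pi * e ^- 2 * e) <= 2 * e.
  move=> e0; rewrite (_ : 4 / _ = 4 * e / pi); last first.
    by move: (@pi R) (pi_gt0 R) => p p0; field; rewrite !gt_eqF.
  by rewrite ler_pdivrMr ?pi_gt0//; have := pi_ge2 R; nra.
have lower (e : R) n : 0 < e ->
    expR (- (2 * alpha * e)) * (fine (conv_mean (e ^- 2) (b + e) n) - B * (2 * e)) <=
    Num.sqrt n%:R * fine (exp_mean n b).
  move=> e0; have A0 : 0 < e ^- 2 by rewrite invr_gt0 exprn_gt0.
  have := conv_le_exp_mean b n B0 BP A0 e0.
  rewrite -(fineK (efin n b)) -(fineK (cfin _ (b + e) n A0)) -!EFinM -EFinD lee_fin => h.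
  rewrite expRN mulrC ler_pdivrMr ?expR_gt0// lerBlDr mulrC (le_trans h)// lerD2l.
  by rewrite ler_wpM2l// tail_small.
have upper (e : R) n : 0 < e -> 2 * e < 1 ->
    Num.sqrt n%:R * fine (exp_mean n b) <=
    fine (conv_mean (e ^- 2) (b - e) n) * (expR (2 * alpha * e) / (1 - 2 * e)).
  move=> e0 e1; have A0 : 0 < e ^- 2 by rewrite invr_gt0 exprn_gt0.
  have t1 := tail_small _ e0.
  have := exp_mean_le_conv b n A0 e0 (le_trans t1 (ltW e1)).
  rewrite -(fineK (efin n b)) -(fineK (cfin _ (b - e) n A0)) -!EFinM lee_fin => h.
  rewrite mulrA ler_pdivlMr ?subr_gt0// -ler_pdivrMr ?expR_gt0// -expRN.
  apply: le_trans h; rewrite /= -mulrA mulrC ler_wpM2r//.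
    by rewrite mulr_ge0 ?sqrtr_ge0// fine_ge0// exp_mean_ge0.
  by rewrite mulrC ler_wpM2l ?expR_ge0// lerD2l lerN2.
have lowlim : expR (- (2 * alpha * e)) * (L - B * (2 * e)) @[e --> 0^'+] --> L.
  rewrite [X in _ --> X](_ : L = expR (- (2 * alpha * 0)) * (L - B * (2 * 0))); last first.
    by rewrite !mulr0 oppr0 expR0 addr0 mul1r.
  apply: cvg_at_right_filter.
  have : {for (0 : R), continuous (fun e : R => expR (- (2 * alpha * e)) * (L - B * (2 * e)))}.
    exact: is_derive_continuous.
  exact.
have uplim : L * (expR (2 * alpha * e) * (1 + 4 * e)) @[e --> 0^'+] --> L.
  rewrite [X in _ --> X](_ : L = L * (expR (2 * alpha * 0) * (1 + 4 * 0))); last first.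
    by rewrite !mulr0 expR0 addr0 !mulr1.
  apply: cvg_at_right_filter.
  have : {for (0 : R), continuous (fun e : R => L * (expR (2 * alpha * e) * (1 + 4 * e)))}.
    exact: is_derive_continuous.
  exact.
apply/cvgrPdist_le => eps eps0; have eps2 : 0 < eps / 2 by rewrite divr_gt0.
(* The condition [e < 4^-1] gives [1 / (1 - 2 * e) <= 1 + 4 * e], which links the upper estimate to
   the continuous function in [uplim]. *)
have [e [e0 e4 elow eup]] : exists e, [/\ 0 < e, e < 4^-1,
    `|L - expR (- (2 * alpha * e)) * (L - B * (2 * e))| <= eps / 2 &
    `|L - L * (expR (2 * alpha * e) * (1 + 4 * e))| <= eps / 2].
  move/cvgrPdist_le : lowlim => /(_ _ eps2) lowlim.
  move/cvgrPdist_le : uplim => /(_ _ eps2) uplim.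
  have : \forall e \near 0^'+, [/\ 0 < e, e < 4^-1,
      `|L - expR (- (2 * alpha * e)) * (L - B * (2 * e))| <= eps / 2 &
      `|L - L * (expR (2 * alpha * e) * (1 + 4 * e))| <= eps / 2].
    near=> e; split; near: e => //; [exact: nbhs_right_gt|apply: nbhs_right_lt].
    by rewrite invr_gt0.
  exact: filter_ex.
have A0 : 0 < e ^- 2 by rewrite invr_gt0 exprn_gt0.
set h := expR (2 * alpha * e) * (1 + 4 * e).
have h0 : 0 < h by rewrite mulr_gt0 ?expR_gt0// addr_gt0// mulr_gt0.
have h1 : 1 / (1 - 2 * e) <= 1 + 4 * e.
  rewrite ler_pdivrMr; last lra. nra.
have k1 : expR (- (2 * alpha * e)) <= 1.
  by rewrite -expR0 ler_expR oppr_le0 !mulr_ge0// ltW.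
have eps3 : 0 < eps / 2 / h by rewrite divr_gt0.
move/cvgrPdist_le : (clim _ (b + e) A0) => /(_ _ eps2) near1.
move/cvgrPdist_le : (clim _ (b - e) A0) => /(_ _ eps3) near2.
near=> n; rewrite ler_distlC; apply/andP; split.
- apply: le_trans (lower e n e0); set k := expR _ in elow k1 *.
  have k0 : 0 < k by exact: expR_gt0.
  have : `|L - fine (conv_mean (e ^- 2) (b + e) n)| <= eps / 2 by near: n.
  set z := fine _; rewrite !ler_distlC in elow * => /andP[z1 z2]; move/andP: elow => [w1 w2].
  have : k * (L - eps / 2 - B * (2 * e)) <= k * (z - B * (2 * e)) by rewrite ler_wpM2l ?(ltW k0)// lerB.
  have : k * (eps / 2) <= 1 * (eps / 2) by rewrite ler_wpM2r// ltW.
  lra.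
- have e1 : 2 * e < 1 by lra.
  apply: (le_trans (upper e n e0 e1)).
  have : `|L - fine (conv_mean (e ^- 2) (b - e) n)| <= eps / 2 / h by near: n.
  set z := fine _; rewrite !ler_distlC in eup * => /andP[z1 z2]; move/andP: eup => [w1 w2].
  have z0 : 0 <= z.
    rewrite fine_ge0// mule_ge0 ?lee_fin ?sqrtr_ge0//.
    by apply: integral_ge0 => w _; exact: tail_conv_ge0.
  apply: (@le_trans _ _ (z * h)).
    by rewrite ler_wpM2l// /h ler_wpM2l ?expR_ge0// -[leLHS]mul1r.
  have : z * h <= (L + eps / 2 / h) * h by rewrite ler_wpM2r// ltW.
  rewrite mulrDl divfK ?gt_eqF//.
  move: w2; rewrite -/h; lra.
Unshelve. all: by end_near. Qed.

End exponential_tail.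

(** * Characteristic functions of centred variables *)

Section trigonometry.
Context (R : realType).
Implicit Types x y : R.

Lemma sin_int_pi (k : int) : sin (k%:~R * pi) = 0 :> R.
Proof.
have nat_case (n : nat) : sin (n%:R * pi) = 0 :> R.
  elim: n => [|n IH]; first by rewrite mul0r sin0.
  by rewrite -natr1 mulrDl mul1r sinDpi IH oppr0.
by case: k => n; [exact: nat_case|rewrite NegzE rmorphN/= mulNr sinN nat_case oppr0].
Qed.

Lemma sin_eq0_int x : sin x = 0 -> exists k : int, x = k%:~R * pi.
Proof.
move=> sx; have p0 := pi_gt0 R; exists (Num.floor (x / pi)).
set k := Num.floor _; apply/eqP; rewrite -subr_eq0.
have /andP[k1 k2] := floor_itv (x / pi).
rewrite ler_pdivlMr// in k1; rewrite ltr_pdivrMr// intrD mulrDl mul1r in k2.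
have s0 : sin (x - k%:~R * pi) = 0 by rewrite sinB sx sin_int_pi mul0r mulr0 subr0.
have [//|y0] := eqVneq (x - k%:~R * pi) 0.
have : 0 < sin (x - k%:~R * pi).
  apply: sin_gt0_pi; rewrite lt_neqAle eq_sym y0/= subr_ge0 k1/=.
  by rewrite ltrBlDr addrC.
by rewrite s0 ltxx.
Qed.

(** By the half-angle formula the sine of [x / 2] vanishes. *)
Lemma cos_eq1_int x : cos x = 1 -> exists k : int, x = k%:~R * (2 * pi).
Proof.
move=> cx; have : sin (x / 2) = 0.
  have := cos2Dsin2 (x / 2); have := cos_mulr2n (x / 2).
  rewrite -(mulr_natr (x / 2)) divfK ?pnatr_eq0// cx => h1 h2.
  by apply/eqP; rewrite -sqrf_eq0; apply/eqP; lra.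
move=> /sin_eq0_int[k kE]; exists k.
by rewrite mulrCA -kE mulrC divfK ?pnatr_eq0.
Qed.

Lemma MVT_from0 (f df : R -> R) x : (forall z : R, is_derive z 1 f (df z)) -> 0 < x ->
  exists2 c, 0 < c < x & f x - f 0 = df c * x.
Proof.
move=> fd x0; have [|c] := MVT x0 (fun z _ => fd z).
  by apply: continuous_subspaceT => z; exact: is_derive_continuous (fd z).
by rewrite in_itv/= subr0 => cx h; exists c.
Qed.

(** The mean value theorem from 0, used twice: [1 - cos] is at most half a square, hence [x - sin x]
    is at most a cube. The quadratic bound feeds the estimate for the cosine. *)
Lemma sin_near_id x : `|sin x - x| <= `|x| ^+ 3 /\ `|sin x - x| <= x ^+ 2.
Proof.
wlog x0 : x / 0 <= x.
  move=> h; have [|xn] := leP 0 x; first exact: h.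
  have := h (- x); rewrite oppr_ge0 (ltW xn) => /(_ isT).
  by rewrite sinN -opprD normrN normrN sqrrN.
have [->|xN0] := eqVneq x 0; first by rewrite sin0 subrr normr0 !expr0n.
have {xN0} x0' : 0 < x by rewrite lt_neqAle eq_sym xN0.
have d1 (z : R) : is_derive z 1 (fun z => z - sin z) (1 - cos z).
  by apply: is_derive_eq; rewrite /GRing.scale/=; ring.
have d2 (z : R) : is_derive z 1 (fun z => z ^+ 2 / 2 + cos z) (z - sin z).
  by apply: is_derive_eq; rewrite /GRing.scale/=; field.
have sin_le y : 0 <= y -> sin y <= y.
  rewrite le_eqVlt => /predU1P[<-|y0]; first by rewrite sin0.
  have [c cy] := MVT_from0 d1 y0; rewrite sin0 !subr0 => h; by rewrite -subr_ge0 h mulr_ge0 ?(ltW y0)// subr_ge0 cos_le1.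
have cos_ge y : 0 <= y -> 1 - cos y <= y ^+ 2 / 2.
  rewrite le_eqVlt => /predU1P[<-|y0]; first by rewrite cos0 subrr expr0n mul0r.
  have [c /andP[c0 _]] := MVT_from0 d2 y0.
  rewrite cos0 expr0n mul0r add0r => h; rewrite -subr_ge0.
  have -> : y ^+ 2 / 2 - (1 - cos y) = (c - sin c) * y by rewrite -h; ring.
  by rewrite mulr_ge0 ?(ltW y0)// subr_ge0 sin_le// ltW.
have [c /andP[c0 cx']] := MVT_from0 d1 x0'.
rewrite sin0 !subr0 => h; have hc := cos_ge c (ltW c0).
have c1 := cos_le1 c; have c2 := cos_geN1 c.
rewrite distrC (ger0_norm (_ : 0 <= x - sin x)) ?subr_ge0 ?sin_le// h ger0_norm//.
have cc : c ^+ 2 <= x ^+ 2 by rewrite ler_pXn2r ?nnegrE// ltW.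
split.
- rewrite exprSr ler_wpM2r//; lra.
- rewrite expr2 ler_wpM2r//.
  (* Up to 2 the bound [c ^+ 2 / 2] on [1 - cos c] is enough; beyond 2 the trivial bound by 2 is. *)
  have [x2|x2] := leP x 2; last lra.
  apply: (le_trans hc); nra.
Qed.

Lemma cos_near_quadratic x : `|cos x - (1 - x ^+ 2 / 2)| <= `|x| ^+ 3.
Proof.
wlog x0 : x / 0 <= x.
  move=> h; have [|xn] := leP 0 x; first exact: h.
  have := h (- x); rewrite oppr_ge0 (ltW xn) => /(_ isT).
  by rewrite cosN normrN sqrrN.
have [->|xN0] := eqVneq x 0; first by rewrite cos0 normr0 !expr0n mul0r subr0 subrr normr0.
have {xN0} x0' : 0 < x by rewrite lt_neqAle eq_sym xN0.
have d2 (z : R) : is_derive z 1 (fun z => z ^+ 2 / 2 + cos z) (z - sin z).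
  by apply: is_derive_eq; rewrite /GRing.scale/=; field.
have [c /andP[c0 cx']] := MVT_from0 d2 x0'.
rewrite cos0 expr0n mul0r add0r => h.
have -> : cos x - (1 - x ^+ 2 / 2) = (c - sin c) * x by rewrite -h; ring.
rewrite normrM (ger0_norm x0) exprSr ler_wpM2r//.
rewrite distrC; apply: (le_trans (sin_near_id c).2).
by rewrite ler_pXn2r ?nnegrE// ltW.
Qed.

End trigonometry.

Section characteristic_function_of_variable.
Context d (T : measurableType d) (R : realType) (Q : probability T R).
Variables (Z : T -> R) (v : R).
Hypothesis mZ : measurable_fun setT Z.
Hypothesis iZ1 : Q.-integrable setT (EFin \o Z).
Hypothesis iZ2 : Q.-integrable setT (EFin \o (fun w => Z w ^+ 2)).
Hypothesis iZ3 : Q.-integrable setT (EFin \o (fun w => `|Z w| ^+ 3)).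
Hypothesis meanZ : (\int[Q]_w Z w)%R = 0.
Hypothesis varZ : (\int[Q]_w (Z w ^+ 2))%R = v ^+ 2.

Definition mean_cos t : R := (\int[Q]_w cos (t * Z w))%R.
Definition mean_sin t : R := (\int[Q]_w sin (t * Z w))%R.

Let mcos : measurable_fun setT (@cos R).
Proof. by apply: continuous_measurable_fun; exact: continuous_cos. Qed.

Let msin : measurable_fun setT (@sin R).
Proof. by apply: continuous_measurable_fun; exact: continuous_sin. Qed.

Let cos_int t : Q.-integrable setT (EFin \o (fun w => cos (t * Z w))).
Proof.
apply: (@prob_bounded_integrable _ _ _ _ _ 1); last by move=> w; exact: cos_max.
by apply: (measurableT_comp mcos); exact: measurable_funM.
Qed.

Let sin_int t : Q.-integrable setT (EFin \o (fun w => sin (t * Z w))).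
Proof.
apply: (@prob_bounded_integrable _ _ _ _ _ 1); last by move=> w; exact: sin_max.
by apply: (measurableT_comp msin); exact: measurable_funM.
Qed.

Let cont_mean (f : R -> R) : continuous f -> (forall x, `|f x| <= 1) ->
  (forall t, Q.-integrable setT (EFin \o (fun w => f (t * Z w)))) ->
  continuous (fun t : R => (\int[Q]_w f (t * Z w))%R).
Proof.
move=> cf f1 fi t.
apply: (@continuity_under_integral _ _ _ Q (fun (t : R) w => f (t * Z w)) setT measurableT (t - 1) (t + 1)
  _ _ (cst 1)).
- by move=> x _; exact: fi.
- apply: aeW => w _ x _; apply: (@continuous_comp R R R (fun y : R => y * Z w) f); last exact: cf.
  exact: mulrr_continuous.
- exact: finite_measure_integrable_cst.
- by move=> x _; apply: aeW => w _; exact: f1.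
- by rewrite inE/= in_itv/=; lra.
Qed.

Lemma mean_cos_continuous : continuous mean_cos.
Proof. exact: cont_mean (@continuous_cos R) (@cos_max R) cos_int. Qed.

Lemma mean_sin_continuous : continuous mean_sin.
Proof. exact: cont_mean (@continuous_sin R) (@sin_max R) sin_int. Qed.

(** The trigonometric remainders are at most the cube of the modulus of [t * Z w]. Integrated, they
    give the third absolute moment once for the cosine and once for the sine, whence [K = b + b]. *)
Lemma characteristic_taylor : exists2 K, 0 <= K & forall t,
  nrm2 (mean_cos t - (1 - v ^+ 2 * t ^+ 2 / 2)) (mean_sin t) <= K * `|t| ^+ 3.
Proof.
pose b := (\int[Q]_w (`|Z w| ^+ 3))%R.
have b0 : 0 <= b by apply: Rintegral_ge0 => // w _; rewrite exprn_ge0.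
have int_cst (c : R) : (\int[Q]_w c)%R = c.
  by rewrite /Rintegral integral_cst//= (@probability_setT _ _ _ Q) mule1.
have i1 (c : R) : Q.-integrable setT (EFin \o (fun _ => c)).
  exact: finite_measure_integrable_cst.
have iZM (c : R) (f : T -> R) : Q.-integrable setT (EFin \o f) ->
  Q.-integrable setT (EFin \o (fun w => c * f w)).
  by move=> fi; have := integrableZl measurableT c fi.
have iB (f g : T -> R) : Q.-integrable setT (EFin \o f) -> Q.-integrable setT (EFin \o g) ->
  Q.-integrable setT (EFin \o (fun w => f w - g w)).
  by move=> fi gi; have := integrableB measurableT fi gi.
have bound (f : T -> R) t : Q.-integrable setT (EFin \o f) ->
    (forall w, `|f w| <= `|t * Z w| ^+ 3) -> `|(\int[Q]_w f w)%R| <= b * `|t| ^+ 3.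
  move=> fi fb; apply: (le_trans (le_normr_Rintegral measurableT fi)).
  rewrite mulrC -RintegralZl//; apply: le_Rintegral => //.
  - exact: integrable_norm.
  - exact: iZM.
  - by move=> w _; rewrite -exprMn -normrM.
exists (b + b) => [|t]; first by rewrite addr_ge0.
have hc : `|mean_cos t - (1 - v ^+ 2 * t ^+ 2 / 2)| <= b * `|t| ^+ 3.
  have -> : mean_cos t - (1 - v ^+ 2 * t ^+ 2 / 2) =
      (\int[Q]_w (cos (t * Z w) - (1 - t ^+ 2 / 2 * Z w ^+ 2)))%R.
    rewrite RintegralB//; last by apply: iB => //; exact: iZM.
    rewrite RintegralB//; last exact: iZM.
    rewrite RintegralZl// int_cst varZ; congr (_ - (_ - _)); ring.
  apply: bound.
    by apply: (iB) => //; apply: (iB (fun=> 1)) => //; exact: iZM.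
  move=> w; have := cos_near_quadratic (t * Z w).
  by rewrite exprMn mulrAC.
have hs : `|mean_sin t| <= b * `|t| ^+ 3.
  have -> : mean_sin t = (\int[Q]_w (sin (t * Z w) - t * Z w))%R.
    rewrite RintegralB//; last exact: iZM.
    by rewrite RintegralZl// meanZ mulr0 subr0.
  apply: bound; first by apply: iB => //; exact: iZM.
  by move=> w; exact: (sin_near_id _).1.
have := nrm2D (mean_cos t - (1 - v ^+ 2 * t ^+ 2 / 2)) 0 0 (mean_sin t).
rewrite addr0 add0r => /le_trans; apply; rewrite mulrDl lerD//.
- by rewrite /nrm2 expr0n addr0 sqrtr_sqr.
- by rewrite /nrm2 expr0n add0r sqrtr_sqr.
Qed.

Hypothesis nonlattice : forall z0 h : R, 0 < h ->
  ~ {ae Q, forall w, exists k : int, Z w = z0 + k%:~R * h}.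

(** Were the modulus [r] at least 1, the projection on the direction [(a, b)] of the characteristic
    function would be a variable bounded by 1 with mean [r], hence almost surely 1. The phase
    [t * Z w] would then be constant modulo [2 * pi], and [Z] would live on a translated lattice. *)
Lemma characteristic_modulus t : t != 0 -> nrm2 (mean_cos t) (mean_sin t) < 1.
Proof.
move=> t0; rewrite ltNge; apply/negP => r1.
set r := nrm2 _ _ in r1; have r0 : 0 < r by exact: lt_le_trans r1.
pose a := mean_cos t / r; pose b := mean_sin t / r.
have ab : a ^+ 2 + b ^+ 2 = 1.
  rewrite /a /b !exprMn -mulrDl -sqr_nrm2 -/r -exprMn mulfV ?gt_eqF// expr1n.
  by [].
pose f w := a * cos (t * Z w) + b * sin (t * Z w).
have f1 w : f w <= 1.
  rewrite (le_trans (ler_norm _))// (le_trans (nrm2_cauchy_schwarz _ _ _ _))//.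
  by rewrite /nrm2 ab cos2Dsin2 sqrtr1 mulr1.
have ifc : Q.-integrable setT (EFin \o (fun w => a * cos (t * Z w))).
  exact: (integrableZl measurableT a (cos_int t)).
have ifs : Q.-integrable setT (EFin \o (fun w => b * sin (t * Z w))).
  exact: (integrableZl measurableT b (sin_int t)).
have fi : Q.-integrable setT (EFin \o f) by exact: (integrableD measurableT ifc ifs).
have i1 : Q.-integrable setT (EFin \o (fun _ => 1 : R)).
  exact: finite_measure_integrable_cst.
have gi : Q.-integrable setT (EFin \o (fun w => 1 - f w)).
  exact: (integrableB measurableT i1 fi).
have g0 : (\int[Q]_w (1 - f w))%R <= 0.
  rewrite RintegralB// [X in X - _](_ : _ = 1); last first.
    by rewrite /Rintegral integral_cst//= (@probability_setT _ _ _ Q) mule1.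
  rewrite RintegralD// !RintegralZl// -/(mean_cos t) -/(mean_sin t).
  rewrite (_ : a * mean_cos t + b * mean_sin t = r); first lra.
  have -> : a * mean_cos t + b * mean_sin t = (mean_cos t ^+ 2 + mean_sin t ^+ 2) / r.
    by rewrite /a /b; ring.
  by rewrite -sqr_nrm2 -/r expr2 mulfK ?gt_eqF.
have : ae_eq Q setT (EFin \o (fun w => 1 - f w)) (cst 0%E).
  apply/ae_eq_integral_abs => //; first exact: measurable_int gi.
  transitivity (\int[Q]_w (1 - f w)%:E)%E.
    by apply: eq_integral => w _; rewrite gee0_abs// lee_fin subr_ge0.
  apply/eqP; rewrite eq_le integral_ge0 ?andbT; last by move=> w _; rewrite lee_fin subr_ge0.
  by rewrite -(fineK (integrable_fin_num measurableT gi)) lee_fin.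
move=> fae; have {fae} fae : {ae Q, forall w, f w = 1}.
  by apply: filterS fae => w /(_ I)/= [h]; lra.
(* One sample point where equality holds supplies an angle for [(a, b)], and its value [Z w0] the
   translation of the lattice. *)
have [w0 w0P] : exists w0, f w0 = 1.
  apply: contrapT => /forallNP none.
  have : Q setT = 0%E.
    case: fae => N [mN N0 hN]; apply/eqP; rewrite -measure_le0 -N0 le_measure ?inE//.
    by move=> w _; apply: hN; exact: none.
  by rewrite (@probability_setT _ _ _ Q) => /eqP; rewrite onee_eq0.
pose x0 := t * Z w0.
have [ac bs] : a = cos x0 /\ b = sin x0.
  have := cos2Dsin2 x0; rewrite /f -/x0 in w0P => cs.
  have : (a - cos x0) ^+ 2 + (b - sin x0) ^+ 2 = 0.
    have -> : (a - cos x0) ^+ 2 + (b - sin x0) ^+ 2 = (a ^+ 2 + b ^+ 2) +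
        (cos x0 ^+ 2 + sin x0 ^+ 2) - 2 * (a * cos x0 + b * sin x0) by ring.
    by rewrite ab cs w0P; ring.
  move/eqP; rewrite paddr_eq0 ?sqr_ge0// !sqrf_eq0 !subr_eq0 => /andP[/eqP -> /eqP ->].
  by [].
have h0 : 0 < 2 * pi / `|t| by rewrite divr_gt0 ?normr_gt0// mulr_gt0// pi_gt0.
apply: (@nonlattice (Z w0) _ h0); apply: filterS fae => w fw.
have : cos (t * Z w - x0) = 1 by rewrite cosB -ac -bs mulrC (mulrC (sin _)).
move=> /cos_eq1_int[k kE].
have zE : Z w = Z w0 + k%:~R * (2 * pi) / t.
  by rewrite -kE /x0 -mulrBr mulrC mulKf//; ring.
have [tp|tn|tE] := ltgtP 0 t; last by rewrite -tE eqxx in t0.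
- by exists k; rewrite zE gtr0_norm// -mulrA.
- exists (- k); rewrite zE ltr0_norm// rmorphN/= invrN; ring.
Qed.

End characteristic_function_of_variable.

(** * Exponential moments *)

(** The power is bounded by its own term in the exponential series, which gives the factorial over
    the power of [e] as constant. *)
Lemma power_le_expR (R : realType) (k : nat) (e : R) : 0 < e ->
  exists2 c, 0 <= c & forall x, 0 <= x -> x ^+ k <= c * expR (e * x).
Proof.
move=> e0; case: k => [|k].
  exists 1 => // x x0; rewrite expr0 mul1r -expR0 ler_expR mulr_ge0//.
  exact: ltW.
have f0 : 0 < (k.+1)`!%:R :> R by rewrite ltr0n fact_gt0.
exists ((k.+1)`!%:R / e ^+ k.+1); first by rewrite divr_ge0 ?ler0n// exprn_ge0// ltW.
move=> x x0; have := expR_ge1Dxn k (mulr_ge0 (ltW e0) x0).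
rewrite exprMn => h; rewrite mulrAC ler_pdivlMr ?exprn_gt0//.
rewrite mulrC [leRHS]mulrC -ler_pdivrMr//; lra.
Qed.

Section exponential_moments.
Context d (T : measurableType d) (R : realType) (Q : probability T R).
Variables (L : T -> R) (alpha eps : R).
Hypothesis mL : measurable_fun setT L.
Hypothesis eps0 : 0 < eps.
Hypothesis int_exp : forall t, `|t - alpha| < eps ->
  Q.-integrable setT (EFin \o (fun w => expR (t * L w))).

Let half_lt : eps / 2 < eps.
Proof. by rewrite ltr_pdivrMr// ltr_pMr// ltr1n. Qed.

(** The derivative of order [k] in [t] of [expR (t * L w)]. *)
Definition weighted k t w : R := L w ^+ k * expR (t * L w).

(** For [t] within [eps / 2] of [alpha], a further [eps / 4] absorbs the power of [L]; the total
    [3 / 4 * eps] stays inside the domain. The two exponentials cover the two signs of [L]. *)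
Let envelope w : R := expR ((alpha + 3 / 4 * eps) * L w) + expR ((alpha - 3 / 4 * eps) * L w).

Let envelope_int : Q.-integrable setT (EFin \o envelope).
Proof.
have e34 : 0 < 3 / 4 * eps by rewrite mulr_gt0// divr_gt0.
have e1 : 3 / 4 * eps < eps by rewrite gtr_pMl//; lra.
have i1 : Q.-integrable setT (EFin \o (fun w => expR ((alpha + 3 / 4 * eps) * L w))).
  by apply: int_exp; rewrite addrAC subrr add0r ger0_norm ?(ltW e34).
have i2 : Q.-integrable setT (EFin \o (fun w => expR ((alpha - 3 / 4 * eps) * L w))).
  by apply: int_exp; rewrite addrAC subrr add0r normrN ger0_norm ?(ltW e34).
by have := integrableD measurableT i1 i2.
Qed.

Lemma weighted_dominated k : exists2 c, 0 <= c &
  forall t w, `|t - alpha| <= eps / 2 -> `|weighted k t w| <= c * envelope w.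
Proof.
have e4 : 0 < eps / 4 by rewrite divr_gt0.
have [c c0 cP] := power_le_expR k e4; exists c => // t w ht.
rewrite /weighted normrM normrX (ger0_norm (expR_ge0 _)).
apply: (@le_trans _ _ (c * (expR (eps / 4 * `|L w|) * expR (t * L w)))).
  by rewrite mulrA ler_wpM2r ?expR_ge0// cP.
rewrite ler_wpM2l// -expRD.
have tL : t * L w <= alpha * L w + eps / 2 * `|L w|.
  rewrite -lerBlDl -mulrBl (le_trans (ler_norm _))// normrM ler_wpM2r//.
have [l0|l0] := leP 0 (L w).
- rewrite (ger0_norm l0) in tL *; rewrite /envelope -[leLHS]addr0 lerD ?expR_ge0//.
  by rewrite ler_expR; lra.
- rewrite (ltr0_norm l0) in tL *; rewrite /envelope -[leLHS]add0r lerD ?expR_ge0//.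
  by rewrite ler_expR; lra.
Qed.

Lemma measurable_weighted k t : measurable_fun setT (weighted k t).
Proof.
apply: measurable_funM; first exact: measurable_funX.
by apply: (measurableT_comp (@measurable_expR R)); exact: measurable_funM.
Qed.

Lemma weighted_integrable k t : `|t - alpha| <= eps / 2 ->
  Q.-integrable setT (EFin \o weighted k t).
Proof.
move=> ht; have [c c0 cP] := weighted_dominated k.
apply: (le_integrable _ _ _ (integrableZl measurableT c envelope_int)) => //.
  by apply/measurable_EFinP; exact: measurable_weighted.
move=> w _ /=; rewrite lee_fin (le_trans (cP _ _ ht))// ler_norm//.
Qed.

Definition exp_moment k t : R := (\int[Q]_w weighted k t w)%R.

Let is_derive_weighted k (t : R) w : is_derive t 1 (fun t : R => weighted k t w) (weighted k.+1 t w).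
Proof.
apply: is_derive_eq; rewrite /GRing.scale/= /weighted exprS; ring.
Qed.

Lemma is_derive_exp_moment k (t : R) : `|t - alpha| < eps / 2 ->
  is_derive t 1 (exp_moment k) (exp_moment k.+1 t).
Proof.
move=> ht; have [c c0 cP] := weighted_dominated k.+1.
have tI : `](alpha - eps / 2), (alpha + eps / 2)[%classic t.
  by rewrite /= in_itv/=; move: ht; rewrite ltr_distl.
have sub (x : R) : `](alpha - eps / 2), (alpha + eps / 2)[%classic x -> `|x - alpha| <= eps / 2.
  by rewrite /= in_itv/= -ltr_distl => /ltW.
have intf (x : R) : `](alpha - eps / 2), (alpha + eps / 2)[%classic x ->
    Q.-integrable setT (EFin \o weighted k x) by move=> /sub; exact: weighted_integrable.
have derf (x : R) w : `](alpha - eps / 2), (alpha + eps / 2)[%classic x -> setT w ->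
    derivable (fun x => weighted k x w) x 1.
  by move=> _ _; have [] := is_derive_weighted k x w.
have d1 (x : R) w : partial1of2 (weighted k) x w = weighted k.+1 x w.
  by rewrite partial1of2E (@derive_val _ _ _ _ _ _ _ (is_derive_weighted k x w)).
have G0 w : 0 <= c * envelope w by rewrite mulr_ge0// addr_ge0// expR_ge0.
have iG : Q.-integrable setT (EFin \o (fun w => c * envelope w)).
  exact: (integrableZl measurableT c envelope_int).
have ubG (x : R) w : `](alpha - eps / 2), (alpha + eps / 2)[%classic x -> setT w ->
    `|partial1of2 (weighted k) x w| <= c * envelope w.
  by move=> /sub hx _; rewrite d1; exact: cP.
apply: DeriveDef.
  exact: (derivable_under_integral measurableT tI intf derf G0 iG ubG).
rewrite -derive1E (differentiation_under_integral measurableT tI intf derf G0 iG ubG).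
by apply: eq_Rintegral => w _; exact: d1.
Qed.

Lemma exp_moment0_gt0 t : `|t - alpha| <= eps / 2 -> 0 < exp_moment 0 t.
Proof.
move=> ht; rewrite lt_neqAle Rintegral_ge0 ?andbT; last first.
  by move=> w _; rewrite /weighted expr0 mul1r expR_ge0.
apply/negP => /eqP/esym z0.
have wi := weighted_integrable 0 ht.
have : ae_eq Q setT (EFin \o weighted 0 t) (cst 0%E).
  apply/ae_eq_integral_abs => //; first exact: measurable_int wi.
  transitivity (\int[Q]_w (weighted 0 t w)%:E)%E.
    by apply: eq_integral => w _; rewrite gee0_abs// lee_fin /weighted expr0 mul1r expR_ge0.
  by rewrite -(fineK (integrable_fin_num measurableT wi)) -[fine _]/(exp_moment 0 t) z0.
move=> [N [mN N0 hN]].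
have : Q setT = 0%E.
  apply/eqP; rewrite -measure_le0 -N0 le_measure ?inE// => w _; apply: hN => /(_ I)/= [].
  by rewrite /weighted expr0 mul1r => /eqP; rewrite gt_eqF ?expR_gt0.
by rewrite (@probability_setT _ _ _ Q) => /eqP; rewrite onee_eq0.
Qed.

Variable f : R -> R.
Hypothesis fE : forall t, `|t - alpha| < eps -> f t = ln (exp_moment 0 t).

Lemma is_derive_log_moment (t : R) : `|t - alpha| < eps / 2 ->
  is_derive t 1 f (exp_moment 1 t / exp_moment 0 t).
Proof.
move=> ht; have m0 := exp_moment0_gt0 (ltW ht).
have d0 := is_derive_exp_moment 0 ht.
have dl : is_derive t 1 (fun t => ln (exp_moment 0 t)) (exp_moment 1 t / exp_moment 0 t).
  have dln := is_derive1_ln m0.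
  rewrite mulrC; exact: (is_derive1_comp dln d0).
apply: near_eq_is_derive dl.
have : t \in `](alpha - eps), (alpha + eps)[.
  by rewrite in_itv/= -ltr_distl (lt_trans ht)// half_lt.
move=> /near_in_itvoo; apply: filterS => x; rewrite in_itv/= -ltr_distl => hx.
by rewrite fE.
Qed.

Let near_alpha (P : R -> Prop) : (forall t, `|t - alpha| < eps / 2 -> P t) ->
  \forall t \near alpha, P t.
Proof.
move=> h; have e2 : 0 < eps / 2 by rewrite divr_gt0.
exists (eps / 2) => // t /=; rewrite distrC; exact: h.
Qed.

Lemma derive1_log_moment : derive1 f alpha = exp_moment 1 alpha / exp_moment 0 alpha.
Proof.
have h := @is_derive_log_moment alpha; rewrite derive1E; apply: derive_val.
by apply: h; rewrite subrr normr0 divr_gt0.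
Qed.

(** The right-hand side is the variance of [L] under the tilted law, just as the first derivative is
    its mean. *)
Lemma derive2_log_moment : derive1n 2 f alpha =
  exp_moment 2 alpha / exp_moment 0 alpha - (exp_moment 1 alpha / exp_moment 0 alpha) ^+ 2.
Proof.
have ha : `|alpha - alpha| < eps / 2 by rewrite subrr normr0 divr_gt0.
have m0 := exp_moment0_gt0 (ltW ha).
rewrite /derive1n/= derive1E; apply: derive_val.
apply: (@near_eq_is_derive _ _ _ (fun t => exp_moment 1 t / exp_moment 0 t)).
  apply: near_alpha => t ht; rewrite derive1E; apply/esym/derive_val.
  exact: is_derive_log_moment.
have d0 := is_derive_exp_moment 0 ha; have d1 := is_derive_exp_moment 1 ha.
have dV := is_deriveV (lt0r_neq0 m0) d0.
apply: (@is_derive_eq _ _ _ _ _ _ _ _ (is_deriveM d1 dV)).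
by rewrite /GRing.scale/=; field; rewrite gt_eqF.
Qed.

(** Jensen gives [t * mu <= f t] for [t] near [alpha], so [f alpha] is nonnegative. Were it 0, [mu]
    would be 0 too, [f] would have an interior minimum at [alpha], and its derivative there would
    vanish, against [mu < derive1 f alpha]. *)
Lemma log_moment_gt0 (mu : R) : 0 < alpha -> 0 <= mu -> Q.-integrable setT (EFin \o L) ->
  (\int[Q]_w L w)%R = mu -> mu < derive1 f alpha -> 0 < f alpha.
Proof.
move=> a0 mu0 iL muE muf.
(* Obtained by integrating the tangent line of the exponential at [t * mu]. *)
have jensen t : `|t - alpha| <= eps / 2 -> t * mu <= f t.
  move=> ht; rewrite fE; last by rewrite (le_lt_trans ht)// half_lt.
  rewrite -[leLHS]expRK ler_ln ?posrE ?expR_gt0 ?exp_moment0_gt0//.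
  have i1 : Q.-integrable setT (EFin \o (fun=> 1 - t * mu)).
    exact: finite_measure_integrable_cst.
  have i2 : Q.-integrable setT (EFin \o (fun w => t * L w)).
    exact: (integrableZl measurableT t iL).
  have i3 : Q.-integrable setT (EFin \o (fun w => (1 - t * mu) + t * L w)).
    exact: (integrableD measurableT i1 i2).
  have -> : expR (t * mu) = (\int[Q]_w (expR (t * mu) * ((1 - t * mu) + t * L w)))%R.
    rewrite RintegralZl// RintegralD// RintegralZl// muE.
    rewrite [X in X + _](_ : _ = 1 - t * mu); first by rewrite subrK mulr1.
    by rewrite /Rintegral integral_cst//= (@probability_setT _ _ _ Q) mule1.
  apply: le_Rintegral => //.
  - exact: (integrableZl measurableT (expR (t * mu)) i3).
  - exact: weighted_integrable.
  - move=> w _; rewrite /weighted expr0 mul1r.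
    rewrite -[X in _ <= X](_ : expR (t * mu) * expR (t * L w - t * mu) = _); last first.
      by rewrite -expRD addrC subrK.
    rewrite ler_wpM2l ?expR_ge0//.
    apply: le_trans (expR_ge1Dx _); lra.
have ha : `|alpha - alpha| <= eps / 2 by rewrite subrr normr0 ltW// divr_gt0.
have fa := jensen _ ha.
rewrite lt_neqAle (le_trans (mulr_ge0 (ltW a0) mu0) fa) andbT; apply/negP => /eqP f0.
have muE0 : mu = 0.
  by apply/eqP; rewrite eq_le mu0 andbT -(pmulr_rle0 _ a0) f0.
have e2 : 0 < eps / 2 by rewrite divr_gt0.
have : is_derive alpha 1 f 0.
  apply: (@derive1_at_min _ f (alpha - eps / 2) (alpha + eps / 2)).
  - lra.
  - by move=> t; rewrite in_itv/= -ltr_distl => /is_derive_log_moment[].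
  - by rewrite in_itv/=; lra.
  - move=> t; rewrite in_itv/= -ltr_distl => /ltW/jensen.
    by rewrite -f0 muE0 mulr0.
move=> df; move: muf; rewrite derive1E (@derive_val _ _ _ _ _ _ _ df) muE0 ltxx.
by [].
Qed.

End exponential_moments.

(** * The random walk log Delta_n under the tilted law *)

Lemma expectationE d (T : measurableType d) (R : realType) (P : probability T R) (f : T -> R) :
  ('E_P[f] = \int[P]_w (f w)%:E)%E.
Proof. by rewrite unlock. Qed.

Lemma same_law_integral d d1 (T : measurableType d) (T1 : measurableType d1) (R : realType)
    (P : probability T R) (X Y : T -> T1) (f : T1 -> \bar R) :
  measurable_fun setT X -> measurable_fun setT Y -> same_law P X Y ->
  measurable_fun setT f -> (\int[P]_w f (X w) = \int[P]_w f (Y w))%E.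
Proof.
move=> mX mY XY mf.
have hp := @same_law_ge0_integral _ _ _ _ _ P X Y mX mY XY (f^\+)%E
    (measurable_funepos mf) (funepos_ge0 f).
have hn := @same_law_ge0_integral _ _ _ _ _ P X Y mX mY XY (f^\-)%E
    (measurable_funeneg mf) (funeneg_ge0 f).
transitivity (\int[P]_w (f^\+)%E (X w) - \int[P]_w (f^\-)%E (X w))%E.
  rewrite [LHS]integralE; congr (_ - _)%E;
    by apply: eq_integral => w _; rewrite ?funeposE ?funenegE.
rewrite hp hn [RHS]integralE; congr (_ - _)%E;
  by apply: eq_integral => w _; rewrite ?funeposE ?funenegE.
Qed.

Section tilted_random_walk.
Context d (Omega : measurableType d) de (Env : measurableType de).
Variable S : cbp Omega Env.
Context (R : realType).
Variables (m lambda : R) (P Pa : probability Omega R) (alpha : R).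
Hypothesis law_P : cbp_law S m P.
Hypothesis lambda_gt0 : 0 < lambda.
Hypothesis law_Pa : tilted_law S m lambda P alpha Pa.
Local Notation M := (M S m lambda).
Local Notation Delta := (Delta S m lambda).
Local Notation Lam := (Lambda S m lambda P).
Local Notation tilt := (tilt S m lambda alpha P).

Lemma M_lower n w : m * lambda <= M n w.
Proof.
have ml : 0 < m * lambda by rewrite mulr_gt0// (xi_mean_gt0 law_P).
by rewrite /Defs.M ler_peMr ?(ltW ml)// ler1n ctlA_gt0.
Qed.

Lemma M_gt0 n w : 0 < M n w.
Proof.
by apply: lt_le_trans (M_lower n w); rewrite mulr_gt0// (xi_mean_gt0 law_P).
Qed.

Lemma Delta_gt0 n w : 0 < Delta n w.
Proof. by apply: prodr_gt0 => i _; exact: M_gt0. Qed.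

Lemma DeltaS n w : Delta n.+1 w = Delta n w * M n w.
Proof. by rewrite /Defs.Delta big_ord_recr. Qed.

Lemma M_powRE n t w : M n w `^ t = expR (t * ln (M n w)).
Proof. by rewrite /powR gt_eqF// M_gt0. Qed.

Let mM n : measurable_fun setT (M n).
Proof.
by apply: (measurable_fun_history (S:=S) (b:=false) (J:=set0) (K:=[set n])); exact: measurable_M.
Qed.

Let mDelta n : measurable_fun setT (Delta n).
Proof.
by apply: (measurable_fun_history (S:=S) (b:=false) (J:=set0) (K:=setT)); exact: measurable_Delta_history.
Qed.

Lemma M_same_law n : same_law P (M n) (M 0).
Proof.
move=> U mU; pose f (e : Env) : R := m * lambda * (ctlA (ctl S) e)%:R.
have mf : measurable_fun setT f.
  apply: measurable_funM => //; apply: (measurable_fun_nat_comp (fun k => k%:R : R)).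
  exact: measurable_funP.
have mfU : measurable (f @^-1` U) by rewrite -[X in measurable X]setTI; exact: mf.
exact: (mark_same_law law_P n mfU).
Qed.

Lemma M_indep_Delta n : indep_rv P (Delta n) (M n).
Proof.
apply: (@law_indep_rv _ _ _ _ S R m P law_P false false set0 set0 [set i | (i < n)%N] [set n]).
- by [].
- by rewrite setI0.
- by move=> i /= [] /[swap] ->; rewrite ltnn.
- exact: measurable_Delta_history.
- exact: measurable_M.
Qed.

Lemma tilt0 w : tilt 0 w = 1.
Proof. by rewrite /tilt /Defs.Delta big_ord0 powR1 mul0r oppr0 expR0 mulr1. Qed.

Lemma tiltS n w : tilt n.+1 w = tilt n w * (M n w `^ alpha * expR (- Lam alpha)).
Proof.
rewrite /tilt DeltaS powRM ?ltW ?M_gt0 ?Delta_gt0//.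
rewrite -natr1 mulrDl mul1r opprD expRD; ring.
Qed.

Lemma tilted_M0 (g : R -> \bar R) : measurable_fun setT g -> (forall x, 0 <= g x)%E ->
  (\int[Pa]_w g (M 0 w) = \int[P]_w (g (M 0 w) * (M 0 w `^ alpha * expR (- Lam alpha))%:E))%E.
Proof.
move=> mg g0; transitivity (\int[P]_w (g (M 0 w) * (tilt 1 w)%:E))%E.
  apply: (@tilt_integral _ _ _ _ S R m lambda alpha P Pa law_P law_Pa 1 _ _ (M 0) g) => //.
  exact: measurable_M.
by apply: eq_integral => w _; rewrite tiltS tilt0 mul1r.
Qed.

(** The density factorises along the generations, and [Delta n] and [M n] are independent under [P];
    so the product still splits under the tilted law. Indicators then give independence and the
    common law of the factors. *)
Lemma tilted_split n (f g : R -> \bar R) : measurable_fun setT f -> measurable_fun setT g ->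
  (forall x, 0 <= f x)%E -> (forall x, 0 <= g x)%E ->
  (\int[Pa]_w (f (Delta n w) * g (M n w)) = (\int[Pa]_w f (Delta n w)) * \int[Pa]_w g (M 0 w))%E.
Proof.
move=> mf mg f0 g0; pose L := Lam alpha.
pose F (x : R) := (f x * (x `^ alpha * expR (- (n%:R * L)))%:E)%E.
pose G (y : R) := (g y * (y `^ alpha * expR (- L))%:E)%E.
have mF : measurable_fun setT F.
  by apply: emeasurable_funM => //; apply/measurable_EFinP; apply: measurable_funM.
have mG : measurable_fun setT G.
  by apply: emeasurable_funM => //; apply/measurable_EFinP; apply: measurable_funM.
have F0 x : (0 <= F x)%E by rewrite mule_ge0// lee_fin mulr_ge0 ?powR_ge0 ?expR_ge0.
have G0 x : (0 <= G x)%E by rewrite mule_ge0// lee_fin mulr_ge0 ?powR_ge0 ?expR_ge0.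
have m12 : measurable_fun setT (fun z : R * R => f z.1 * g z.2)%E.
  by apply: emeasurable_funM; [exact: (measurableT_comp mf)|exact: (measurableT_comp mg)].
have mFG : measurable_fun setT (fun z : R * R => F z.1 * G z.2)%E.
  by apply: emeasurable_funM; [exact: (measurableT_comp mF)|exact: (measurableT_comp mG)].
have mDM : measurable_fun (setT : set (history S true setT [set i | (i < n.+1)%N]))
    (fun w => (Delta n w, M n w)).
  apply/measurable_fun_pairP; split.
    by apply: measurable_Delta_history => i /= /ltnW; rewrite ltnS.
  by apply: measurable_M => /=.
transitivity (\int[P]_w (F (Delta n w) * G (M n w)))%E.
  transitivity (\int[P]_w (f (Delta n w) * g (M n w) * (tilt n.+1 w)%:E))%E.
    apply: (@tilt_integral _ _ _ _ S R m lambda alpha P Pa law_P law_Pa n.+1 _ _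
      (fun w => (Delta n w, M n w)) (fun z => f z.1 * g z.2)%E mDM m12) => z.
    by rewrite mule_ge0.
  by apply: eq_integral => w _; rewrite tiltS EFinM muleACA.
transitivity (\int[P]_w \int[P]_w' (F (Delta n w) * G (M n w')))%E.
  apply: (@indep_ge0_fubini _ _ _ _ _ _ R P (Delta n) (M n) (fun z => F z.1 * G z.2)%E
    (mDelta n) (mM n) (@M_indep_Delta n) mFG) => z.
  by rewrite mule_ge0.
have mGM : measurable_fun setT (fun w => G (M n w)) by exact: (measurableT_comp mG).
transitivity (\int[P]_w (F (Delta n w) * \int[P]_w' G (M n w')))%E.
  by apply: eq_integral => w _; rewrite ge0_integralZl.
rewrite ge0_integralZr//; last 2 first.
- exact: (measurableT_comp mF).
- exact: integral_ge0.
congr (_ * _)%E.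
- apply/esym; apply: (@tilt_integral _ _ _ _ S R m lambda alpha P Pa law_P law_Pa n _ _ (Delta n) f) => //.
  exact: measurable_Delta_history.
- transitivity (\int[P]_w G (M 0 w))%E; last exact/esym/tilted_M0.
  exact: (same_law_ge0_integral (mM n) (mM 0) (@M_same_law n) mG G0).
Qed.

Lemma tilted_M_same_law n : same_law Pa (M n) (M 0).
Proof.
move=> U mU.
have m1 : measurable_fun setT (fun x : R => (\1_U x)%:E : \bar R).
  by apply/measurable_EFinP; exact: measurable_indic.
have := @tilted_split n (cst 1%E) (fun x => (\1_U x)%:E) (measurable_cst _) m1 _ _.
rewrite integral_cst//= (@probability_setT _ _ _ Pa) !mul1e.
under eq_integral do rewrite mul1e.
have ind k : (\int[Pa]_w (\1_U (M k w))%:E = Pa (M k @^-1` U))%E.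
  rewrite -(setIT (M k @^-1` U)) -integral_indic//.
  by rewrite -[X in measurable X]setTI; exact: mM.
rewrite !ind; apply => // x; exact: lee01.
Qed.

Lemma tilted_M_indep_Delta n : indep_rv Pa (Delta n) (M n).
Proof.
move=> U V mU mV.
have mI (W : set R) : measurable W -> measurable_fun setT (fun x : R => (\1_W x)%:E : \bar R).
  by move=> mW; apply/measurable_EFinP; exact: measurable_indic.
have I0 (W : set R) x : (0 <= (\1_W x : R)%:E)%E by rewrite lee_fin.
have := @tilted_split n _ _ (mI _ mU) (mI _ mV) (I0 U) (I0 V).
have ind (f : Omega -> R) (W : set R) : measurable_fun setT f -> measurable W ->
    (\int[Pa]_w (\1_W (f w))%:E = Pa (f @^-1` W))%E.
  move=> mf mW; rewrite -(setIT (f @^-1` W)) -integral_indic//.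
  by rewrite -[X in measurable X]setTI; exact: mf.
rewrite !ind// -(tilted_M_same_law n mV) => <-.
rewrite -(setIT (_ `&` _)) -integral_indic//; last first.
  by apply: measurableI; rewrite -[X in measurable X]setTI; [exact: mDelta|exact: mM].
by apply: eq_integral => w _; rewrite indicI -EFinM.
Qed.

Definition centred_log_Delta (rho : R) n w : R := ln (Delta n w) - n%:R * rho.

Lemma measurable_centred_log_Delta rho n : measurable_fun setT (centred_log_Delta rho n).
Proof.
apply: measurable_funB => //; apply: (measurableT_comp (@measurable_ln R)).
exact: mDelta.
Qed.

Lemma centred_log_Delta0 rho w : centred_log_Delta rho 0 w = 0.
Proof. by rewrite /centred_log_Delta /Defs.Delta big_ord0 ln1 mul0r subr0. Qed.

Lemma centred_log_DeltaS rho n w : centred_log_Delta rho n.+1 w =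
  centred_log_Delta rho n w + (ln (M n w) - rho).
Proof.
rewrite /centred_log_Delta DeltaS lnM ?posrE ?Delta_gt0 ?M_gt0// -natr1; ring.
Qed.

(** Under the tilted law each step adds an increment of fixed law, independent of the current
    position; the addition formulas then amount to a multiplication of complex numbers. *)
Lemma walk_powers rho t : planar_powers
  (mean_cos Pa (fun w => ln (M 0 w) - rho) t) (mean_sin Pa (fun w => ln (M 0 w) - rho) t)
  (char_cos Pa (centred_log_Delta rho) ^~ t) (char_sin Pa (centred_log_Delta rho) ^~ t).
Proof.
have mln := @measurable_ln R.
have mcos : measurable_fun setT (@cos R).
  by apply: continuous_measurable_fun; exact: continuous_cos.
have msin : measurable_fun setT (@sin R).
  by apply: continuous_measurable_fun; exact: continuous_sin.
pose u n (x : R) := t * (ln x - n%:R * rho).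
pose z (y : R) := t * (ln y - rho).
have mu n : measurable_fun setT (u n) by apply: measurable_funM => //; exact: measurable_funB.
have mz : measurable_fun setT z by apply: measurable_funM => //; exact: measurable_funB.
split.
- rewrite /char_cos; under eq_Rintegral do rewrite centred_log_Delta0 mulr0 cos0.
  by rewrite /Rintegral integral_cst//= (@probability_setT _ _ _ Pa) mule1.
- rewrite /char_sin; under eq_Rintegral do rewrite centred_log_Delta0 mulr0 sin0.
  by rewrite /Rintegral integral_cst//= mul0e.
move=> n.
have bi (f : R -> R) (x : Omega -> R) : measurable_fun setT f -> (forall y, `|f y| <= 1) ->
    measurable_fun setT x -> Pa.-integrable setT (EFin \o (f \o x)).
  move=> mf f1 mx; apply: (@prob_bounded_integrable _ _ _ _ _ 1) => [|w]; last exact: f1.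
  exact: (measurableT_comp mf).
have ind (f g : R -> R) : measurable_fun setT f -> measurable_fun setT g ->
    (forall y, `|f y| <= 1) -> (forall y, `|g y| <= 1) ->
    Pa.-integrable setT (EFin \o (fun w => f (u n (Delta n w)) * g (z (M n w)))) /\
    (\int[Pa]_w (f (u n (Delta n w)) * g (z (M n w))) =
    (\int[Pa]_w f (t * centred_log_Delta rho n w)) * (\int[Pa]_w g (t * (ln (M 0 w) - rho))))%R.
  move=> mf mg f1 g1.
  have mfu : measurable_fun setT (f \o u n) by exact: measurableT_comp.
  have mgz : measurable_fun setT (g \o z) by exact: measurableT_comp.
  have if1 : Pa.-integrable setT (EFin \o ((f \o u n) \o Delta n)).
    exact: (bi (f \o u n) (Delta n) mfu (fun y => f1 _) (mDelta n)).
  have ig1 : Pa.-integrable setT (EFin \o ((g \o z) \o M n)).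
    exact: (bi (g \o z) (M n) mgz (fun y => g1 _) (mM n)).
  have [i1 i2] := indep_expectationM (mDelta n) (mM n) (@tilted_M_indep_Delta n) mfu mgz if1 ig1.
  split => //; rewrite /Rintegral i2 fineM//.
  + congr (_ * fine _).
    apply: (same_law_integral (mM n) (mM 0) (@tilted_M_same_law n) (f := EFin \o (g \o z))).
    exact/measurable_EFinP.
  + exact: (integrable_fin_num measurableT if1).
  + exact: (integrable_fin_num measurableT ig1).
have [icc ecc] := ind cos cos mcos mcos (@cos_max R) (@cos_max R).
have [iss ess] := ind sin sin msin msin (@sin_max R) (@sin_max R).
have [isc esc] := ind sin cos msin mcos (@sin_max R) (@cos_max R).
have [ics ecs] := ind cos sin mcos msin (@cos_max R) (@sin_max R).
have step w : t * centred_log_Delta rho n.+1 w = u n (Delta n w) + z (M n w).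
  by rewrite centred_log_DeltaS mulrDr.
split.
- rewrite /char_cos; under eq_Rintegral do rewrite step cosD.
  by rewrite RintegralB// ecc ess.
- rewrite /char_sin; under eq_Rintegral do rewrite step sinD.
  by rewrite RintegralD// esc ecs.
Qed.

End tilted_random_walk.

(** * Tail of log Delta_n *)

Section walk_tail.
Context d (Omega : measurableType d) de (Env : measurableType de).
Variable S : cbp Omega Env.
Context (R : realType).
Variables (m lambda : R) (P Pa : probability Omega R) (alpha mu rho v : R).
Hypothesis law_P : cbp_law S m P.
Hypothesis lambda_gt0 : 0 < lambda.
Hypothesis alpha_gt0 : 0 < alpha.
Hypothesis alpha_int : interior (dom_Lambda S m lambda P) alpha.
Hypothesis law_Pa : tilted_law S m lambda P alpha Pa.
Hypothesis logM_nonarith : nonarithmetic_logM S m lambda P.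
Hypothesis logM_int : ('E_P[fun w => `|ln (M S m lambda 0 w)|%R] < +oo)%E.
Hypothesis mu_def : ('E_P[fun w => ln (M S m lambda 0 w)] = mu%:E)%E.
Hypothesis mu_ge0 : 0 <= mu.
Hypothesis rho_def : rho = derive1 (Lambda S m lambda P) alpha.
Hypothesis rho_gt_mu : mu < rho.
Hypothesis v_gt0 : 0 < v.
Hypothesis v_def : v ^+ 2 = derive1n 2 (Lambda S m lambda P) alpha.
Local Notation M := (M S m lambda).
Local Notation Delta := (Delta S m lambda).
Local Notation Lam := (Lambda S m lambda P).

Let L w : R := ln (M 0 w).

Let mM n : measurable_fun setT (M n).
Proof.
by apply: (measurable_fun_history (S:=S) (b:=false) (J:=set0) (K:=[set n])); exact: measurable_M.
Qed.

Let mL : measurable_fun setT L.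
Proof. exact: (measurableT_comp (@measurable_ln R)). Qed.

Let ME n t w : M n w `^ t = expR (t * ln (M n w)).
Proof. exact: (M_powRE law_P lambda_gt0). Qed.

Let domain : exists2 eps, 0 < eps & forall t, `|t - alpha| < eps ->
  P.-integrable setT (EFin \o (fun w => expR (t * L w))).
Proof.
have [eps /= eps0 h] := alpha_int; exists eps => // t ht.
have : dom_Lambda S m lambda P t by apply: h => /=; rewrite distrC.
rewrite /dom_Lambda/= /Lambda_ext expectationE => hl.
apply/integrableP; split.
  apply/measurable_EFinP; apply: (measurableT_comp (@measurable_expR R)).
  exact: measurable_funM.
have -> : (\int[P]_w `|(expR (t * L w))%:E| = \int[P]_w (M 0 w `^ t)%:E)%E.
  by apply: eq_integral => w _; rewrite ME gee0_abs// lee_fin expR_ge0.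
by move: hl; case: (\int[P]_w _)%E => // r; rewrite ltry.
Qed.

Let moment0_gt0 eps t : 0 < eps -> (forall s, `|s - alpha| < eps ->
    P.-integrable setT (EFin \o (fun w => expR (s * L w)))) ->
  `|t - alpha| < eps -> 0 < exp_moment P L 0 t.
Proof.
move=> eps0 hi ht.
(* Positivity is known within half the radius of the centre, so the lemma is applied centred at [t]
   with the radius that remains. *)
have e2 : 0 < eps - `|t - alpha| by rewrite subr_gt0.
apply: (@exp_moment0_gt0 _ _ _ P L t _ mL e2).
- move=> s hs; apply: hi; rewrite -(subrK t s) -addrA (le_lt_trans (ler_normD _ _))//.
  by rewrite -ltrBrDr.
- by rewrite subrr normr0 ltW// divr_gt0.
Qed.

Let LamE eps : 0 < eps -> (forall t, `|t - alpha| < eps ->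
    P.-integrable setT (EFin \o (fun w => expR (t * L w)))) ->
  forall t, `|t - alpha| < eps -> Lam t = ln (exp_moment P L 0 t).
Proof.
move=> eps0 hi t ht; have m0 := moment0_gt0 eps0 hi ht.
rewrite /Lambda /Lambda_ext expectationE.
have -> : (\int[P]_w (M 0 w `^ t)%:E = (exp_moment P L 0 t)%:E)%E.
  rewrite /exp_moment /Rintegral fineK.
    by apply: eq_integral => w _; rewrite ME /weighted expr0 mul1r.
  rewrite (eq_integral (EFin \o (fun w => expR (t * L w)))).
    exact: (integrable_fin_num measurableT (hi t ht)).
  by move=> w _; rewrite /weighted expr0 mul1r.
by rewrite lne_EFin.
Qed.

Let iL : P.-integrable setT (EFin \o L).
Proof.
apply/integrableP; split; first exact/measurable_EFinP.
by move: logM_int; rewrite expectationE.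
Qed.

Let mean_L : (\int[P]_w L w)%R = mu.
Proof. by rewrite /Rintegral -[RHS]/(fine mu%:E) -mu_def expectationE. Qed.

Lemma Lambda_gt0 : 0 < Lam alpha.
Proof.
have [eps eps0 hi] := domain.
apply: (log_moment_gt0 mL eps0 hi (LamE eps0 hi) alpha_gt0 mu_ge0 iL mean_L).
by rewrite -rho_def.
Qed.

(** The change of measure holds for nonnegative integrands; signed functions are reached through
    their positive and negative parts. *)
Lemma tilted_M0_integral (f : R -> R) : measurable_fun setT f ->
  P.-integrable setT (EFin \o (fun w => f (M 0 w) * M 0 w `^ alpha)) ->
  Pa.-integrable setT (EFin \o (f \o M 0)) /\
  (\int[Pa]_w f (M 0 w) = expR (- Lam alpha) * \int[P]_w (f (M 0 w) * M 0 w `^ alpha))%R.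
Proof.
move=> mf fi; pose W w := M 0 w `^ alpha * expR (- Lam alpha).
have W0 w : 0 <= W w by rewrite mulr_ge0 ?powR_ge0 ?expR_ge0.
have fiW : P.-integrable setT (EFin \o (fun w => f (M 0 w) * W w)).
  have := integrableZr measurableT (expR (- Lam alpha)) fi.
  by apply: eq_integrable => // w _ /=; rewrite -EFinM mulrA.
have mfE : measurable_fun setT (EFin \o f) by exact/measurable_EFinP.
pose F w : \bar R := (f (M 0 w) * W w)%:E.
have pos : (\int[Pa]_w (EFin \o f)^\+ (M 0 w) = \int[P]_w F^\+ w)%E.
  rewrite (tilted_M0 law_P lambda_gt0 law_Pa (measurable_funepos mfE) (funepos_ge0 _)).
  apply: eq_integral => w _; rewrite !funeposE [F w]EFinM.
  by rewrite -(mul0e (W w)%:E) -maxeMl ?lee_fin// mul0e.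
have neg : (\int[Pa]_w (EFin \o f)^\- (M 0 w) = \int[P]_w F^\- w)%E.
  rewrite (tilted_M0 law_P lambda_gt0 law_Pa (measurable_funeneg mfE) (funeneg_ge0 _)).
  apply: eq_integral => w _; rewrite !funenegE [F w]EFinM -mulNe.
  by rewrite -(mul0e (W w)%:E) -maxeMl ?lee_fin// mul0e.
have mfM : measurable_fun setT (f \o M 0) by exact: measurableT_comp.
split.
  apply/integrableP; split; first exact/measurable_EFinP.
  have mabs : measurable_fun setT (fun x : R => `|(f x)%:E|)%E by exact: measurableT_comp.
  have /integrableP[_] := fiW.
  rewrite (tilted_M0 law_P lambda_gt0 law_Pa mabs (fun x => abse_ge0 _)).
  under [in X in X -> _]eq_integral do rewrite /= normrM (ger0_norm (W0 _)).
  by [].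
have -> : (\int[Pa]_w f (M 0 w))%R = fine (\int[P]_w (f (M 0 w) * W w)%:E)%E.
  rewrite /Rintegral; congr fine; rewrite [RHS]integralE -pos -neg [LHS]integralE.
  by congr (_ - _)%E; apply: eq_integral => w _; rewrite ?funeposE ?funenegE.
rewrite -RintegralZl//; congr fine; apply: eq_integral => w _; congr EFin.
by rewrite /W; ring.
Qed.

Let moments k : Pa.-integrable setT (EFin \o (fun w => L w ^+ k)) /\
  (\int[Pa]_w (L w ^+ k) = exp_moment P L k alpha / exp_moment P L 0 alpha)%R.
Proof.
have [eps eps0 hi] := domain.
have ha : `|alpha - alpha| < eps by rewrite subrr normr0.
have ha2 : `|alpha - alpha| <= eps / 2 by rewrite subrr normr0 ltW// divr_gt0.
have mf : measurable_fun setT (fun x : R => ln x ^+ k).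
  by apply: measurable_funX; exact: measurable_ln.
have [|i1 e1] := @tilted_M0_integral _ mf.
  have := weighted_integrable mL eps0 hi k ha2; apply: eq_integrable => // w _ /=.
  by rewrite ME.
split; first exact: i1.
rewrite [LHS]e1 (LamE eps0 hi ha) expRN lnK ?posrE ?(moment0_gt0 eps0 hi ha)// mulrC.
by congr (_ / _); apply: eq_Rintegral => w _; rewrite ME.
Qed.

Let mean_La : (\int[Pa]_w L w)%R = rho.
Proof.
have [eps eps0 hi] := domain.
rewrite rho_def (derive1_log_moment mL eps0 hi (LamE eps0 hi)) -(moments 1).2.
by apply: eq_Rintegral => w _; rewrite expr1.
Qed.

Let iLa : Pa.-integrable setT (EFin \o L).
Proof.
by have := (moments 1).1; apply: eq_integrable => // w _ /=; rewrite expr1.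
Qed.

Let sqr_La : (\int[Pa]_w (L w ^+ 2))%R = v ^+ 2 + rho ^+ 2.
Proof.
have [eps eps0 hi] := domain.
rewrite v_def rho_def (derive1_log_moment mL eps0 hi (LamE eps0 hi)).
by rewrite (derive2_log_moment mL eps0 hi (LamE eps0 hi)) subrK (moments 2).2.
Qed.

Let Z w : R := L w - rho.

Let mZ : measurable_fun setT Z. Proof. exact: measurable_funB. Qed.

Let icst (c : R) : Pa.-integrable setT (EFin \o (fun=> c)).
Proof. exact: finite_measure_integrable_cst. Qed.

Let icst_val (c : R) : (\int[Pa]_w c)%R = c.
Proof. by rewrite /Rintegral integral_cst//= (@probability_setT _ _ _ Pa) mule1. Qed.

Let iZ1 : Pa.-integrable setT (EFin \o Z).
Proof. exact: (integrableB measurableT iLa (icst rho)). Qed.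

Let iMl (c : R) f : Pa.-integrable setT (EFin \o f) ->
  Pa.-integrable setT (EFin \o (fun w => c * f w)).
Proof. exact: integrableZl. Qed.

Let iD (f g : Omega -> R) : Pa.-integrable setT (EFin \o f) -> Pa.-integrable setT (EFin \o g) ->
  Pa.-integrable setT (EFin \o (fun w => f w + g w)).
Proof. exact: integrableD. Qed.

Let Z2E w : Z w ^+ 2 = L w ^+ 2 + (- (2 * rho) * L w + rho ^+ 2).
Proof. by rewrite /Z; ring. Qed.

Let iZ2 : Pa.-integrable setT (EFin \o (fun w => Z w ^+ 2)).
Proof.
have : Pa.-integrable setT (EFin \o (fun w => L w ^+ 2 + (- (2 * rho) * L w + rho ^+ 2))).
  by apply: iD; [exact: (moments 2).1|apply: iD => //; exact: iMl].
by apply: eq_integrable => // w _ /=; rewrite Z2E.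
Qed.

Let iZ3 : Pa.-integrable setT (EFin \o (fun w => `|Z w| ^+ 3)).
Proof.
have iabs k : Pa.-integrable setT (EFin \o (fun w => `|L w| ^+ k)).
  have := integrable_norm (moments k).1; apply: eq_integrable => // w _ /=.
  by rewrite normrX.
have i3 : Pa.-integrable setT (EFin \o (fun w => `|L w| ^+ 3 + (3 * `|rho| * `|L w| ^+ 2 +
    (3 * `|rho| ^+ 2 * `|L w| ^+ 1 + `|rho| ^+ 3)))).
  by do ![apply: iD => //]; apply: iMl.
apply: (le_integrable _ _ _ i3) => //.
  by apply/measurable_EFinP; apply: measurable_funX; exact: measurableT_comp.
move=> w _ /=; rewrite lee_fin normrX normr_id.
have -> : `|L w| ^+ 3 + (3 * `|rho| * `|L w| ^+ 2 + (3 * `|rho| ^+ 2 * `|L w| ^+ 1 + `|rho| ^+ 3)) =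
    (`|L w| + `|rho|) ^+ 3 by ring.
rewrite [leRHS]ger0_norm ?exprn_ge0 ?addr_ge0//.
by rewrite lerXn2r ?nnegrE ?addr_ge0// ler_normB.
Qed.

Let meanZ : (\int[Pa]_w Z w)%R = 0.
Proof. by rewrite /Z RintegralB// mean_La icst_val subrr. Qed.

Let varZ : (\int[Pa]_w (Z w ^+ 2))%R = v ^+ 2.
Proof.
under eq_Rintegral do rewrite Z2E.
have i1 := iMl (- (2 * rho)) iLa.
have i2 := iD i1 (icst (rho ^+ 2)).
rewrite RintegralD//; last exact: (moments 2).1.
rewrite RintegralD// RintegralZl// sqr_La mean_La icst_val; ring.
Qed.

(** The laws of [M 0] under [P] and [Pa] have the same null sets, because the density is strictly
    positive; a lattice for one would be a lattice for the other. *)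
Let nonlattice (z0 h : R) : 0 < h -> ~ {ae Pa, forall w, exists k : int, Z w = z0 + k%:~R * h}.
Proof.
move=> h0 hae; apply: logM_nonarith; exists (z0 + rho), h; split => //.
pose A := [set x : R | exists k : int, ln x = z0 + rho + k%:~R * h].
have mA : measurable A.
  pose F (n : nat) := @ln R @^-1` [set z0 + rho + n%:R * h] `|`
    @ln R @^-1` [set z0 + rho - n%:R * h].
  have mS c : measurable (@ln R @^-1` [set c]).
    by rewrite -[X in measurable X]setTI; exact: measurable_ln.
  rewrite (_ : A = \bigcup_n F n); last first.
    apply/seteqP; split=> [x [[n|n] kE]|x [n _ [kE|kE]]].
    - by exists n => //; left.
    - by exists n.+1 => //; right; rewrite /= kE NegzE rmorphN/= mulNr.
    - by exists n%:Z.
    - by exists (- n%:Z); rewrite rmorphN/= mulNr.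
  by apply: bigcupT_measurable => n; apply: measurableU; exact: mS.
have mAC : measurable (~` A) by exact: measurableC.
have mg : measurable_fun setT (fun x : R => (\1_(~` A) x)%:E : \bar R).
  by apply/measurable_EFinP; exact: measurable_indic.
have mpre (B : set R) : measurable B -> measurable (M 0 @^-1` B).
  by move=> mB; rewrite -[X in measurable X]setTI; exact: mM.
have g0 (x : R) : (0 <= (\1_(~` A) x : R)%:E)%E by rewrite lee_fin.
have Pa0 : Pa (M 0 @^-1` (~` A)) = 0%E.
  case: hae => N [mN N0 hN]; apply/eqP; rewrite -measure_le0 -N0 le_measure ?inE//.
    exact: mpre.
  move=> w nA; apply: hN => -[k kE]; apply: nA; exists k.
  by move: kE; rewrite /Z /L; lra.
have P0 : P (M 0 @^-1` (~` A)) = 0%E.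
  have := tilted_M0 law_P lambda_gt0 law_Pa mg g0.
  rewrite (_ : (\int[Pa]_w _)%E = 0%E); last first.
    rewrite -Pa0 -(setIT (M 0 @^-1` _)) -integral_indic//; exact: mpre.
  move=> /esym i0.
  have : ae_eq P setT (fun w => (\1_(~` A) (M 0 w))%:E * (M 0 w `^ alpha * expR (- Lam alpha))%:E)%E (cst 0%E).
    apply/ae_eq_integral_abs => //.
      apply: emeasurable_funM; first exact: (measurableT_comp mg).
      apply/measurable_EFinP; apply: measurable_funM => //.
      exact: (measurableT_comp (measurable_powR alpha)).
    rewrite -[RHS]i0; apply: eq_integral => w _.
    by rewrite gee0_abs// mule_ge0// lee_fin mulr_ge0 ?powR_ge0 ?expR_ge0.
  move=> [N [mN N0 hN]]; apply/eqP; rewrite -measure_le0 -N0 le_measure ?inE//.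
    exact: mpre.
  move=> w nA; apply: hN => /(_ I)/=; rewrite indicE mem_set// mul1e => -[].
  by move/eqP; rewrite gt_eqF// mulr_gt0 ?expR_gt0// powR_gt0// (M_gt0 law_P).
have -> : [set w | exists z : int, ln (M 0 w) = z0 + rho + z%:~R * h] = M 0 @^-1` A by [].
have := probability_setC P (mpre _ mA); rewrite -[~` (_ @^-1` _)]/(M 0 @^-1` (~` A)) P0 => h1.
have := fin_num_measure P _ (mpre _ mA); move: h1; case: (P (M 0 @^-1` A)) => // r.
by move=> /esym /eqP; rewrite -EFinB eqe subr_eq0 => /eqP <-.
Qed.

Local Notation Y := (centred_log_Delta S m lambda rho).
Local Notation kappa := ((v * Num.sqrt (2 * pi))^-1).

Let walk_llt : (exists2 B, 0 <= B &
    forall n b, ((Num.sqrt n%:R)%:E * exp_mean alpha Pa Y n b <= B%:E)%E) /\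
  (forall b, Num.sqrt n%:R * fine (exp_mean alpha Pa Y n b) @[n --> \oo] --> kappa / alpha).
Proof.
have mY n : measurable_fun setT (Y n) by exact: measurable_centred_log_Delta.
have [K K0 taylor] := characteristic_taylor mZ iZ1 iZ2 iZ3 meanZ varZ.
have modulus := characteristic_modulus mZ nonlattice.
have cc := mean_cos_continuous (Q:=Pa) mZ; have cs := mean_sin_continuous (Q:=Pa) mZ.
have pow := walk_powers law_P lambda_gt0 law_Pa rho.
have kappa0 : 0 <= kappa by rewrite invr_ge0 mulr_ge0 ?sqrtr_ge0// ltW.
have bnd := smoothed_bounded mY v_gt0 K0 cc cs taylor modulus pow.
have lim := smoothed_limit mY v_gt0 K0 cc cs taylor modulus pow.
split; first exact: (exp_mean_bounded alpha_gt0 mY bnd).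
move=> b; exact: (exp_mean_limit alpha_gt0 mY kappa0 bnd lim).
Qed.

Let I := alpha * rho - Lam alpha.

(** On the event, the density [tilt], the exponential in [exp_tail] and the prefactor multiply to 1;
    this cancellation is what fixes the value of [I]. *)
Lemma tail_probE n b : (P [set w | rho * n%:R + b < ln (Delta n w)]%R =
  (expR (- (n%:R * I) - alpha * b))%:E * exp_mean alpha Pa Y n b)%E.
Proof.
pose h (x : R) : \bar R := (exp_tail alpha (ln x - n%:R * rho - b))%:E.
have mh : measurable_fun setT h.
  apply/measurable_EFinP; apply: (measurableT_comp (@measurable_exp_tail R alpha)).
  apply: measurable_funB => //; apply: measurable_funB => //; exact: measurable_ln.
have h0 x : (0 <= h x)%E by rewrite lee_fin exp_tail_ge0.
have mD : measurable_fun setT (Delta n).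
  by apply: (measurable_fun_history (S:=S) (b:=false) (J:=set0) (K:=setT)); exact: measurable_Delta_history.
pose A := [set w | rho * n%:R + b < ln (Delta n w)].
have mA : measurable A.
  rewrite (_ : A = (fun w => ln (Delta n w)) @^-1` `](rho * n%:R + b), +oo[%classic); last first.
    by apply/seteqP; split=> w /=; rewrite in_itv/= andbT.
  by rewrite -[X in measurable X]setTI; apply: (measurableT_comp (@measurable_ln R)).
have -> : exp_mean alpha Pa Y n b = (\int[P]_w (h (Delta n w) * (tilt S m lambda alpha P n w)%:E))%E.
  apply: (@tilt_integral _ _ _ _ S R m lambda alpha P Pa law_P law_Pa n _ _ (Delta n) h) => //.
  exact: measurable_Delta_history.
rewrite -ge0_integralZl//; last 2 first.
- apply: emeasurable_funM; first exact: (measurableT_comp mh).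
  by apply/measurable_EFinP; exact: measurable_tilt.
- by move=> w _; rewrite mule_ge0// lee_fin tilt_ge0.
rewrite -(setIT [set w | _]) -integral_indic//.
apply: eq_integral => w _; rewrite /h exp_tailE -!EFinM; congr EFin.
have D0 := Delta_gt0 law_P lambda_gt0 n w.
rewrite /tilt /powR gt_eqF// indicE.
have [wA|wA] := boolP (w \in _).
  rewrite inE/= in wA; rewrite ifT; last by move: wA; lra.
  by rewrite -!expRD (_ : _ + _ = 0) ?expR0//; rewrite /I; ring.
rewrite notin_setE/= in wA; rewrite ifN ?mul0r ?mulr0//.
by apply/negP => h1; apply: wA; lra.
Qed.

Lemma tail_prob_bounded : exists2 B, 0 <= B & forall n b,
  (P [set w | rho * n%:R + b < ln (Delta n w)]%R <=
   (B * expR (- (n%:R * I)) * expR (- (alpha * b)) / Num.sqrt n.+1%:R)%:E)%E.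
Proof.
have [[B B0 BP] _] := walk_llt.
(* For positive [n], replacing [n] by [n.+1] under the root costs at most a factor 2; for [n = 0]
   the bound of [exp_mean] by 1 is used. *)
exists (2 * B + 1) => [|n b]; first lra.
have mY k : measurable_fun setT (Y k) by exact: measurable_centred_log_Delta.
rewrite tail_probE expRD.
have E0 := exp_mean_ge0 alpha Pa Y n b; have E1 := exp_mean_le1 alpha_gt0 Pa mY n b.
have s0 k : 0 < Num.sqrt (k.+1%:R : R) by rewrite sqrtr_gt0 ltr0n.
have main : (exp_mean alpha Pa Y n b <= ((2 * B + 1) / Num.sqrt n.+1%:R)%:E)%E.
  case: n E0 E1 => [|n] E0 E1.
    by rewrite sqrtr1 divr1 (le_trans E1)// lee_fin; lra.
  have := BP n.+1 b; rewrite -lee_pdivlMl// => /le_trans; apply.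
  rewrite lee_fin mulrC ler_pdivlMr// mulrAC ler_pdivrMr//.
  have h : Num.sqrt (n.+2%:R : R) <= 2 * Num.sqrt n.+1%:R.
    rewrite -[X in X * _](ger0_norm (ler0n R 2)) -sqrtr_sqr -sqrtrM ?sqr_ge0// ler_wsqrtr//.
    have : 1 <= n.+1%:R :> R by rewrite ler1n.
    by rewrite -[n.+2%:R]natr1; lra.
  have : B * Num.sqrt n.+2%:R <= B * (2 * Num.sqrt n.+1%:R) by rewrite ler_wpM2l.
  by have := ltW (s0 n); nra.
apply: (@le_trans _ _ ((expR (- (n%:R * I)) * expR (- (alpha * b)))%:E *
  ((2 * B + 1) / Num.sqrt n.+1%:R)%:E)%E).
  by rewrite lee_wpmul2l// lee_fin mulr_ge0 ?expR_ge0.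
by rewrite -EFinM lee_fin le_eqVlt; apply/orP; left; apply/eqP; ring.
Qed.

Lemma tail_prob_limit b :
  Num.sqrt n%:R * expR (n%:R * I) *
    fine (P [set w | rho * n%:R + b < ln (Delta n w)]) @[n --> \oo] -->
  expR (- (alpha * b)) * (kappa / alpha).
Proof.
have [_ lim] := walk_llt.
rewrite (_ : (fun n => _) = fun n => expR (- (alpha * b)) * (Num.sqrt n%:R * fine (exp_mean alpha Pa Y n b))).
  by apply: cvgMr; exact: lim.
have mY n : measurable_fun setT (Y n) by exact: measurable_centred_log_Delta.
apply/funext => n; rewrite tail_probE.
have efin : exp_mean alpha Pa Y n b \is a fin_num.
  rewrite ge0_fin_numE ?(exp_mean_ge0 alpha Pa Y)//.
  by rewrite (le_lt_trans (exp_mean_le1 alpha_gt0 Pa mY n b))// ltry.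
rewrite fineM// expRD /=.
rewrite [LHS](_ : _ = (expR (n%:R * I) * expR (- (n%:R * I))) * expR (- (alpha * b)) *
  (Num.sqrt n%:R * fine (exp_mean alpha Pa Y n b))); last by ring.
by rewrite -expRD subrr expR0 mul1r.
Qed.

End walk_tail.

(** * Moments of X_n / Delta_n under the tilted law *)

Section real_powers.
Context (R : realType).
Implicit Types a b c x y : R.

(** Below the threshold [c] the last term suffices, above it the first. *)
Lemma powR_young a b c x : 0 <= b -> b <= a -> 0 < c -> 0 <= x ->
  x `^ b <= c `^ (b - a) * x `^ a + c `^ b.
Proof.
move=> b0 ba c0 x0; have [xc|cx] := leP x c.
  by rewrite (le_trans (ge0_ler_powR b0 _ _ xc)) ?nnegrE ?(ltW c0)// lerDr mulr_ge0 ?powR_ge0.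
have xp : 0 < x := lt_trans c0 cx.
rewrite -[leLHS]addr0 lerD ?powR_ge0//.
have -> : x `^ b = x `^ (b - a) * x `^ a.
  by rewrite -powRD ?subrK// (gt_eqF xp) implybT.
rewrite ler_wpM2r ?powR_ge0//.
have -> : b - a = - (a - b) by rewrite opprB.
rewrite !powRN lef_pV2 ?posrE ?powR_gt0//.
by rewrite ge0_ler_powR ?nnegrE ?(ltW c0) ?(ltW xp) ?subr_ge0// ltW.
Qed.

(** The sum is at most twice the larger term, an argument that works for exponents on either side of
    1. *)
Lemma powRD_le a x y : 0 < a -> 0 <= x -> 0 <= y ->
  (x + y) `^ a <= 2 `^ a * (x `^ a + y `^ a).
Proof.
move=> a0 x0 y0; wlog xy : x y x0 y0 / x <= y.
  move=> h; have [|/ltW] := leP x y; first exact: h.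
  by rewrite addrC [x `^ a + _]addrC; exact: h.
apply: (@le_trans _ _ ((2 * y) `^ a)).
  by rewrite ge0_ler_powR ?nnegrE ?(ltW a0) ?addr_ge0 ?mulr_ge0//; lra.
by rewrite powRM// ler_wpM2l ?powR_ge0// lerDr powR_ge0.
Qed.

(* Comparing every term with the largest of the ratios [x i / e i]: this holds
   for exponents below and above 1 alike. *)
Lemma sum_le_powR_sum a (x e : nat -> R) n : 0 < a -> (forall i, 0 <= x i) ->
  (forall i, 0 < e i) -> \sum_(i < n) e i <= 1 ->
  (\sum_(i < n) x i) <= (\sum_(i < n) (x i / e i) `^ a) `^ a^-1.
Proof.
move=> a0 x0 e0 e1; set T := \sum_(i < n) _ `^ _.
have T0 : 0 <= T by apply: sumr_ge0 => i _; exact: powR_ge0.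
apply: (@le_trans _ _ (\sum_(i < n) e i * T `^ a^-1)).
  apply: ler_sum => i _; rewrite -ler_pdivrMl// mulrC.
  have h : (x i / e i) `^ a <= T.
    rewrite /T (bigD1 i)//= lerDl sumr_ge0// => j _; exact: powR_ge0.
  have -> : x i / e i = ((x i / e i) `^ a) `^ a^-1.
    by rewrite -powRrM mulfV ?gt_eqF// powRr1// divr_ge0// ltW.
  by apply: ge0_ler_powR; rewrite ?nnegrE ?invr_ge0 ?(ltW a0) ?powR_ge0.
by rewrite -mulr_suml ler_piMl ?powR_ge0.
Qed.

Lemma sum_powR_le a (x e : nat -> R) n : 0 < a -> (forall i, 0 <= x i) ->
  (forall i, 0 < e i) -> \sum_(i < n) e i <= 1 ->
  (\sum_(i < n) x i) `^ a <= \sum_(i < n) (x i / e i) `^ a.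
Proof.
move=> a0 x0 e0 e1; set T := \sum_(i < n) _ `^ _.
have T0 : 0 <= T by apply: sumr_ge0 => i _; exact: powR_ge0.
have := sum_le_powR_sum a0 x0 e0 e1; rewrite -/T => h.
apply: (@le_trans _ _ ((T `^ a^-1) `^ a)).
  by apply: ge0_ler_powR; rewrite ?nnegrE ?(ltW a0) ?powR_ge0 ?sumr_ge0.
by rewrite -powRrM mulVf ?gt_eqF// powRr1.
Qed.

Lemma geometric_sum_le x n : 0 <= x < 1 -> \sum_(i < n) x ^+ i <= (1 - x)^-1.
Proof.
move=> /andP[x0 x1]; have x1' : 0 < 1 - x by rewrite subr_gt0.
rewrite -[leRHS]mul1r ler_pdivlMr// mulrC.
rewrite -opprB mulNr -subrX1 opprB lerBlDr lerDl exprn_ge0//.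
Qed.

End real_powers.

Section tilted_moments.
Context d (Omega : measurableType d) de (Env : measurableType de).
Variable S : cbp Omega Env.
Context (R : realType).
Variables (m lambda : R) (P Pa : probability Omega R) (alpha : R).
Hypothesis law_P : cbp_law S m P.
Hypothesis lambda_gt0 : 0 < lambda.
Hypothesis law_Pa : tilted_law S m lambda P alpha Pa.
Local Notation M := (M S m lambda).
Local Notation Delta := (Delta S m lambda).
Local Notation Lam := (Lambda S m lambda P alpha).
Local Notation X := (X S).
Local Notation noise := (noise S m lambda).
Local Notation tilt := (tilt S m lambda alpha P).

Definition normalized j w : R := (X j w)%:R / Delta j w.

Definition increment j w : R := `|noise j (X j w) w| / Delta j.+1 w.

Let D0 := Delta_gt0 law_P lambda_gt0.
Let M0 := M_gt0 law_P lambda_gt0.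

Lemma normalized_ge0 j w : 0 <= normalized j w.
Proof. by rewrite divr_ge0// ltW. Qed.

Lemma increment_ge0 j w : 0 <= increment j w.
Proof. by rewrite divr_ge0// ltW. Qed.

Lemma normalizedS j w :
  normalized j.+1 w = normalized j w + noise j (X j w) w / Delta j.+1 w.
Proof.
rewrite /normalized /noise DeltaS/=; have dn := D0 j w; have mn := M0 j w.
by field; rewrite !gt_eqF.
Qed.

Lemma normalized_increment j w :
  `|normalized j.+1 w - normalized j w| = increment j w.
Proof.
by rewrite normalizedS addrAC subrr add0r normrM (ger0_norm (_ : 0 <= (Delta j.+1 w)^-1))// invr_ge0 ltW.
Qed.

Lemma normalized_dist k i w :
  `|normalized (k + i) w - normalized k w| <= \sum_(l < i) increment (k + l) w.
Proof.
elim: i => [|i IH]; first by rewrite addn0 subrr normr0 big_ord0.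
rewrite big_ord_recr/= addnS -normalized_increment.
have -> : normalized (k + i).+1 w - normalized k w =
  (normalized (k + i) w - normalized k w) + (normalized (k + i).+1 w - normalized (k + i) w) by ring.
by rewrite (le_trans (ler_normD _ _))// lerD2r.
Qed.

Lemma past_known k j : (k <= j)%N -> <<s past S k >> `<=` <<s known S j >>.
Proof.
move=> kj; apply: sub_sigma_algebra2; apply: history_rect_sub => // i /=.
by move/leq_trans; exact.
Qed.

Lemma past_subset k j : (k <= j)%N -> <<s past S k >> `<=` <<s past S j >>.
Proof.
move=> kj; apply: sub_sigma_algebra2; apply: history_rect_sub => // [[a b]/=|i /=];
  by move/leq_trans; exact.
Qed.

Lemma tilted_integral_on (G : set Omega) n (f : Omega -> R) : <<s known S n >> G ->
  measurable_fun (setT : set (history S true setT [set i | (i < n)%N])) f ->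
  (forall w, 0 <= f w) ->
  (\int[Pa]_(w in G) (f w)%:E = \int[P]_(w in G) (f w * tilt n w)%:E)%E.
Proof.
move=> hG mf f0; pose Z w := \1_G w * f w.
have mZ : measurable_fun (setT : set (history S true setT [set i | (i < n)%N])) Z.
  by apply: measurable_funM => //; exact: (@measurable_indic _ (history S _ _ _)).
transitivity (\int[Pa]_w `|(Z w)%:E|)%E.
  rewrite [LHS]integral_mkcond; apply: eq_integral => w _; rewrite patchE /Z indicE.
  by case: (w \in G); rewrite ?mul1r ?mul0r ?abse0// gee0_abs// lee_fin.
transitivity (\int[P]_w (`|(Z w)%:E| * (tilt n w)%:E))%E.
  apply: (@tilt_integral _ _ _ _ S R m lambda alpha P Pa law_P law_Pa n _ _ Z
    (fun x => `|x%:E|)%E mZ) => //.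
  exact: measurableT_comp.
rewrite [RHS]integral_mkcond; apply: eq_integral => w _; rewrite patchE /Z indicE.
case: (w \in G); rewrite ?mul1r ?mul0r ?abse0 ?mul0e// gee0_abs// lee_fin.
by [].
Qed.

Lemma measurable_normalized j n : (j <= n)%N ->
  measurable_fun (setT : set (history S true setT [set i | (i < n)%N])) (normalized j).
Proof.
move=> jn.
have mX : measurable_fun (setT : set (history S true setT [set i | (i < n)%N])) (X j).
  by apply: measurable_X_history => // i ij; exact: leq_trans ij jn.
apply: measurable_funM.
  exact: (@measurable_fun_nat_comp _ _ (history S _ _ _) _ (fun k => k%:R : R) _ mX).
rewrite (_ : (fun w => _) = (fun x : R => x `^ (-1)) \o Delta j); last first.
  by apply/funext => w /=; rewrite powR_inv1// ltW.
apply: measurableT_comp; first exact: measurable_powR.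
by apply: measurable_Delta_history => i ij; exact: leq_trans ij jn.
Qed.

Lemma measurable_noise_X j n : (j < n)%N ->
  measurable_fun (setT : set (history S true setT [set i | (i < n)%N]))
    (fun w => noise j (X j w) w).
Proof.
move=> jn; apply: (@measurable_fun_select _ _ (history S _ _ _)).
  by apply: measurable_X_history => // i ij; exact: ltn_trans ij jn.
by move=> k; exact: measurable_noise.
Qed.

Lemma measurable_increment j n : (j < n)%N ->
  measurable_fun (setT : set (history S true setT [set i | (i < n)%N])) (increment j).
Proof.
move=> jn; apply: measurable_funM.
  by apply: measurableT_comp => //; exact: measurable_noise_X.
rewrite (_ : (fun w => _) = (fun x : R => x `^ (-1)) \o Delta j.+1); last first.
  by apply/funext => w /=; rewrite powR_inv1// ltW.
apply: measurableT_comp; first exact: measurable_powR.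
by apply: measurable_Delta_history => i ij; exact: leq_trans ij jn.
Qed.

Let mpowR : measurable_fun setT (fun x : R => x `^ alpha).
Proof. exact: measurable_powR. Qed.

(** The density contains the alpha-th power of [Delta j], which cancels the denominator of
    [normalized]. The event [G] may belong to an earlier time, since the density on [j] marks also
    describes events of the first [k]. *)
Lemma normalized_moment k j (G : set Omega) : (k <= j)%N -> <<s past S k >> G ->
  (\int[Pa]_(w in G) (normalized j w `^ alpha)%:E =
   (expR (- (j%:R * Lam)))%:E * \int[P]_(w in G) ((X j w)%:R `^ alpha)%:E)%E.
Proof.
move=> kj hG; have hGn := past_known kj hG; have mG := past_measurable hG.
rewrite (tilted_integral_on hGn); last 2 first.
- apply: (@measurableT_comp _ _ _ _ _ _ (fun x : R => x `^ alpha)) => //.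
  exact: measurable_normalized.
- by move=> w; exact: powR_ge0.
rewrite -ge0_integralZl//; last first.
  apply: measurable_funTS; apply/measurable_EFinP; apply: (measurableT_comp mpowR).
  exact: (measurable_fun_nat_comp (fun k => k%:R : R) (measurable_X S j)).
apply: eq_integral => w _; rewrite -EFinM; congr EFin.
rewrite /tilt mulrA mulrC; congr (_ * _).
by rewrite -powRM ?normalized_ge0 ?(ltW (D0 _ _))// /normalized divfK// gt_eqF.
Qed.

(** The noise of generation [j] involves the mark [j], hence the density on [j.+1] marks, matching
    the denominator [Delta j.+1]. *)
Lemma increment_moment k j (G : set Omega) : (k <= j)%N -> <<s past S k >> G ->
  (\int[Pa]_(w in G) (increment j w `^ alpha)%:E =
   (expR (- (j.+1%:R * Lam)))%:E *
     \int[P]_(w in G) (`|noise j (X j w) w| `^ alpha)%:E)%E.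
Proof.
move=> kj hG; have hGn := past_known (leqW kj) hG; have mG := past_measurable hG.
rewrite (tilted_integral_on hGn); last 2 first.
- apply: (@measurableT_comp _ _ _ _ _ _ (fun x : R => x `^ alpha)) => //.
  exact: measurable_increment.
- by move=> w; exact: powR_ge0.
rewrite -ge0_integralZl//; last first.
  apply: measurable_funTS; apply/measurable_EFinP; apply: (measurableT_comp mpowR).
  apply: measurableT_comp => //.
  exact: (measurable_fun_history (measurable_noise_X (ltnSn j))).
apply: eq_integral => w _; rewrite -EFinM; congr EFin.
rewrite /tilt mulrA mulrC; congr (_ * _).
by rewrite -powRM ?increment_ge0 ?(ltW (D0 _ _))// /increment divfK// gt_eqF.
Qed.

End tilted_moments.

(** * Moment estimates with geometric decay *)

Section moment_bounds.
Context d (Omega : measurableType d) de (Env : measurableType de).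
Variable S : cbp Omega Env.
Context (R : realType).
Variables (m lambda : R) (P Pa : probability Omega R) (alpha : R).
Hypothesis law_P : cbp_law S m P.
Hypothesis lambda_gt0 : 0 < lambda.
Hypothesis law_Pa : tilted_law S m lambda P alpha Pa.
Hypothesis alpha_gt0 : 0 < alpha.
Local Notation Lam := (Lambda S m lambda P alpha).
Hypothesis Lam_gt0 : 0 < Lam.
Variables (C beta : R).
Hypothesis beta_ge0 : 0 <= beta.
Hypothesis beta_lt : beta < alpha.
Hypothesis D_moment : forall k : nat,
  ('E_P[fun w => (`|D S m lambda k w| `^ alpha)%R] <= (C * (1 + k%:R `^ beta))%R%:E)%E.
Local Notation Delta := (Delta S m lambda).
Local Notation X := (X S).
Local Notation noise := (noise S m lambda).
Local Notation V := (normalized S m lambda).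
Local Notation incr := (increment S m lambda).

Lemma D_moment_const_ge0 : 0 <= C.
Proof.
have := D_moment 0; rewrite expectationE => h.
have : (0 <= (C * (1 + 0%:R `^ beta))%:E)%E.
  by apply: le_trans h; apply: integral_ge0 => w _; rewrite lee_fin powR_ge0.
by rewrite lee_fin pmulr_lge0// ltr_pwDl ?powR_ge0.
Qed.

Let C0 := D_moment_const_ge0.

Let mpowR a : measurable_fun setT (fun x : R => x `^ a).
Proof. exact: measurable_powR. Qed.

Let mXpow j a : measurable_fun setT (fun w => (X j w)%:R `^ a : R).
Proof.
apply: (measurableT_comp (mpowR a)).
exact: (measurable_fun_nat_comp (fun k => k%:R : R) (measurable_X S j)).
Qed.

Lemma noise_moment k j (G : set Omega) : (k <= j)%N -> <<s past S k >> G ->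
  (\int[P]_(w in G) (`|noise j (X j w) w| `^ alpha)%:E <=
   \int[P]_(w in G) (C * (1 + (X j w)%:R `^ beta))%:E)%E.
Proof.
move=> kj hk; have hG := past_subset kj hk; have mG := past_measurable hG.
have mh : measurable_fun setT (fun x : R => (`|x| `^ alpha)%:E).
  by apply/measurable_EFinP; apply: (measurableT_comp (mpowR alpha)).
have h0 (x : R) : (0 <= (`|x| `^ alpha)%:E)%E by rewrite lee_fin powR_ge0.
have f0 w : (0 <= (C * (1 + (X j w)%:R `^ beta))%:E)%E.
  by rewrite lee_fin mulr_ge0// addr_ge0// powR_ge0.
have mf : measurable_fun setT (fun w => (C * (1 + (X j w)%:R `^ beta))%:E).
  apply/measurable_EFinP; apply: measurable_funM => //; apply: measurable_funD => //.
rewrite (noise_ge0_integral_past lambda law_P hG mh h0).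
rewrite (ge0_integral_nat_fibers P mG (measurable_X S j) mf f0).
apply: lee_nneseries => [k' _|k' _].
  by rewrite mule_ge0// integral_ge0.
have mGk : measurable (G `&` X j @^-1` [set k']).
  by apply: measurableI => //; rewrite -[X in measurable X]setTI; exact: measurable_X.
rewrite [leRHS](_ : _ = (\int[P]_(w in G `&` X j @^-1` [set k']) (C * (1 + k'%:R `^ beta))%:E)%E); last first.
  by apply: eq_integral => w /set_mem[_ /= ->].
rewrite integral_cst// muleC lee_wpmul2r//.
by have := D_moment k'; rewrite expectationE.
Qed.

(** When the moment of order [alpha] grows at rate [Lam], that of order [beta] grows at most at rate
    [Lam * beta / alpha], so the tilted increments decay at rate [Lam * (1 - beta / alpha)]. A
    quarter of it is the unit: one unit pays for the weights, one for the quotient of square roots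
    in the tail estimate, and at least two are left for summation. *)
Definition decay : R := expR (- (Lam * (1 - beta / alpha) / 4)).

Let u := decay.

Let theta_lt1 : beta / alpha < 1.
Proof. by rewrite ltr_pdivrMr// mul1r. Qed.

Lemma decay_gt0 : 0 < decay. Proof. exact: expR_gt0. Qed.

Lemma decay_lt1 : decay < 1.
Proof.
rewrite /decay -[X in _ < X]expR0 ltr_expR oppr_lt0 divr_gt0// mulr_gt0// subr_gt0.
exact: theta_lt1.
Qed.

Lemma decay_pow i : decay ^+ (4 * i) = expR (- (i%:R * Lam * (1 - beta / alpha))).
Proof.
rewrite /decay -expRM_natl natrM; congr expR.
by have := alpha_gt0; move=> ?; field; rewrite gt_eqF.
Qed.

Lemma exp_le_decay i : expR (- (i%:R * Lam)) <= decay ^+ (4 * i).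
Proof.
rewrite decay_pow ler_expR lerN2 ler_piMr ?mulr_ge0 ?(ltW Lam_gt0)//.
by rewrite lerBlDr lerDl divr_ge0// ltW.
Qed.

(** Young's inequality at the threshold [c0 * expR (i%:R * Lam / alpha)]. Its growth in [i] produces
    the decay in front of the alpha-th power, and [c0] is chosen so that its power [beta - alpha]
    equals [e]. *)
Lemma young_decay (e : R) : 0 < e -> exists2 c, 0 <= c & forall i x, 0 <= x ->
  x `^ beta <= e * decay ^+ (4 * i) * x `^ alpha + c * (expR (i%:R * Lam) * decay ^+ (4 * i)).
Proof.
move=> e0; have ba : beta - alpha != 0 by rewrite subr_eq0 lt_eqF.
have aN0 : alpha != 0 by rewrite gt_eqF.
pose c0 := e `^ (beta - alpha)^-1; have c00 : 0 < c0 by exact: powR_gt0.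
exists (c0 `^ beta) => [|i x x0]; first exact: powR_ge0.
pose c := c0 * expR (i%:R * Lam / alpha).
have := powR_young beta_ge0 (ltW beta_lt) (_ : 0 < c) x0.
rewrite mulr_gt0 ?expR_gt0// => /(_ isT).
rewrite /c !powRM ?expR_ge0 ?(ltW c00)// -!expRM -/c.
have -> : c0 `^ (beta - alpha) = e.
  by rewrite /c0 -powRrM mulVf// powRr1// ltW.
rewrite !decay_pow -expRD.
rewrite (_ : i%:R * Lam / alpha * (beta - alpha) = - (i%:R * Lam * (1 - beta / alpha))); last first.
  by field.
rewrite (_ : i%:R * Lam / alpha * beta = i%:R * Lam + - (i%:R * Lam * (1 - beta / alpha)))//.
by field.
Qed.

(** The coefficient [e] of the moment of [V] is at will, so that the inequality can later be closed
    on itself; the event [G] makes it usable on a part of the space chosen at time [k]. *)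
Lemma increment_young (e : R) : 0 < e -> exists2 c, 0 <= c &
  forall k i (G : set Omega), <<s past S k >> G ->
  (\int[Pa]_(w in G) (incr (k + i) w `^ alpha)%:E <=
   (C * decay ^+ (4 * i))%:E * ((1 + c)%:E * ((expR (- (k%:R * Lam)))%:E * P G) +
     e%:E * \int[Pa]_(w in G) (V (k + i) w `^ alpha)%:E))%E.
Proof.
move=> e0; have [c c0 young] := young_decay e0; exists c => // k i G hG.
have ki : (k <= k + i)%N by exact: leq_addr.
have mG := past_measurable hG.
rewrite (increment_moment law_P lambda_gt0 law_Pa ki hG) (normalized_moment law_P lambda_gt0 law_Pa ki hG).
set E := (\int[P]_(w in G) ((X (k + i) w)%:R `^ alpha)%:E)%E.
have E0 : (0 <= E)%E by apply: integral_ge0 => w _; rewrite lee_fin powR_ge0.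
set r := decay ^+ (4 * i); have r0 : 0 <= r by rewrite exprn_ge0// ltW// decay_gt0.
pose a := C * (1 + c * (expR (i%:R * Lam) * r)); pose b := C * (e * r).
have a0 : 0 <= a by rewrite mulr_ge0// addr_ge0// mulr_ge0// mulr_ge0// expR_ge0.
have b0 : 0 <= b by rewrite mulr_ge0// mulr_ge0// ltW.
have step : (\int[P]_(w in G) (`|noise (k + i) (X (k + i) w) w| `^ alpha)%:E <= a%:E * P G + b%:E * E)%E.
  apply: (le_trans (noise_moment ki hG)).
  apply: (@le_trans _ _ (\int[P]_(w in G) (a%:E + b%:E * ((X (k + i) w)%:R `^ alpha)%:E))%E).
    apply: ge0_le_integral => //.
    - by move=> w _; rewrite lee_fin mulr_ge0// addr_ge0// powR_ge0.
    - apply: measurable_funTS; apply/measurable_EFinP; apply: measurable_funM => //.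
      exact: measurable_funD.
    - apply: measurable_funTS; apply: emeasurable_funD => //.
      by apply: emeasurable_funM => //; exact/measurable_EFinP.
    - move=> w _; rewrite -EFinM -EFinD lee_fin /a /b.
      have := young i _ (ler0n R (X (k + i) w)).
      by move=> h; have := ler_wpM2l C0 h; rewrite -/r; lra.
  rewrite ge0_integralD//; last 2 first.
  - by move=> w _; rewrite -EFinM lee_fin mulr_ge0 ?powR_ge0.
  - apply: measurable_funTS; apply: emeasurable_funM => //; exact/measurable_EFinP.
  rewrite integral_cst// ge0_integralZl//.
  by apply: measurable_funTS; exact/measurable_EFinP.
apply: (@le_trans _ _ ((expR (- ((k + i)%:R * Lam)))%:E * (a%:E * P G + b%:E * E))%E).
  apply: lee_pmul; [by rewrite lee_fin expR_ge0| | |exact: step].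
    by apply: integral_ge0 => w _; rewrite lee_fin powR_ge0.
  by rewrite lee_fin ler_expR lerN2 ler_wpM2r ?(ltW Lam_gt0)// ler_nat.
have PG0 : (0 <= P G)%E by [].
have PGf : P G \is a fin_num by exact: fin_num_measure.
rewrite -(fineK PGf) ge0_muleDr ?mule_ge0// ?lee_fin ?fine_ge0//.
rewrite -EFinM [leRHS]ge0_muleDr; last 2 first.
- by rewrite -!EFinM lee_fin !mulr_ge0 ?addr_ge0 ?expR_ge0 ?fine_ge0.
- by rewrite !mule_ge0 ?lee_fin ?expR_ge0// ltW.
set p := fine (P G); have p0 : 0 <= p by exact: fine_ge0.
have eki : expR (- ((k + i)%:R * Lam)) = expR (- (k%:R * Lam)) * expR (- (i%:R * Lam)).
  by rewrite -expRD natrD; congr expR; ring.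
apply: leeD.
- rewrite -!EFinM lee_fin eki /a.
  have h := exp_le_decay i; rewrite -/r in h.
  have ee : expR (- (i%:R * Lam)) * expR (i%:R * Lam) = 1 by rewrite -expRD addNr expR0.
  have -> : expR (- (k%:R * Lam)) * expR (- (i%:R * Lam)) * (C * (1 + c * (expR (i%:R * Lam) * r)) * p) =
    expR (- (k%:R * Lam)) * p * C * (expR (- (i%:R * Lam)) + c * r * (expR (- (i%:R * Lam)) * expR (i%:R * Lam))).
    by ring.
  rewrite ee mulr1.
  have -> : C * r * ((1 + c) * (expR (- (k%:R * Lam)) * p)) =
    expR (- (k%:R * Lam)) * p * C * (r + c * r) by ring.
  by rewrite ler_wpM2l ?mulr_ge0 ?expR_ge0// lerD2r.
- rewrite !muleA -!EFinM lee_wpmul2r// lee_fin /b le_eqVlt; apply/orP; left; apply/eqP; ring.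
Qed.

(** The base whose alpha-th power is [decay]: dividing by [weight i] inside an alpha-th power costs
    [decay ^- i] and a constant. *)
Definition ratio : R := decay `^ alpha^-1.

Lemma ratio_gt0 : 0 < ratio. Proof. exact: powR_gt0 decay_gt0. Qed.

Lemma ratio_lt1 : ratio < 1.
Proof.
have one : 1 `^ alpha^-1 = 1 :> R by rewrite powR1.
rewrite /ratio -[X in _ < X]one; apply: gt0_ltr_powR; rewrite ?invr_gt0 ?nnegrE ?ltW ?decay_gt0//.
exact: decay_lt1.
Qed.

Definition weight i : R := (1 - ratio) * ratio ^+ i.

Lemma weight_gt0 i : 0 < weight i.
Proof. by rewrite mulr_gt0 ?exprn_gt0 ?ratio_gt0// subr_gt0 ratio_lt1. Qed.

Lemma sum_weight n : \sum_(i < n) weight i <= 1.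
Proof.
rewrite /weight -mulr_sumr.
have r1 : 0 < 1 - ratio by rewrite subr_gt0 ratio_lt1.
rewrite mulrC -ler_pdivlMr// div1r geometric_sum_le//.
by rewrite (ltW ratio_gt0) ratio_lt1.
Qed.

Definition weight_const : R := (1 - ratio) `^ (- alpha).

Lemma weight_const_gt0 : 0 < weight_const.
Proof. by rewrite powR_gt0// subr_gt0 ratio_lt1. Qed.

Lemma weight_pow i x : 0 <= x -> (x / weight i) `^ alpha = weight_const * decay ^- i * x `^ alpha.
Proof.
move=> x0; have r0 := ratio_gt0; have r1 : 0 < 1 - ratio by rewrite subr_gt0 ratio_lt1.
rewrite powRM ?invr_ge0 ?(ltW (weight_gt0 i))// mulrC; congr (_ * _).
rewrite -powR_inv1 ?(ltW (weight_gt0 i))// -powRrM mulN1r /weight powRM ?(ltW r1)// ?exprn_ge0 ?(ltW r0)//.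
congr (_ * _); rewrite powRN; congr (_^-1).
have ra : ratio `^ alpha = decay.
  by rewrite /ratio -powRrM mulVf ?gt_eqF// powRr1// ltW// decay_gt0.
rewrite -powR_mulrn ?(ltW r0)// powRAC ra.
by rewrite powR_mulrn// ltW// decay_gt0.
Qed.

(** The two times may come in either order: a later value is bounded by an earlier one to control
    moments, and an earlier by a later one to show that the limit does not vanish. *)
Lemma normalized_pow_le j j' k i w : `|V j w - V j' w| <= \sum_(l < i) incr (k + l) w ->
  V j w `^ alpha <=
  2 `^ alpha * (V j' w `^ alpha + \sum_(l < i) weight_const * decay ^- l * incr (k + l) w `^ alpha).
Proof.
move=> h.
have V0 n : 0 <= V n w by exact: (normalized_ge0 law_P lambda_gt0).
have i0 n : 0 <= incr n w by exact: (increment_ge0 law_P lambda_gt0).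
have s0 : 0 <= \sum_(l < i) incr (k + l) w by exact: sumr_ge0.
apply: (@le_trans _ _ ((V j' w + \sum_(l < i) incr (k + l) w) `^ alpha)).
  apply: ge0_ler_powR; rewrite ?nnegrE ?(ltW alpha_gt0) ?addr_ge0//.
  by rewrite -lerBlDl (le_trans (ler_norm _)).
rewrite (le_trans (powRD_le _ _ _))// ler_wpM2l ?powR_ge0// lerD2l.
rewrite (le_trans (sum_powR_le alpha_gt0 (fun l => i0 (k + l)%N) weight_gt0 (sum_weight i)))//.
by apply: ler_sum => l _; rewrite weight_pow.
Qed.

Let mV j : measurable_fun setT (fun w => V j w `^ alpha).
Proof.
apply: (measurableT_comp (mpowR alpha)).
exact: (measurable_fun_history (measurable_normalized law_P lambda_gt0 (leqnn j))).
Qed.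

Let mincr j : measurable_fun setT (fun w => incr j w `^ alpha).
Proof.
apply: (measurableT_comp (mpowR alpha)).
exact: (measurable_fun_history (measurable_increment law_P lambda_gt0 (ltnSn j))).
Qed.

Lemma normalized_integral_le j j' k i (G : set Omega) : measurable G ->
  (forall w, `|V j w - V j' w| <= \sum_(l < i) incr (k + l) w) ->
  (\int[Pa]_(w in G) (V j w `^ alpha)%:E <=
   (2 `^ alpha)%:E * (\int[Pa]_(w in G) (V j' w `^ alpha)%:E +
     \sum_(l < i) (weight_const * decay ^- l)%:E * \int[Pa]_(w in G) (incr (k + l) w `^ alpha)%:E))%E.
Proof.
move=> mG hV; have wl l : 0 <= weight_const * decay ^- l.
  by rewrite mulr_ge0 ?invr_ge0 ?exprn_ge0 ?ltW ?weight_const_gt0 ?decay_gt0.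
apply: (@le_trans _ _ (\int[Pa]_(w in G) ((2 `^ alpha)%:E * ((V j' w `^ alpha)%:E +
    \sum_(l < i) (weight_const * decay ^- l)%:E * (incr (k + l) w `^ alpha)%:E)))%E).
  apply: ge0_le_integral => //.
  - by move=> w _; rewrite lee_fin powR_ge0.
  - by apply: measurable_funTS; apply/measurable_EFinP; exact: mV.
  - apply: measurable_funTS; apply: emeasurable_funM => //; apply: emeasurable_funD.
      exact/measurable_EFinP.
    apply: emeasurable_sum => l; apply: emeasurable_funM => //; exact/measurable_EFinP.
  - move=> w _; under eq_bigr do rewrite -EFinM.
    by rewrite sumEFin -EFinD -EFinM lee_fin normalized_pow_le.
rewrite ge0_integralZl//; last 2 first.
- apply: measurable_funTS; apply: emeasurable_funD; first exact/measurable_EFinP.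
  apply: emeasurable_sum => l; apply: emeasurable_funM => //; exact/measurable_EFinP.
- move=> w _; rewrite adde_ge0 ?lee_fin ?powR_ge0//; apply: sume_ge0 => l _.
  by rewrite mule_ge0 ?lee_fin ?powR_ge0.
rewrite lee_wpmul2l ?lee_fin ?powR_ge0// ge0_integralD//; last 4 first.
- by move=> w _; rewrite lee_fin powR_ge0.
- by apply: measurable_funTS; exact/measurable_EFinP.
- by move=> w _; apply: sume_ge0 => l _; rewrite mule_ge0 ?lee_fin ?powR_ge0.
- apply: measurable_funTS; apply: emeasurable_sum => l; apply: emeasurable_funM => //; exact/measurable_EFinP.
rewrite leeD2l// ge0_integral_sum//; last 2 first.
- move=> l; apply: measurable_funTS; apply: emeasurable_funM => //; exact/measurable_EFinP.
- by move=> l w _; rewrite mule_ge0 ?lee_fin ?powR_ge0.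
apply: lee_sum => l _; rewrite ge0_integralZl//.
- by apply: measurable_funTS; exact/measurable_EFinP.
- by move=> w _; rewrite lee_fin powR_ge0.
- by rewrite lee_fin.
Qed.

Definition total_weight : R := weight_const * C / (1 - decay ^+ 3).

Lemma total_weight_ge0 : 0 <= total_weight.
Proof.
rewrite divr_ge0 ?mulr_ge0 ?(ltW weight_const_gt0)// subr_ge0 exprn_ile1 ?(ltW decay_gt0)//.
exact: ltW decay_lt1.
Qed.

Lemma weighted_sum_le i (T : R) : 0 <= T ->
  \sum_(l < i) weight_const * decay ^- l * (C * decay ^+ (4 * l) * T) <= total_weight * T.
Proof.
move=> T0; have u0 := decay_gt0.
have -> : \sum_(l < i) weight_const * decay ^- l * (C * decay ^+ (4 * l) * T) =
    weight_const * C * T * \sum_(l < i) (decay ^+ 3) ^+ l.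
  rewrite mulr_sumr; apply: eq_bigr => l _.
  rewrite -exprM; have -> : (4 * l = l + 3 * l)%N by rewrite mulSn.
  by rewrite exprD; field; rewrite expf_neq0 ?gt_eqF.
rewrite /total_weight -[leRHS]mulrA [_ ^-1 * T]mulrC mulrA ler_wpM2l ?mulr_ge0 ?(ltW weight_const_gt0)//.
apply: geometric_sum_le; rewrite exprn_ge0 ?(ltW u0)//=.
by rewrite exprn_ilt1 ?(ltW u0) ?decay_lt1.
Qed.

(** Strong induction on [i]: the increments are bounded by earlier values of the same moment. The
    choice of [e] makes the total coefficient of these values at most one half, so the bound
    [L * (h + q)] reproduces itself. *)
Lemma normalized_bounded : exists2 L, 0 <= L &
  forall k (G : set Omega) (q h : R), <<s past S k >> G -> 0 <= q -> 0 <= h ->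
  ((expR (- (k%:R * Lam)))%:E * P G <= q%:E)%E ->
  (\int[Pa]_(w in G) (V k w `^ alpha)%:E <= h%:E)%E ->
  forall i, (\int[Pa]_(w in G) (V (k + i) w `^ alpha)%:E <= (L * (h + q))%:E)%E.
Proof.
set A := 2 `^ alpha * total_weight.
have A0 : 0 <= A by rewrite mulr_ge0 ?powR_ge0 ?total_weight_ge0.
pose e : R := (2 * A + 1)^-1; have A1 : 0 < 2 * A + 1 by lra.
have e0 : 0 < e by rewrite invr_gt0.
have Ae : A * e <= 2^-1.
  by rewrite ler_pdivrMr//; lra.
have [c c0 young] := increment_young e0.
have p0 : 0 <= 2 `^ alpha :> R by exact: powR_ge0.
exists (2 * (2 `^ alpha + A * (1 + c))) => [|k G q h hG q0 h0 hq hh].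
  by rewrite mulr_ge0// addr_ge0// mulr_ge0// addr_ge0.
have mG := past_measurable hG.
set L := 2 * _ * _; have L0 : 0 <= L.
  rewrite /L mulr_ge0 ?(addr_ge0 h0 q0)// mulr_ge0// addr_ge0// mulr_ge0//; lra.
elim/ltn_ind => i IH; apply: (le_trans (normalized_integral_le mG (normalized_dist law_P lambda_gt0 k i))).
pose T := (1 + c) * q + e * L; have T0 : 0 <= T.
  exact: addr_ge0 (mulr_ge0 (addr_ge0 ler01 c0) q0) (mulr_ge0 (ltW e0) L0).
apply: (@le_trans _ _ (2 `^ alpha * (h + total_weight * T))%:E).
  rewrite EFinM lee_wpmul2l ?lee_fin// EFinD leeD//.
  apply: (@le_trans _ _ (\sum_(l < i) weight_const * decay ^- l * (C * decay ^+ (4 * l) * T))%:E).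
    rewrite -sumEFin; apply: lee_sum => l _; rewrite [leRHS]EFinM lee_wpmul2l//.
      by rewrite lee_fin mulr_ge0 ?invr_ge0 ?exprn_ge0 ?ltW ?weight_const_gt0 ?decay_gt0.
    apply: (le_trans (young k l G hG)); rewrite [leRHS]EFinM lee_wpmul2l//.
      by rewrite lee_fin mulr_ge0 ?exprn_ge0 ?(ltW decay_gt0).
    rewrite [leRHS]EFinD [((1 + c) * q)%:E]EFinM [(e * L)%:E]EFinM.
    apply: leeD; rewrite lee_wpmul2l ?lee_fin ?addr_ge0 ?(ltW e0)//.
    exact: IH.
  by rewrite lee_fin weighted_sum_le.
rewrite lee_fin /T.
have -> : 2 `^ alpha * (h + total_weight * ((1 + c) * q + e * L)) =
  2 `^ alpha * h + A * (1 + c) * q + A * e * L by rewrite /A; ring.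
have h1 : A * e * L <= 2^-1 * L by rewrite ler_wpM2r.
have h2 : 0 <= 2 `^ alpha * q by rewrite mulr_ge0.
have h3 : 0 <= A * (1 + c) * h by exact: mulr_ge0 (mulr_ge0 A0 (addr_ge0 ler01 c0)) h0.
have h4 : 2^-1 * L = (2 `^ alpha + A * (1 + c)) * (h + q) by rewrite /L; field.
have h5 : L = 2^-1 * L + 2^-1 * L by field.
lra.
Qed.

(* The bound is in terms of [q] up to an arbitrarily small multiple of [h]: this
   is what yields a nonzero limit when [q] is small compared with [h]. *)
Lemma increment_bounded (e : R) : 0 < e -> exists2 c, 0 <= c &
  forall k (G : set Omega) (q h : R), <<s past S k >> G -> 0 <= q -> 0 <= h ->
  ((expR (- (k%:R * Lam)))%:E * P G <= q%:E)%E ->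
  (\int[Pa]_(w in G) (V k w `^ alpha)%:E <= h%:E)%E ->
  forall i, (\int[Pa]_(w in G) (incr (k + i) w `^ alpha)%:E <=
    (C * decay ^+ (4 * i) * (c * q + e * h))%:E)%E.
Proof.
move=> e0; have [L L0 LP] := normalized_bounded.
have L1 : 0 < L + 1 by rewrite ltr_wpDl.
have eL : 0 < e / (L + 1) by rewrite divr_gt0.
have [c c0 young] := increment_young eL.
exists (1 + c + e) => [|k G q h hG q0 h0 hq hh i]; first by rewrite !addr_ge0// ltW.
apply: (le_trans (young k i G hG)); rewrite [leRHS]EFinM lee_wpmul2l//.
  by rewrite lee_fin mulr_ge0 ?exprn_ge0 ?(ltW decay_gt0) ?D_moment_const_ge0.
apply: (@le_trans _ _ ((1 + c) * q + e / (L + 1) * (L * (h + q)))%:E).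
  rewrite [leRHS]EFinD [((1 + c) * q)%:E]EFinM [(e / (L + 1) * _)%:E]EFinM.
  apply: leeD; rewrite lee_wpmul2l ?lee_fin ?addr_ge0 ?(ltW eL)//.
  exact: LP.
rewrite lee_fin.
have : e / (L + 1) * (L * (h + q)) <= e * (h + q).
  have -> : e / (L + 1) * (L * (h + q)) = L / (L + 1) * (e * (h + q)) by ring.
  by rewrite ler_piMl ?mulr_ge0 ?addr_ge0 ?(ltW e0)// ler_pdivrMr// mul1r lerDl.
lra.
Qed.

End moment_bounds.

(** * Convergence of X_n / Delta_n *)

(** Away from 0 the power is differentiable; at 0 the tolerance is raised to the inverse power. *)
Lemma cvg_powR (R : realType) (a : R) (u : nat -> R) (l : R) : 0 < a -> (forall n, 0 <= u n) ->
  u n @[n --> \oo] --> l -> u n `^ a @[n --> \oo] --> l `^ a.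
Proof.
move=> a0 u0 ul; have l0 : 0 <= l.
  by rewrite -(cvg_lim _ ul)//; apply: limr_ge; [apply/cvg_ex; exists l|exact: nearW].
have [lE|lN0] := eqVneq l 0; last first.
  have lp : 0 < l by rewrite lt_neqAle eq_sym lN0.
  have : {for l, continuous (fun x : R => x `^ a)}.
    exact: is_derive_continuous (is_derive1_powR a lp).
  by apply: cvg_comp.
rewrite lE powR0 ?gt_eqF//; rewrite lE in ul.
apply/cvgrPdist_lt => e e0; have e1 : 0 < e `^ a^-1 by exact: powR_gt0.
move/cvgrPdist_lt : ul => /(_ _ e1); apply: filterS => n.
rewrite !sub0r !normrN (ger0_norm (u0 n)) (ger0_norm (powR_ge0 _ _)) => h.
have -> : e = (e `^ a^-1) `^ a by rewrite -powRrM mulVf ?gt_eqF// powRr1// ltW.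
by apply: gt0_ltr_powR => //; rewrite nnegrE// ltW.
Qed.

Section increments.
Context d (T : measurableType d) (R : realType) (Q : probability T R).
Variables (V a : nat -> T -> R) (e : nat -> R) (alpha B : R).
Hypothesis alpha0 : 0 < alpha.
Hypotheses (V0 : forall n w, 0 <= V n w) (a0 : forall n w, 0 <= a n w).
Hypotheses (mV : forall n, measurable_fun setT (V n)) (ma : forall n, measurable_fun setT (a n)).
Hypothesis Va : forall n w, `|V n.+1 w - V n w| <= a n w.
Hypotheses (e0 : forall i, 0 < e i) (e1 : forall n, \sum_(i < n) e i <= 1).
Hypothesis int_V0 : (\int[Q]_w (V 0 w `^ alpha)%:E < +oo)%E.
Hypothesis int_a : forall n,
  (\sum_(i < n) \int[Q]_w ((a i w / e i) `^ alpha)%:E <= B%:E)%E.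

Let mpowR : measurable_fun setT (fun x : R => x `^ alpha).
Proof. exact: measurable_powR. Qed.

Let ma' i : measurable_fun setT (fun w => ((a i w / e i) `^ alpha)%:E).
Proof.
by apply/measurable_EFinP; apply: (measurableT_comp mpowR); exact: measurable_funM.
Qed.

(** Its expectation is at most [B], so it is finite almost surely. It dominates every partial
    weighted sum and thus gives both the convergence of the paths and the integrable envelope
    [g]. *)
Let Z w : \bar R := (\sum_(0 <= i <oo) ((a i w / e i) `^ alpha)%:E)%E.

Let mZ : measurable_fun setT Z.
Proof.
apply: ge0_emeasurable_sum => // i w _ _; by rewrite lee_fin powR_ge0.
Qed.

Let Z0 w : (0 <= Z w)%E.
Proof. by apply: nneseries_ge0 => i _ _; rewrite lee_fin powR_ge0. Qed.

Let iZ : Q.-integrable setT Z.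
Proof.
apply/integrableP; split => //; under eq_integral do rewrite gee0_abs//.
rewrite integral_nneseries//; last by move=> i w _; rewrite lee_fin powR_ge0.
apply: (@le_lt_trans _ _ B%:E); last exact: ltry.
apply: lime_le.
  by apply: is_cvg_nneseries => i _ _; apply: integral_ge0 => w _; rewrite lee_fin powR_ge0.
by apply: nearW => n; rewrite big_mkord.
Qed.

Let g w : \bar R := ((2 `^ alpha)%:E * ((V 0 w `^ alpha)%:E + Z w))%E.

Let g_int : Q.-integrable setT g.
Proof.
apply: integrableZl => //; apply: integrableD => //; apply/integrableP; split.
  by apply/measurable_EFinP; exact: (measurableT_comp mpowR).
by under eq_integral do rewrite gee0_abs ?lee_fin ?powR_ge0//.
Qed.

Let dist k i w : `|V (k + i) w - V k w| <= \sum_(l < i) a (k + l) w.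
Proof.
elim: i => [|i IH]; first by rewrite addn0 subrr normr0 big_ord0.
rewrite big_ord_recr/= addnS.
have -> : V (k + i).+1 w - V k w = (V (k + i) w - V k w) + (V (k + i).+1 w - V (k + i) w) by ring.
by rewrite (le_trans (ler_normD _ _))// lerD.
Qed.

Let partial_le n w : ((\sum_(i < n) (a i w / e i) `^ alpha)%:E <= Z w)%E.
Proof.
rewrite -sumEFin -(big_mkord xpredT (fun i => ((a i w / e i) `^ alpha)%:E)).
by apply: nneseries_lim_ge => i _; rewrite lee_fin powR_ge0.
Qed.

Let V_le_g n w : ((V n w `^ alpha)%:E <= g w)%E.
Proof.
apply: (@le_trans _ _ (2 `^ alpha * (V 0 w `^ alpha + \sum_(i < n) (a i w / e i) `^ alpha))%:E).
  have s0 : 0 <= \sum_(l < n) a (0 + l) w by exact: sumr_ge0.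
  rewrite lee_fin; apply: (@le_trans _ _ ((V 0 w + \sum_(l < n) a (0 + l) w) `^ alpha)).
    apply: ge0_ler_powR; rewrite ?nnegrE ?(ltW alpha0) ?addr_ge0//.
    by rewrite -lerBlDl (le_trans (ler_norm _))// (dist 0 n).
  rewrite (le_trans (powRD_le alpha0 (V0 0 w) s0))// ler_wpM2l ?powR_ge0// lerD2l.
  exact: (sum_powR_le alpha0 (fun i => a0 i w) e0 (e1 n)).
by rewrite EFinM /g lee_wpmul2l ?lee_fin ?powR_ge0// EFinD leeD2l.
Qed.

Let V_cvg w : Z w \is a fin_num -> cvgn (V ^~ w).
Proof.
move=> Zf; have zE : Z w = (fine (Z w))%:E by rewrite fineK.
have cs : cvgn (series (a ^~ w)).
  apply: nondecreasing_is_cvgn.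
    apply/nondecreasing_seqP => n; rewrite /series/= big_nat_recr//= lerDl//.
  exists (fine (Z w) `^ alpha^-1) => _ [n _ <-]; rewrite /series/= big_mkord.
  apply: (le_trans (sum_le_powR_sum alpha0 (fun i => a0 i w) e0 (e1 n))).
  apply: ge0_ler_powR; rewrite ?nnegrE ?invr_ge0 ?(ltW alpha0) ?fine_ge0//.
    by apply: sumr_ge0 => i _; exact: powR_ge0.
  by rewrite -lee_fin -zE.
have : cvgn (series (fun n => V n.+1 w - V n w)).
  apply: normed_cvg; apply: (series_le_cvg _ _ _ cs) => n; [exact: normr_ge0|exact: a0|exact: Va].
move=> cd; rewrite (_ : V ^~ w = (fun n => V 0 w + series (fun n => V n.+1 w - V n w) n)).
  exact: is_cvgD (is_cvg_cst _) cd.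
by apply/funext => n; rewrite /series/= telescope_sumr// addrC subrK.
Qed.

Lemma increments_limit : exists W : T -> R, [/\ measurable_fun setT W, (forall w, 0 <= W w),
  {ae Q, forall w, V n w @[n --> \oo] --> W w},
  (forall n, (\int[Q]_w (V n w `^ alpha)%:E < +oo)%E) /\
  (\int[Q]_w (`|V n w - W w| `^ alpha)%:E)%E @[n --> \oo] --> 0%E &
  (\int[Q]_w (W w `^ alpha)%:E < +oo)%E /\
  (\int[Q]_w (V n w `^ alpha)%:E)%E @[n --> \oo] --> (\int[Q]_w (W w `^ alpha)%:E)%E].
Proof.
(* Off the event of convergence the limit must still be measurable and nonnegative: the upper limit
   ensures the first, the absolute value the second. *)
pose W w : R := `|fine (limn_esup (fun n => (V n w)%:E))|.
have mW : measurable_fun setT W.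
  apply: measurableT_comp => //; apply: (@measurableT_comp _ _ _ _ _ _ (@fine R)) => //.
  by apply: measurable_fun_limn_esup => n; exact/measurable_EFinP.
have Zfin : {ae Q, forall w, Z w \is a fin_num}.
  by apply: filterS (integrable_ae measurableT iZ) => w /(_ I).
have WE w : Z w \is a fin_num -> V n w @[n --> \oo] --> W w.
  move=> /V_cvg cV; have cE : (V n w)%:E @[n --> \oo] --> (limn (V ^~ w))%:E.
    by apply: cvg_EFin => //; exact: nearW.
  rewrite /W is_cvg_limn_esupE; last by apply/cvg_ex; eexists; exact: cE.
  rewrite (cvg_lim _ cE)//= ger0_norm//; apply: limr_ge => //; exact: nearW.
have mVp n : measurable_fun setT (fun w => (V n w `^ alpha)%:E).
  by apply/measurable_EFinP; exact: (measurableT_comp mpowR).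
have mWp : measurable_fun setT (fun w => (W w `^ alpha)%:E).
  by apply/measurable_EFinP; exact: (measurableT_comp mpowR).
have WpE : {ae Q, forall w, setT w -> (V n w `^ alpha)%:E @[n --> \oo] --> (W w `^ alpha)%:E}.
  apply: filterS Zfin => w Zw _; apply: cvg_EFin; first exact: nearW.
  by apply: cvg_powR => //; exact: WE.
have dom : {ae Q, forall w n, setT w -> (`|(V n w `^ alpha)%:E| <= g w)%E}.
  by apply: aeW => w n _; rewrite gee0_abs ?lee_fin ?powR_ge0.
have [iWp _ lim] := dominated_convergence measurableT mVp mWp WpE g_int dom.
have g0 w : (0 <= g w)%E.
  by rewrite mule_ge0 ?lee_fin ?powR_ge0// adde_ge0// lee_fin powR_ge0.
have mg := measurable_int _ g_int.
have gfin : (\int[Q]_w g w < +oo)%E.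
  by have /integrableP[_] := g_int; under eq_integral do rewrite gee0_abs//.
exists W; split; [exact: mW|by move=> w; exact: normr_ge0|exact: filterS Zfin|split|split; last exact: lim].
- move=> n; apply: le_lt_trans gfin; apply: ge0_le_integral => //.
  by move=> w _; rewrite lee_fin powR_ge0.
- have h0 : {ae Q, forall w, setT w -> (`|V n w - W w| `^ alpha)%:E @[n --> \oo] --> cst 0%E w}.
    apply: filterS Zfin => w Zw _; apply: cvg_EFin; first exact: nearW.
    rewrite -(@powR0 _ alpha) ?gt_eqF//; apply: cvg_powR => //.
    have dW : V n w - W w @[n --> \oo] --> (0 : R).
      by rewrite -(subrr (W w)); apply: cvgB; [exact: WE|exact: cvg_cst].
    move/cvgrPdist_lt : dW => h; apply/cvgrPdist_lt => r r0.
    by apply: filterS (h _ r0) => n; rewrite !sub0r !normrN normr_id.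
  have mVW n : measurable_fun setT (fun w => (`|V n w - W w| `^ alpha)%:E).
    apply/measurable_EFinP; apply: (measurableT_comp mpowR).
    by apply: measurableT_comp => //; exact: measurable_funB.
  (* [V n] and its limit both have alpha-th power at most [g], whence two copies of [g] after
     bounding the power of a sum. *)
  have domh : {ae Q, forall w n, setT w ->
      (`|(`|V n w - W w| `^ alpha)%:E| <= (2 `^ alpha * 2)%:E * g w)%E}.
    apply: filterS Zfin => w Zw n _.
    have gE : g w = (fine (g w))%:E.
      rewrite fineK// /g -(fineK Zw) -EFinD -EFinM//.
    have Vg k : V k w `^ alpha <= fine (g w) by rewrite -lee_fin -gE.
    have Wg : W w `^ alpha <= fine (g w).
      have cW := cvg_powR alpha0 (V0 ^~ w) (WE w Zw).
      by rewrite -(cvg_lim _ cW)//; apply: limr_le; [apply/cvg_ex; eexists; exact: cW|exact: nearW].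
    have W0 : 0 <= W w by exact: normr_ge0.
    rewrite gee0_abs ?lee_fin ?powR_ge0// gE -EFinM lee_fin.
    apply: (@le_trans _ _ ((V n w + W w) `^ alpha)).
      apply: ge0_ler_powR; rewrite ?nnegrE ?(ltW alpha0) ?addr_ge0//.
      by rewrite (le_trans (ler_normB _ _))// !ger0_norm.
    rewrite (le_trans (powRD_le alpha0 (V0 n w) W0))// -mulrA ler_wpM2l ?powR_ge0//.
    by have := Vg n; lra.
  have G_int : Q.-integrable setT (fun w => (2 `^ alpha * 2)%:E * g w)%E.
    exact: integrableZl.
  have [_ _] := dominated_convergence measurableT mVW (measurable_cst _) h0 G_int domh.
  by rewrite integral_cst//= mul0e.
- have /integrableP[_] := iWp.
  by under eq_integral do rewrite gee0_abs ?lee_fin ?powR_ge0//.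
Qed.

End increments.

(** * Limit of X_n / Delta_n and its positivity *)

Section process_limit.
Context d (Omega : measurableType d) de (Env : measurableType de).
Variable S : cbp Omega Env.
Context (R : realType).
Variables (m lambda : R) (P Pa : probability Omega R) (alpha : R).
Hypothesis law_P : cbp_law S m P.
Hypothesis lambda_gt0 : 0 < lambda.
Hypothesis law_Pa : tilted_law S m lambda P alpha Pa.
Hypothesis alpha_gt0 : 0 < alpha.
Local Notation Lam := (Lambda S m lambda P alpha).
Hypothesis Lam_gt0 : 0 < Lam.
Variables (C beta : R).
Hypothesis beta_ge0 : 0 <= beta.
Hypothesis beta_lt : beta < alpha.
Hypothesis D_moment : forall k : nat,
  ('E_P[fun w => (`|D S m lambda k w| `^ alpha)%R] <= (C * (1 + k%:R `^ beta))%R%:E)%E.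
Hypothesis X0_moment : ('E_P[fun w => ((X0 S w)%:R `^ alpha)%R] < +oo)%E.
Hypothesis reach : forall K : nat, (1 <= K)%N ->
  (0 < P [set w | (tau S R K w < +oo)%E])%E.
Local Notation Delta := (Delta S m lambda).
Local Notation X := (X S).
Local Notation V := (normalized S m lambda).
Local Notation incr := (increment S m lambda).
Local Notation u := (decay S m lambda P alpha beta).
Local Notation wc := (weight_const S m lambda P alpha beta).
Local Notation W := (weight S m lambda P alpha beta).
Local Notation tw := (total_weight S m lambda P alpha C beta).

Let C0 : 0 <= C. Proof. exact: D_moment_const_ge0 D_moment. Qed.
Let u0 : 0 < u. Proof. exact: decay_gt0. Qed.
Let V0 n w : 0 <= V n w. Proof. exact: (normalized_ge0 law_P lambda_gt0). Qed.
Let i0 n w : 0 <= incr n w. Proof. exact: (increment_ge0 law_P lambda_gt0). Qed.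

Let mpowR : measurable_fun setT (fun x : R => x `^ alpha).
Proof. exact: measurable_powR. Qed.

Lemma measurable_normalizedT j : measurable_fun setT (V j).
Proof. exact: (measurable_fun_history (measurable_normalized law_P lambda_gt0 (leqnn j))). Qed.

Lemma measurable_incrementT j : measurable_fun setT (incr j).
Proof. exact: (measurable_fun_history (measurable_increment law_P lambda_gt0 (ltnSn j))). Qed.

Lemma pastT k : <<s past S k >> setT.
Proof. by apply: sub_sigma_algebra; exact: history_rectT. Qed.

Lemma initial_moment : (\int[Pa]_w (V 0 w `^ alpha)%:E < +oo)%E.
Proof.
rewrite (normalized_moment law_P lambda_gt0 law_Pa (leqnn 0) (@pastT 0)).
by rewrite mul0r oppr0 expR0 mul1e; move: X0_moment; rewrite expectationE.
Qed.

(** The localised bound with the whole space as event at time 0, where [q = 1]. *)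
Lemma increments_moment : exists2 c, 0 <= c &
  forall j, (\int[Pa]_w (incr j w `^ alpha)%:E <= (c * u ^+ (4 * j))%:E)%E.
Proof.
have [c c0 cP] := increment_bounded law_P lambda_gt0 law_Pa alpha_gt0 Lam_gt0 beta_ge0 beta_lt D_moment ltr01.
pose h := fine (\int[Pa]_w (V 0 w `^ alpha)%:E)%E.
have h0 : 0 <= h by apply: fine_ge0; apply: integral_ge0 => w _; rewrite lee_fin powR_ge0.
exists (C * (c * 1 + 1 * h)) => [|j]; first by rewrite mulr_ge0// addr_ge0// mulr_ge0.
have := cP 0%N setT 1 h (@pastT 0) ler01 h0 _ _ j.
rewrite add0n mul0r oppr0 expR0 mul1e (@probability_setT _ _ _ P) => /(_ (lexx _)).
rewrite /h fineK; last first.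
  rewrite ge0_fin_numE ?initial_moment//.
  by apply: integral_ge0 => w _; rewrite lee_fin powR_ge0.
by move=> /(_ (lexx _)) /le_trans; apply; rewrite lee_fin le_eqVlt; apply/orP; left; apply/eqP; ring.
Qed.

Lemma process_limit : exists L : Omega -> R, [/\ measurable_fun setT L, (forall w, 0 <= L w),
  {ae Pa, forall w, V n w @[n --> \oo] --> L w},
  (forall n, (\int[Pa]_w (V n w `^ alpha)%:E < +oo)%E) /\
  (\int[Pa]_w (`|V n w - L w| `^ alpha)%:E)%E @[n --> \oo] --> 0%E &
  (\int[Pa]_w (L w `^ alpha)%:E < +oo)%E /\
  (\int[Pa]_w (V n w `^ alpha)%:E)%E @[n --> \oo] --> (\int[Pa]_w (L w `^ alpha)%:E)%E].
Proof.
have [c c0 cP] := increments_moment.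
pose B := c * wc / (1 - u ^+ 3).
apply: (@increments_limit _ _ _ Pa V incr W alpha B alpha_gt0 V0 i0).
- exact: measurable_normalizedT.
- exact: measurable_incrementT.
- by move=> n w; rewrite (normalized_increment law_P lambda_gt0).
- by move=> i; exact: (weight_gt0 alpha_gt0 Lam_gt0 beta_lt).
- by move=> n; exact: (sum_weight alpha_gt0 Lam_gt0 beta_lt).
- exact: initial_moment.
move=> n.
have wl l : 0 <= wc * u ^- l.
  by rewrite mulr_ge0 ?invr_ge0 ?exprn_ge0 ?(ltW u0)// ltW// (weight_const_gt0 alpha_gt0 Lam_gt0 beta_lt).
apply: (@le_trans _ _ (\sum_(i < n) (wc * u ^- i * (c * u ^+ (4 * i)))%:E)%E).
  apply: lee_sum => i _.
  rewrite (eq_integral (fun w => (wc * u ^- i)%:E * (incr i w `^ alpha)%:E)%E); last first.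
    by move=> w _; rewrite (weight_pow alpha_gt0 Lam_gt0 beta_lt)// EFinM.
  rewrite ge0_integralZl//; last 3 first.
  - by apply/measurable_EFinP; apply: (measurableT_comp mpowR); exact: measurable_incrementT.
  - by move=> w _; rewrite lee_fin powR_ge0.
  - by rewrite lee_fin.
  by rewrite [leRHS]EFinM lee_wpmul2l ?lee_fin// cP.
rewrite sumEFin lee_fin /B.
have -> : \sum_(i < n) wc * u ^- i * (c * u ^+ (4 * i)) = c * wc * \sum_(i < n) (u ^+ 3) ^+ i.
  rewrite mulr_sumr; apply: eq_bigr => l _.
  rewrite -exprM; have -> : (4 * l = l + 3 * l)%N by rewrite mulSn.
  by rewrite exprD; field; rewrite expf_neq0 ?gt_eqF.
rewrite ler_wpM2l//; first by rewrite mulr_ge0// ltW// (weight_const_gt0 alpha_gt0 Lam_gt0 beta_lt).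
apply: geometric_sum_le; rewrite exprn_ge0 ?(ltW u0)//=.
by rewrite exprn_ilt1 ?(ltW u0) ?(decay_lt1 alpha_gt0 Lam_gt0 beta_lt).
Qed.

Let exceed K k := [set w | (K <= X k w)%N].

Lemma exceed_past K k : <<s past S k >> (exceed K k).
Proof.
have mX : measurable_fun (setT : set (history S true [set ij | (ij.1 < k)%N] [set i | (i < k)%N])) (X k).
  by apply: measurable_X_history.
by have := @history_preimage _ _ _ _ _ _ _ _ _ _ _ [set n | (K <= n)%N] mX; exact.
Qed.

(** The event that [tau S R K] is finite is the countable union of the events [exceed K k]; were
    they all null, so would it be. *)
Lemma exceed_pos K : (1 <= K)%N -> exists k, (0 < P (exceed K k))%E.
Proof.
move=> K1; apply: contrapT => /forallNP none; have := reach K1.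
have zero k : P (exceed K k) = 0%E.
  by apply/eqP; rewrite eq_le measure_ge0 andbT leNgt; apply/negP; exact: none.
have mex k : measurable (exceed K k) by apply: past_measurable; exact: exceed_past.
rewrite (_ : [set w | _] = \bigcup_k exceed K k); last first.
  apply/seteqP; split=> w /=.
    move=> h; apply: contrapT => nk; move: h; rewrite /tau.
    rewrite (_ : [set _ | _ in _] = set0) ?ereal_inf0//.
    by apply/seteqP; split=> // x [n /= Kn _]; apply: nk; exists n.
  move=> [k _ Kk]; apply: (@le_lt_trans _ _ (k%:R%:E)%E); last exact: ltry.
  by apply: ereal_inf_lbound; exists k.
rewrite lt_neqAle => /andP[/eqP + _]; apply; apply/esym/eqP; rewrite -measure_le0.
have -> : 0%E = (\sum_(0 <= k <oo) P (exceed K k))%E :> \bar R.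
  by rewrite eseries0// => k _ _; exact: zero.
by apply: measure_sigma_subadditive => //; exact: bigcupT_measurable.
Qed.

(** Suppose the limit is 0. On the event [exceed K k] the moment [h] at time [k] is positive, and up
    to constants it is at most the moment at a late time, small by assumption, plus the increments
    in between. The late moment, the part in [q] and the part in [e * h] each contribute at most
    [h / 4]: a contradiction. *)
Lemma limit_moment_gt0 (l : R) :
  (\int[Pa]_w (V n w `^ alpha)%:E)%E @[n --> \oo] --> l%:E -> 0 < l.
Proof.
move=> Vl; have l0 : 0 <= l.
  rewrite -lee_fin -(cvg_lim _ Vl)//; apply: lime_ge; first by apply/cvg_ex; eexists; exact: Vl.
  by apply: nearW => n; apply: integral_ge0 => w _; rewrite lee_fin powR_ge0.
rewrite lt_neqAle l0 andbT; apply/negP => /eqP lE; rewrite -{}lE in Vl.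
have tw0 : 0 <= tw := total_weight_ge0 alpha_gt0 Lam_gt0 beta_lt D_moment.
have p0 : 0 <= 2 `^ alpha :> R by exact: powR_ge0.
set A := 2 `^ alpha * tw; have A0 : 0 <= A by rewrite mulr_ge0.
pose e : R := (4 * (A + 1))^-1; have A1 : 0 < A + 1 by lra.
have e0 : 0 < e by rewrite invr_gt0 mulr_gt0.
have Ae : A * e <= 4^-1.
  by rewrite /e invfM mulrCA ler_piMr// ler_pdivrMr// mul1r lerDl.
have [c c0 cP] := increment_bounded law_P lambda_gt0 law_Pa alpha_gt0 Lam_gt0 beta_ge0 beta_lt D_moment e0.
(* Makes [A * c / x] at most [4^-1]; with [K] taken from [x], the quantity [q] is at most
   [h / x]. *)
pose x : R := 4 * (A * c + 1); have x0 : 0 < x.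
  by have := mulr_ge0 A0 c0; rewrite /x; lra.
pose K := (Num.truncn (x `^ alpha^-1)).+1.
have Kx : x <= K%:R `^ alpha.
  have -> : x = (x `^ alpha^-1) `^ alpha by rewrite -powRrM mulVf ?gt_eqF// powRr1// ltW.
  apply: ge0_ler_powR; rewrite ?nnegrE ?(ltW alpha_gt0) ?powR_ge0//.
  by rewrite ltW// truncnS_gt.
have K0 : 0 < K%:R `^ alpha :> R by exact: lt_le_trans Kx.
have [k Pk] := exceed_pos (isT : (1 <= K)%N).
set G := exceed K k in Pk; have hG : <<s past S k >> G by exact: exceed_past.
have mG := past_measurable hG.
have hge0 : (0 <= \int[Pa]_(w in G) (V k w `^ alpha)%:E)%E.
  by apply: integral_ge0 => w _; rewrite lee_fin powR_ge0.
have Vfin : (\int[Pa]_(w in G) (V k w `^ alpha)%:E < +oo)%E.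
  have [L [_ _ _ [h _] _]] := process_limit; apply: le_lt_trans (h k).
  apply: ge0_subset_integral => //.
    by apply/measurable_EFinP; apply: (measurableT_comp mpowR); exact: measurable_normalizedT.
  by move=> w _; rewrite lee_fin powR_ge0.
pose h := fine (\int[Pa]_(w in G) (V k w `^ alpha)%:E)%E.
have hE : (\int[Pa]_(w in G) (V k w `^ alpha)%:E = h%:E)%E.
  by rewrite fineK// ge0_fin_numE.
have h0 : 0 <= h by rewrite fine_ge0.
pose q := (K%:R `^ alpha)^-1 * h; have q0 : 0 <= q by rewrite mulr_ge0// invr_ge0 ltW.
(* On [G] the population at time [k] is at least [K], so its alpha-th moment over [G] is at least
   the alpha-th power of [K] times [P G]. *)
have hq : ((expR (- (k%:R * Lam)))%:E * P G <= q%:E)%E.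
  rewrite /q EFinM -hE (normalized_moment law_P lambda_gt0 law_Pa (leqnn k) hG) muleCA.
  rewrite lee_wpmul2l ?lee_fin ?expR_ge0// lee_pdivlMl// -integral_cst//.
  apply: ge0_le_integral => //.
  - by move=> w _; rewrite lee_fin powR_ge0.
  - apply: measurable_funTS; apply/measurable_EFinP; apply: (measurableT_comp mpowR).
    exact: (measurable_fun_nat_comp (fun k => k%:R : R) (measurable_X S k)).
  - move=> w Kk; rewrite lee_fin; apply: ge0_ler_powR; rewrite ?nnegrE ?(ltW alpha_gt0)//.
    by rewrite ler_nat.
have q_gt0 : 0 < q.
  by rewrite -lte_fin; apply: lt_le_trans hq; rewrite mule_gt0// lte_fin expR_gt0.
have h_gt0 : 0 < h by move: q_gt0; rewrite /q pmulr_rgt0// invr_gt0.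
have [i Vi] : exists i, (\int[Pa]_w (V (k + i) w `^ alpha)%:E <= (h / (4 * (2 `^ alpha + 1)))%:E)%E.
  have d0 : 0 < h / (4 * (2 `^ alpha + 1)) by rewrite divr_gt0// mulr_gt0// ltr_wpDl.
  move/fine_cvgP : Vl => [Vf /cvgrPdist_le/(_ _ d0)[N _ hN]].
  case: Vf => N' _ hN'; exists (maxn N N'); set n := (k + maxn N N')%N.
  have nN : (N <= n)%N by rewrite (leq_trans (leq_maxl N N'))// leq_addl.
  have nN' : (N' <= n)%N by rewrite (leq_trans (leq_maxr N N'))// leq_addl.
  rewrite -(fineK (hN' n nN')) lee_fin; have := hN n nN; rewrite sub0r normrN.
  exact: le_trans (ler_norm _).
have tri w : `|V k w - V (k + i) w| <= \sum_(l < i) incr (k + l) w.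
  by rewrite distrC; exact: (normalized_dist law_P lambda_gt0).
have T0 : 0 <= c * q + e * h by rewrite addr_ge0 ?mulr_ge0 ?(ltW e0).
have := normalized_integral_le Pa law_P lambda_gt0 alpha_gt0 Lam_gt0 beta_lt mG tri.
rewrite hE.
have : ((2 `^ alpha)%:E * (\int[Pa]_(w in G) (V (k + i) w `^ alpha)%:E +
    \sum_(l < i) (wc * u ^- l)%:E * \int[Pa]_(w in G) (incr (k + l) w `^ alpha)%:E) <=
    (2 `^ alpha * (h / (4 * (2 `^ alpha + 1)) + tw * (c * q + e * h)))%:E)%E.
  rewrite [leRHS]EFinM lee_wpmul2l ?lee_fin// EFinD leeD//.
    apply: le_trans Vi; apply: ge0_subset_integral => //.
      by apply/measurable_EFinP; apply: (measurableT_comp mpowR); exact: measurable_normalizedT.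
    by move=> w _; rewrite lee_fin powR_ge0.
  apply: (@le_trans _ _ (\sum_(l < i) wc * u ^- l * (C * u ^+ (4 * l) * (c * q + e * h)))%:E).
    rewrite -sumEFin; apply: lee_sum => j _; rewrite [leRHS]EFinM lee_wpmul2l//.
      rewrite lee_fin mulr_ge0 ?invr_ge0 ?exprn_ge0 ?(ltW u0)//.
      by rewrite ltW// (weight_const_gt0 alpha_gt0 Lam_gt0 beta_lt).
    by apply: cP => //; rewrite hE.
  by rewrite lee_fin (weighted_sum_le alpha_gt0 Lam_gt0 beta_lt D_moment).
move=> h1 h2; have := le_trans h2 h1; rewrite lee_fin; apply/negP; rewrite -ltNge.
have -> : 2 `^ alpha * (h / (4 * (2 `^ alpha + 1)) + tw * (c * q + e * h)) =
    2 `^ alpha / (2 `^ alpha + 1) * (h / 4) + A * c * q + A * e * h.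
  by rewrite /A; field; rewrite gt_eqF// ltr_wpDl.
have b1 : 2 `^ alpha / (2 `^ alpha + 1) * (h / 4) <= h / 4.
  by rewrite ler_piMl ?divr_ge0// ler_pdivrMr ?ltr_wpDl// mul1r lerDl.
have b2 : A * e * h <= 4^-1 * h by rewrite ler_wpM2r.
have b3 : A * c * q <= h / 4.
  rewrite /q mulrA [leRHS]mulrC ler_wpM2r// ler_pdivrMr//.
  have := mulr_ge0 A0 c0; rewrite /x in Kx; lra.
lra.
Qed.

End process_limit.

(** * Tail of X_n *)

(** Three nested limits: [i] to infinity for fixed [e] and [k], then [k] to infinity, then [e] to 0.
    Here [g] stands for the main term, [err] for the noise, and [p] for the effect of moving the
    threshold by a factor. *)
Lemma cvg_double_squeeze (R : realType) (f w : R^nat) (g : R -> nat -> nat -> R)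
    (err : R -> R^nat) (p : R -> R) (l : R) :
  {for 1, continuous p} -> p 1 = 1 ->
  (forall (x : R) k, 0 < x -> g x k i @[i --> \oo] --> p x * w k) ->
  (forall e : R, 0 < e < 1 -> err e k @[k --> \oo] --> 0) ->
  w @ \oo --> l ->
  (forall (e : R) k i, 0 < e < 1 -> g (1 + e) k i - err e k <= f (k + i)%N) ->
  (forall (e : R) k i, 0 < e < 1 -> f (k + i)%N <= g (1 - e) k i + err e k) ->
  f @ \oo --> l.
Proof.
move=> cp p1 gl errl wl flo fup; apply/cvgrPdist_le => eta /= eta0.
have p_l : p x * l @[x --> (1 : R)] --> l.
  by rewrite -{2}[l]mul1r -{2}p1; apply: cvgM; [exact: cp|exact: cvg_cst].
have eta4 : 0 < eta / 4 by rewrite divr_gt0.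
have [e [/andP[e0 e1] pe pe']] : exists e : R, [/\ 0 < e < 1,
    `|l - p (1 + e) * l| <= eta / 4 & `|l - p (1 - e) * l| <= eta / 4].
  move/cvgrPdist_le : p_l => /(_ _ eta4)[r /= r0 hr].
  exists (Num.min (r / 2) 2^-1).
  have m0 : 0 < Num.min (r / 2) 2^-1 by rewrite lt_min divr_gt0//=.
  have m1 : Num.min (r / 2) 2^-1 < 1 by rewrite gt_min invf_lt1// ltr1n orbT.
  have mr : Num.min (r / 2) 2^-1 < r by rewrite gt_min ltr_pdivrMr// ltr_pMr// ltr1n.
  split; first by rewrite m0.
  - by apply: hr; rewrite /ball_/= opprD addrA subrr sub0r normrN gtr0_norm.
  - by apply: hr; rewrite /ball_/= opprB addrCA subrr addr0 gtr0_norm.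
have e01 : 0 < e < 1 by rewrite e0.
have near_k x : p x * w k @[k --> \oo] --> p x * l by apply: cvgM => //; exact: cvg_cst.
have [k [k1 k2 k3]] : exists k, [/\ `|p (1 + e) * l - p (1 + e) * w k| <= eta / 4,
    `|p (1 - e) * l - p (1 - e) * w k| <= eta / 4 & `|err e k| <= eta / 4].
  have := near_k (1 + e); move/cvgrPdist_le => /(_ _ eta4) h1.
  have := near_k (1 - e); move/cvgrPdist_le => /(_ _ eta4) h2.
  have := errl e e01; move/cvgr0Pnorm_le => /(_ _ eta4) h3.
  have [k [? ? ?]] : exists k, [/\ `|p (1 + e) * l - p (1 + e) * w k| <= eta / 4,
    `|p (1 - e) * l - p (1 - e) * w k| <= eta / 4 & `|err e k| <= eta / 4].
    near \oo => k; exists k; split; near: k.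
    - exact: h1.
    - exact: h2.
    - exact: h3.
  by exists k.
have e1' : 0 < 1 + e by lra.
have e2' : 0 < 1 - e by lra.
have := gl _ k e1'; move/cvgrPdist_le => /(_ _ eta4)[N1 _ hN1].
have := gl _ k e2'; move/cvgrPdist_le => /(_ _ eta4)[N2 _ hN2].
exists (k + maxn N1 N2)%N => // n /= hn.
have kn : (k <= n)%N by rewrite (leq_trans _ hn)// leq_addr.
have := hN1 (n - k)%N; have := hN2 (n - k)%N => /=.
have -> : (N1 <= n - k)%N by rewrite leq_subRL// (leq_trans _ hn)// leq_add2l leq_maxl.
have -> : (N2 <= n - k)%N by rewrite leq_subRL// (leq_trans _ hn)// leq_add2l leq_maxr.
move=> /(_ isT) g2 /(_ isT) g1.
have := flo e k (n - k)%N e01; have := fup e k (n - k)%N e01; rewrite subnKC//.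
move: g1 g2 k1 k2 k3 pe pe'; rewrite !ler_norml.
move=> /andP[? ?] /andP[? ?] /andP[? ?] /andP[? ?] /andP[? ?] /andP[? ?] /andP[? ?] ? ?.
by apply/andP; split; lra.
Unshelve. all: by end_near.
Qed.

(** * Tail of a factor from the past times an independent product *)

Section product_tail.
Context d (Omega : measurableType d) de (Env : measurableType de).
Variable S : cbp Omega Env.
Context (R : realType).
Variables (m lambda : R) (P : probability Omega R).
Hypothesis law_P : cbp_law S m P.
Hypothesis lambda_gt0 : 0 < lambda.
Local Notation Delta := (Delta S m lambda).
Local Notation Delta_from := (Delta_from S m lambda).
Local Notation M := (M S m lambda).

Let mDf k n : measurable_fun setT (Delta_from k n).
Proof. by apply: (@measurable_fun_history _ _ _ _ S false setT setT); exact: measurable_Delta_from. Qed.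

Let mM k : measurable_fun setT (M k).
Proof. by apply: (@measurable_fun_history _ _ _ _ S false setT setT); exact: measurable_M. Qed.

(** Induction on [l], integrating out the last factor, which is independent of the others and
    distributed as [M 0]. *)
Lemma Delta_from_ge0_integral k l (h : R -> \bar R) : measurable_fun setT h ->
  (forall x, 0 <= h x)%E ->
  (\int[P]_w h (Delta_from k (k + l) w) = \int[P]_w h (Delta l w))%E.
Proof.
move=> mh h0; transitivity (\int[P]_w h (Delta_from 0 (0 + l) w))%E; last first.
  by apply: eq_integral => w _; rewrite Delta_fromE.
elim: l h mh h0 => [|l IH] h mh h0.
  by apply: eq_integral => w _; rewrite /Delta_from !addn0 !big_geq.
have mh2 : measurable_fun setT (fun z : R * R => h (z.1 * z.2)).
  by apply: (measurableT_comp mh); apply: measurable_funM.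
have step i : (\int[P]_w h (Delta_from i (i + l.+1) w) =
    \int[P]_w (fun x : R => \int[P]_w' h (x * M 0 w')%R) (Delta_from i (i + l) w))%E.
  transitivity (\int[P]_w h (Delta_from i (i + l) w * M (i + l) w)%R)%E.
    by apply: eq_integral => w _; rewrite /Delta_from addnS big_nat_recr ?leq_addr.
  have ind : indep_rv P (Delta_from i (i + l)) (M (i + l)).
    apply: (@law_indep_rv _ _ _ _ _ _ _ _ law_P false false set0 set0 [set j | (j < i + l)%N] [set (i + l)%N]) => //.
    - by move=> j /= [+ E]; rewrite E ltnn.
    - by apply: measurable_Delta_from => j /andP[].
    - exact: measurable_M.
  transitivity (\int[P]_w \int[P]_w' h (Delta_from i (i + l) w * M (i + l) w')%R)%E.
    exact: (indep_ge0_fubini (mDf _ _) (mM _) ind mh2 (fun z => h0 _)).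
  apply: eq_integral => w _.
  apply: (same_law_ge0_integral (mM _) (mM _) (M_same_law lambda law_P (i + l)%N) (h := fun y => h (Delta_from i (i + l) w * y))) => //.
  by apply: (measurableT_comp mh); apply: measurable_funM.
rewrite !step; apply: (IH (fun x => \int[P]_w' h (x * M 0 w')%R)%E) => [|x]; last exact: integral_ge0.
apply: (@measurable_fun_fubini_tonelli_F _ _ _ _ _ P (fun z : R * Omega => h (z.1 * M 0 z.2))) => //.
apply: (measurableT_comp mh); apply: measurable_funM => //.
by apply: (measurableT_comp (mM 0)); exact: measurable_snd.
Qed.

Lemma product_tail_fubini k l (Y : Omega -> R) (s : R) :
  measurable_fun (setT : set (history S true setT `I_k)) Y ->
  P [set w | s < Y w * Delta_from k (k + l) w] =
  (\int[P]_w P [set w' | (s < Y w * Delta l w')%R])%E.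
Proof.
move=> hY; have mY : measurable_fun setT Y := measurable_fun_history hY.
have mD : measurable_fun setT (Delta l).
  by rewrite (_ : Delta l = Delta_from 0 l)//; apply/funext => w; rewrite Delta_fromE.
pose h (x : R) : \bar R := (\1_[set y : R | s < y] x)%:E.
have ms : measurable [set y : R | s < y].
  by rewrite (_ : [set _ | _] = `]s, +oo[%classic)//; apply/seteqP; split => y /=; rewrite in_itv/= andbT.
have mh : measurable_fun setT h by apply/measurable_EFinP; exact: measurable_indic.
have h0 x : (0 <= h x)%E by rewrite lee_fin.
have prob (Z : Omega -> R) : measurable_fun setT Z ->
    P [set w | s < Z w] = (\int[P]_w h (Z w))%E.
  move=> mZ; have mE : measurable [set w | s < Z w].
    by rewrite -[X in measurable X]setTI; exact: (mZ measurableT _ ms).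
  rewrite -[in LHS](setIT [set w | _]) -integral_indic//.
rewrite prob; last exact: measurable_funM.
have mh2 : measurable_fun setT (fun z : R * R => h (z.1 * z.2)).
  by apply: (measurableT_comp mh); apply: measurable_funM.
have ind : indep_rv P Y (Delta_from k (k + l)).
  apply: (@law_indep_rv _ _ _ _ _ _ _ _ law_P true false setT set0 `I_k [set j | (k <= j)%N]) => //.
  - by move=> j /= [jk]; rewrite leqNgt jk.
  - by apply: measurable_Delta_from => j /andP[].
transitivity (\int[P]_w \int[P]_w' h (Y w * Delta_from k (k + l) w')%R)%E.
  exact: (indep_ge0_fubini mY (mDf _ _) ind mh2 (fun z => h0 _)).
apply: eq_integral => w _; rewrite prob; last exact: measurable_funM.
apply: (@Delta_from_ge0_integral k l (fun y => h (Y w * y))) => //.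
by apply: (measurableT_comp mh); apply: measurable_funM.
Qed.

Lemma Delta_tailE l (s x : R) (rho : R) : 0 < s -> 0 < x ->
  [set w | s < x * Delta l w] =
  [set w | rho * l%:R + (ln s - ln x - rho * l%:R) < ln (Delta l w)].
Proof.
move=> s0 x0; apply/seteqP; split => w /=.
  rewrite -ltr_ln ?posrE ?mulr_gt0 ?(Delta_gt0 law_P lambda_gt0)//.
  by rewrite lnM ?posrE ?(Delta_gt0 law_P lambda_gt0)//; lra.
rewrite -[s < _]ltr_ln ?posrE ?mulr_gt0 ?(Delta_gt0 law_P lambda_gt0)//.
by rewrite lnM ?posrE ?(Delta_gt0 law_P lambda_gt0)//; lra.
Qed.

Lemma Delta_tail0 l (s : R) : 0 < s -> [set w | s < 0 * Delta l w] = set0.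
Proof. by move=> s0; apply/seteqP; split => // w /=; rewrite mul0r ltNge (ltW s0). Qed.

End product_tail.

Section product_tail_asymptotics.
Context d (Omega : measurableType d) de (Env : measurableType de).
Variable S : cbp Omega Env.
Context (R : realType).
Variables (m lambda : R) (P Pa : probability Omega R) (alpha rho v : R).
Hypothesis law_P : cbp_law S m P.
Hypothesis lambda_gt0 : 0 < lambda.
Hypothesis alpha_gt0 : 0 < alpha.
Hypothesis alpha_int : interior (dom_Lambda S m lambda P) alpha.
Hypothesis law_Pa : tilted_law S m lambda P alpha Pa.
Hypothesis logM_nonarith : nonarithmetic_logM S m lambda P.
Hypothesis rho_def : rho = derive1 (Lambda S m lambda P) alpha.
Hypothesis v_gt0 : 0 < v.
Hypothesis v_def : v ^+ 2 = derive1n 2 (Lambda S m lambda P) alpha.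
Local Notation Delta := (Delta S m lambda).
Local Notation Delta_from := (Delta_from S m lambda).
Local Notation Lam := (Lambda S m lambda P alpha).
Local Notation I := (alpha * rho - Lam).

Let shift_factor l (s x : R) : 0 < s -> 0 < x ->
  expR (- (l%:R * I)) * expR (- (alpha * (ln s - ln x - rho * l%:R))) =
  expR (l%:R * Lam) * s `^ (- alpha) * x `^ alpha.
Proof.
move=> s0 x0; rewrite /powR !gt_eqF// -!expRD; congr expR; ring.
Qed.

Lemma Delta_tail_bounded : exists2 B : R, 0 <= B & forall l (s x : R), 0 < s -> 0 <= x ->
  (P [set w | (s < x * Delta l w)%R] <=
   (B * expR (l%:R * Lam) * s `^ (- alpha) / Num.sqrt l.+1%:R * x `^ alpha)%:E)%E.
Proof.
have [B B0 hB] := tail_prob_bounded law_P lambda_gt0 alpha_gt0 alpha_int law_Pa logM_nonarith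
  rho_def v_gt0 v_def.
(* For [x = 0], where passing to logarithms is not possible, the event is empty. *)
exists B => // l s x s0; rewrite le_eqVlt => /predU1P[<-|x0].
  rewrite Delta_tail0// measure0 lee_fin.
  by rewrite !mulr_ge0 ?powR_ge0 ?expR_ge0 ?invr_ge0 ?sqrtr_ge0.
rewrite (Delta_tailE law_P lambda_gt0 l rho s0 x0); apply: le_trans (hB _ _) _.
rewrite lee_fin -[B * _ * expR _]mulrA shift_factor// le_eqVlt; apply/orP; left; apply/eqP; ring.
Qed.

(** The root counts the [l] factors of the product, while the exponential already uses [k + l]; the
    root is adjusted in [product_tail_limit]. *)
Lemma Delta_tail_limit k (r x : R) : 0 < r -> 0 <= x ->
  Num.sqrt l%:R * expR ((k + l)%:R * I) *
    fine (P [set w | r * expR (rho * (k + l)%:R) < x * Delta l w]) @[l --> \oo] -->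
  expR (- (k%:R * Lam)) * r `^ (- alpha) * ((v * Num.sqrt (2 * pi))^-1 / alpha) * x `^ alpha.
Proof.
move=> r0; rewrite le_eqVlt => /predU1P[<-|x0].
  rewrite powR0 ?gt_eqF// mulr0; apply: cvg_near_cst; apply: nearW => l.
  by rewrite Delta_tail0 ?measure0 ?mulr0// mulr_gt0// expR_gt0.
pose b := ln r - ln x + rho * k%:R.
have := tail_prob_limit law_P lambda_gt0 alpha_gt0 alpha_int law_Pa logM_nonarith
  rho_def v_gt0 v_def (b := b).
move/(cvgM (cvg_cst (expR (k%:R * I)))).
set c := (_^-1 / alpha).
have -> : expR (k%:R * I) * (expR (- (alpha * b)) * c) =
    expR (- (k%:R * Lam)) * r `^ (- alpha) * c * x `^ alpha.
  rewrite mulrA -expRD /powR !gt_eqF// mulrAC -!expRD; congr (_ * _); congr expR.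
  by rewrite /b; ring.
apply: cvg_trans; apply: near_eq_cvg; apply: nearW => l.
rewrite (Delta_tailE law_P lambda_gt0 l rho _ x0) ?mulr_gt0 ?expR_gt0//.
rewrite lnM ?posrE ?expR_gt0// expRK.
have -> : ln r + rho * (k + l)%:R - ln x - rho * l%:R = b by rewrite /b natrD; ring.
rewrite natrD mulrDl expRD /=; ring.
Qed.

Let measurable_tail (s : R) l : measurable_fun setT (fun x : R => P [set w | s < x * Delta l w]).
Proof.
have mD : measurable_fun setT (Delta l).
  rewrite (_ : Delta l = Delta_from 0 l); last by apply/funext => w; rewrite Delta_fromE.
  by apply: (@measurable_fun_history _ _ _ _ S false setT setT); exact: measurable_Delta_from.
have mE : measurable [set z : R * Omega | s < z.1 * Delta l z.2].
  have mf : measurable_fun setT (fun z : R * Omega => z.1 * Delta l z.2).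
    by apply: measurable_funM => //; apply: (measurableT_comp mD); exact: measurable_snd.
  rewrite -[X in measurable X]setTI.
  have -> : [set z : R * Omega | s < z.1 * Delta l z.2] =
      (fun z : R * Omega => z.1 * Delta l z.2) @^-1` `]s, +oo[%classic.
    by apply/seteqP; split => z /=; rewrite in_itv/= andbT.
  exact: mf.
rewrite (_ : (fun x : R => _) = P \o xsection [set z : R * Omega | s < z.1 * Delta l z.2]).
  exact: measurable_fun_xsection.
apply/funext => x /=; congr (P _); apply/seteqP; split => w; rewrite /xsection /= inE//.
Qed.

Let measurable_history_ge0 k (Y : Omega -> R) :
  measurable_fun (setT : set (history S true setT `I_k)) Y -> measurable_fun setT Y.
Proof. exact: measurable_fun_history. Qed.

Lemma product_tail_bounded : exists2 B : R, 0 <= B &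
  forall k l (Y : Omega -> R) (s : R), 0 < s -> (forall w, 0 <= Y w) ->
  measurable_fun (setT : set (history S true setT `I_k)) Y ->
  (P [set w | (s < Y w * Delta_from k (k + l) w)%R] <=
   (B * expR (l%:R * Lam) * s `^ (- alpha) / Num.sqrt l.+1%:R)%:E *
   \int[P]_w (Y w `^ alpha)%:E)%E.
Proof.
have [B B0 hB] := Delta_tail_bounded; exists B => // k l Y s s0 Y0 hY.
have mY := measurable_history_ge0 hY.
have mYa : measurable_fun setT (fun w => (Y w `^ alpha)%:E).
  by apply/measurable_EFinP; apply: (measurableT_comp (measurable_powR alpha)).
rewrite (product_tail_fubini lambda law_P)//.
rewrite -ge0_integralZl//; last 2 first.
- by move=> w _; rewrite lee_fin powR_ge0.
- by rewrite lee_fin !mulr_ge0 ?powR_ge0 ?expR_ge0 ?invr_ge0 ?sqrtr_ge0.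
apply: ge0_le_integral => //.
- by apply: (measurableT_comp (measurable_tail s l)).
- exact: measurable_funeM.
- by move=> w _; rewrite -EFinM; exact: hB.
Qed.

(** The limit holds for each fixed value of [Y], and the uniform tail bound dominates by a constant
    times the alpha-th power of [Y]. *)
Lemma product_tail_limit k (Y : Omega -> R) (r : R) : 0 < r -> (forall w, 0 <= Y w) ->
  measurable_fun (setT : set (history S true setT `I_k)) Y ->
  (\int[P]_w (Y w `^ alpha)%:E < +oo)%E ->
  Num.sqrt (k + l)%:R * expR ((k + l)%:R * I) *
    fine (P [set w | r * expR (rho * (k + l)%:R) < Y w * Delta_from k (k + l) w])
    @[l --> \oo] -->
  r `^ (- alpha) * ((v * Num.sqrt (2 * pi))^-1 / alpha) *
    (expR (- (k%:R * Lam)) * fine (\int[P]_w (Y w `^ alpha)%:E)).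
Proof.
move=> r0 Y0 hY Yfin.
have [B B0 hB] := Delta_tail_bounded.
have mY := measurable_history_ge0 hY.
have mYa : measurable_fun setT (fun w => (Y w `^ alpha)%:E).
  by apply/measurable_EFinP; apply: (measurableT_comp (measurable_powR alpha)).
set c := (_^-1 / alpha).
pose t l := r * expR (rho * (k + l)%:R).
have t0 l : 0 < t l by rewrite mulr_gt0// expR_gt0.
pose a l := Num.sqrt l%:R * expR ((k + l)%:R * I).
have a0 l : 0 <= a l by rewrite mulr_ge0 ?sqrtr_ge0 ?expR_ge0.
pose C := expR (- (k%:R * Lam)) * r `^ (- alpha) * c.
have Ya0 w : (0 <= (Y w `^ alpha)%:E)%E by rewrite lee_fin powR_ge0.
have mQ l : measurable_fun setT (fun w => P [set w' | t l < Y w * Delta l w']).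
  exact: (measurableT_comp (measurable_tail _ _)).
have Qf l w : P [set w' | t l < Y w * Delta l w'] \is a fin_num.
  rewrite ge0_fin_numE//; apply: le_lt_trans (hB l _ _ (t0 l) (Y0 w)) _.
  by rewrite ltry.
have lim : (\int[P]_w ((a l)%:E * P [set w' | (t l < Y w * Delta l w')%R]) @[l --> \oo] -->
    \int[P]_w (C%:E * (Y w `^ alpha)%:E))%E.
  pose G w := ((B * expR (- (k%:R * Lam)) * r `^ (- alpha))%:E * (Y w `^ alpha)%:E)%E.
  have G0 w : (0 <= G w)%E.
    by rewrite mule_ge0// lee_fin !mulr_ge0 ?powR_ge0 ?expR_ge0.
  have [] := @dominated_convergence _ _ _ P setT measurableT
    (fun l w => (a l)%:E * P [set w' | (t l < Y w * Delta l w')%R])%E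
    (fun w => C%:E * (Y w `^ alpha)%:E)%E G.
  - by move=> l; exact: measurable_funeM.
  - exact: measurable_funeM.
  - apply: aeW => w _.
    have h := @Delta_tail_limit k r _ r0 (Y0 w).
    have -> : (fun l => (a l)%:E * P [set w' | (t l < Y w * Delta l w')%R])%E =
        (fun l => (a l * fine (P [set w' | t l < Y w * Delta l w']))%:E).
      by apply/funext => l; rewrite [in RHS]EFinM fineK.
    by rewrite -EFinM; apply: cvg_EFin; [exact: nearW|exact: h].
  - apply/integrableP; split; first exact: measurable_funeM.
    under eq_integral do rewrite gee0_abs//.
    rewrite ge0_integralZl//; last by rewrite lee_fin !mulr_ge0 ?powR_ge0 ?expR_ge0.
    by rewrite lte_mul_pinfty// ?lee_fin ?integral_ge0// !mulr_ge0 ?powR_ge0 ?expR_ge0.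
  - apply: aeW => w l _.
    rewrite gee0_abs; last by rewrite mule_ge0// lee_fin.
    apply: (@le_trans _ _ ((a l)%:E * (B * expR (l%:R * Lam) * t l `^ (- alpha) /
       Num.sqrt l.+1%:R * Y w `^ alpha)%:E)%E).
      by rewrite lee_wpmul2l ?lee_fin ?hB.
    rewrite /G -!EFinM lee_fin mulrA ler_wpM2r ?powR_ge0//.
    have -> : t l `^ (- alpha) = r `^ (- alpha) * expR (- (alpha * (rho * (k + l)%:R))).
      by rewrite /t powRM ?(ltW r0) ?expR_ge0// [expR _ `^ _]/powR gt_eqF ?expR_gt0// expRK mulNr.
    (* The exponentials in [l] cancel, which leaves a dominating function free of [l]. *)
    have e : expR ((k + l)%:R * I) * expR (l%:R * Lam) * expR (- (alpha * (rho * (k + l)%:R))) =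
        expR (- (k%:R * Lam)).
      by rewrite -!expRD natrD; congr expR; ring.
    have -> : a l * (B * expR (l%:R * Lam) * (r `^ (- alpha) * expR (- (alpha * (rho * (k + l)%:R))))
        / Num.sqrt l.+1%:R) =
        (Num.sqrt l%:R / Num.sqrt l.+1%:R) * (B * expR (- (k%:R * Lam)) * r `^ (- alpha)).
      by rewrite -e /a; ring.
    rewrite ler_piMl ?mulr_ge0 ?powR_ge0 ?expR_ge0// ler_pdivrMr ?mul1r ?ler_wsqrtr ?ler_nat//.
  - by [].
have C0 : 0 <= C.
  have c0 : 0 <= c.
    by rewrite /c divr_ge0 ?(ltW alpha_gt0)// invr_ge0 mulr_ge0 ?sqrtr_ge0 ?(ltW v_gt0).
  by apply: mulr_ge0 c0; rewrite mulr_ge0 ?powR_ge0 ?expR_ge0.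
rewrite ge0_integralZl// in lim.
have Efin : (\int[P]_w (Y w `^ alpha)%:E)%E \is a fin_num.
  by rewrite ge0_fin_numE// integral_ge0.
rewrite -(fineK Efin) -EFinM in lim.
have lim2 : a l * fine (P [set w | t l < Y w * Delta_from k (k + l) w]) @[l --> \oo] -->
    C * fine (\int[P]_w (Y w `^ alpha)%:E).
  apply: cvg_trans (fine_cvg lim); apply: near_eq_cvg; apply: nearW => l /=.
  rewrite ge0_integralZl ?lee_fin// -(product_tail_fubini lambda law_P l (t l) hY).
  rewrite fineM// fin_num_measure//; have mD : measurable_fun setT (Delta_from k (k + l)).
    by apply: (@measurable_fun_history _ _ _ _ S false setT setT); exact: measurable_Delta_from.
  have := measurable_funM mY mD measurableT (measurable_itv `]t l, +oo[).
  by rewrite setTI; congr measurable; apply/seteqP; split => w /=; rewrite in_itv/= andbT.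
(* Passes from the root of [l] to the root of [k + l]; the quotient tends to 1 for fixed [k]. *)
have ratio : Num.sqrt (1 + k%:R * (l%:R : R)^-1) @[l --> \oo] --> (1 : R).
  have inv0 : (l%:R : R)^-1 @[l --> \oo] --> (0 : R) by rewrite -cvg_shiftS; exact: cvg_harmonic.
  have : 1 + k%:R * (l%:R : R)^-1 @[l --> \oo] --> (1 + k%:R * 0 : R).
    by apply: cvgD; [exact: cvg_cst|apply: cvgM => //; exact: cvg_cst].
  have := @sqrt_continuous R (1 + k%:R * 0); rewrite /continuous_at mulr0 addr0 sqrtr1 => + h.
  by move=> hs; exact: (cvg_comp _ _ h hs).
have -> : r `^ (- alpha) * c * (expR (- (k%:R * Lam)) * fine (\int[P]_w (Y w `^ alpha)%:E)) =
    1 * (C * fine (\int[P]_w (Y w `^ alpha)%:E)) by rewrite /C; ring.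
apply: cvg_trans (cvgM ratio lim2); apply: near_eq_cvg; near=> l.
have l0 : (0 < l)%N by near: l; exact: nbhs_infty_gt.
rewrite /= /a !mulrA; congr (_ * _ * _).
rewrite -sqrtrM; last by rewrite addr_ge0// mulr_ge0// invr_ge0.
by congr Num.sqrt; rewrite natrD; field; rewrite pnatr_eq0 -lt0n.
Unshelve. all: by end_near.
Qed.

End product_tail_asymptotics.

Lemma fine_union_bound d (T : measurableType d) (R : realType) (P : probability T R)
    (A B : set T) (E : nat -> set T) (l : nat) :
  measurable A -> measurable B -> (forall i, measurable (E i)) ->
  A `<=` B `|` \bigcup_(i in `I_l) E i ->
  fine (P A) <= fine (P B) + \sum_(i < l) fine (P (E i)).
Proof.
move=> mA mB mE sub.
pose F i := if i is i'.+1 then E i' else B.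
have mF i : measurable (F i) by case: i.
have cover : A `<=` \big[setU/set0]_(i < l.+1) F i.
  by rewrite -bigcup_mkord => w /sub[Bw|[i il Ei]]; [exists 0%N|exists i.+1].
have := content_subadditive P (fun i _ => mF i) mA cover.
rewrite big_ord_recl -lee_fin EFinD -sumEFin !fineK ?fin_num_measure//.
by under [X in _ -> (_ <= _ + X)%E]eq_bigr do rewrite fineK ?fin_num_measure//.
Qed.

(** Each of the [n.+1] copies of [u ^+ n] is at most a different term of the geometric sum up to
    degree [n]. *)
Lemma natr_exp_le (R : realType) (u : R) (n : nat) : 0 < u < 1 ->
  n.+1%:R * u ^+ n <= (1 - u)^-1.
Proof.
move=> /andP[u0 u1]; have : \sum_(i < n.+1) u ^+ i <= (1 - u)^-1.
  by apply: geometric_sum_le; rewrite ltW.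
apply: le_trans; rewrite -[n.+1 in leLHS]card_ord -sumr_const mulr_suml.
apply: ler_sum => i _; rewrite mul1r; apply: ler_wiXn2l; rewrite ?(ltW u0) ?(ltW u1)//.
by rewrite -ltnS.
Qed.

(** [k + l] is the sum of [k + i] and [l - i], hence at most the product of [(k + i).+1] and
    [l - i]. The linear loss in [k + i] is absorbed by one factor [decay ^+ (k + i)]. *)
Lemma sqrt_ratio_le (R : realType) (k i l : nat) : (i < l)%N ->
  Num.sqrt (k + l)%:R / Num.sqrt (l - i)%:R <= (k + i).+1%:R :> R.
Proof.
move=> il; have p : (0 < l - i)%N by rewrite subn_gt0.
rewrite ler_pdivrMr; last by rewrite sqrtr_gt0 ltr0n.
have : Num.sqrt (k + l)%:R <= Num.sqrt ((k + i).+1%:R * (l - i)%:R) :> R.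
  rewrite ler_sqrt ?mulr_ge0// -natrM ler_nat.
  have e : (k + l = k + i + (l - i))%N by rewrite -addnA subnKC// ltnW.
  by rewrite e mulSn addnC leq_add2l leq_pmulr.
move/le_trans; apply; rewrite sqrtrM// ler_wpM2r ?sqrtr_ge0//.
rewrite -[leRHS]ger0_norm// -sqrtr_sqr ler_sqrt ?exprn_ge0// -natrX ler_nat.
by rewrite expnS expn1 leq_pmulr.
Qed.

Lemma inv_powR (R : realType) (x a : R) : 0 < x -> x^-1 `^ a = x `^ (- a).
Proof. by move=> x0; rewrite /powR invr_eq0 !gt_eqF// lnV// mulNr mulrN. Qed.

(** * Tail of the process *)

Section tail.
Context d (Omega : measurableType d) de (Env : measurableType de).
Variable S : cbp Omega Env.
Context (R : realType).
Variables (m lambda : R) (P Pa : probability Omega R) (alpha rho v : R).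
Hypothesis law_P : cbp_law S m P.
Hypothesis lambda_gt0 : 0 < lambda.
Hypothesis alpha_gt0 : 0 < alpha.
Hypothesis alpha_int : interior (dom_Lambda S m lambda P) alpha.
Hypothesis law_Pa : tilted_law S m lambda P alpha Pa.
Hypothesis logM_nonarith : nonarithmetic_logM S m lambda P.
Hypothesis rho_def : rho = derive1 (Lambda S m lambda P) alpha.
Hypothesis v_gt0 : 0 < v.
Hypothesis v_def : v ^+ 2 = derive1n 2 (Lambda S m lambda P) alpha.
Local Notation Lam := (Lambda S m lambda P alpha).
Hypothesis Lam_gt0 : 0 < Lam.
Variables (C beta : R).
Hypothesis beta_ge0 : 0 <= beta.
Hypothesis beta_lt : beta < alpha.
Hypothesis D_moment : forall k : nat,
  ('E_P[fun w => (`|D S m lambda k w| `^ alpha)%R] <= (C * (1 + k%:R `^ beta))%R%:E)%E.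
Hypothesis X0_moment : ('E_P[fun w => ((X0 S w)%:R `^ alpha)%R] < +oo)%E.
Local Notation Delta := (Delta S m lambda).
Local Notation Delta_from := (Delta_from S m lambda).
Local Notation X := (X S).
Local Notation V := (normalized S m lambda).
Local Notation incr := (increment S m lambda).
Local Notation u := (decay S m lambda P alpha beta).
Local Notation wc := (weight_const S m lambda P alpha beta).
Local Notation W := (weight S m lambda P alpha beta).
Local Notation I := (alpha * rho - Lam).

Let N j w := `|noise S m lambda j (X j w) w|.

Let u0 : 0 < u. Proof. exact: decay_gt0. Qed.
Let u1 : u < 1. Proof. exact: decay_lt1. Qed.

Let mN j : measurable_fun (setT : set (history S true setT `I_j.+1)) (N j).
Proof. by apply: (measurableT_comp (@normr_measurable R setT)); exact: measurable_noise_X. Qed.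

Let mX k : measurable_fun (setT : set (history S true setT `I_k)) (fun w => (X k w)%:R : R).
Proof.
apply: (@measurable_fun_nat_comp _ _ (history S true setT `I_k) _ (fun a => a%:R : R)).
exact: measurable_X_history.
Qed.

Let mDf k n : measurable_fun setT (Delta_from k n).
Proof. by apply: (@measurable_fun_history _ _ _ _ S false setT setT); exact: measurable_Delta_from. Qed.

Lemma Delta_fromM k n w : (k <= n)%N -> Delta n w = Delta k w * Delta_from k n w.
Proof. by move=> kn; rewrite !Delta_fromE /Delta_from -big_cat_nat. Qed.

(** The telescoped increments of [normalized], multiplied by [Delta (k + l)]. In each term the
    product starts after the generation of the noise, so that the two factors are independent. *)
Lemma process_split k l w :
  `|(X (k + l) w)%:R - (X k w)%:R * Delta_from k (k + l) w| <=
  \sum_(i < l) N (k + i) w * Delta_from (k + i).+1 (k + l) w.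
Proof.
have D0 n : 0 < Delta n w := Delta_gt0 law_P lambda_gt0 n w.
have E n : (X n w)%:R = V n w * Delta n w by rewrite /normalized divfK// gt_eqF.
rewrite !E -mulrA -Delta_fromM ?leq_addr// -mulrBl normrM (gtr0_norm (D0 _)).
apply: le_trans (ler_wpM2r (ltW (D0 _)) (normalized_dist law_P lambda_gt0 k l w)) _.
rewrite mulr_suml; apply: ler_sum => i _.
rewrite (@Delta_fromM (k + i).+1); last by rewrite -addnS leq_add2l.
by rewrite mulrA /increment divfK// gt_eqF.
Qed.

(** The noise of index [i] exceeds its share of the tolerance [t]. As the shares [W i] sum to at
    most 1, the total error is at most [t] outside all these events. *)
Let err k l (t : R) i :=
  [set w | W i * t < N (k + i) w * Delta_from (k + i).+1 (k + l) w].

Let err_outside k l t w : 0 <= t -> ~ (\bigcup_(i in `I_l) err k l t i) w ->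
  `|(X (k + l) w)%:R - (X k w)%:R * Delta_from k (k + l) w| <= t.
Proof.
move=> t0 nE; apply: le_trans (process_split k l w) _.
apply: (@le_trans _ _ (\sum_(i < l) W i * t)); last first.
  by rewrite -mulr_suml ler_piMl// (sum_weight alpha_gt0 Lam_gt0 beta_lt).
by apply: ler_sum => i _; rewrite leNgt; apply/negP => h; apply: nE; exists i => //=.
Qed.

Let mlt (f : Omega -> R) s : measurable_fun setT f -> measurable [set w | s < f w].
Proof.
move=> mf; have := mf measurableT _ (measurable_itv `]s, +oo[).
by rewrite setTI; congr measurable; apply/seteqP; split => w /=; rewrite in_itv/= andbT.
Qed.

Let mXT k : measurable_fun setT (fun w => (X k w)%:R : R).
Proof. exact: (measurable_fun_history (@mX k)). Qed.

Let merr k l t i : measurable (err k l t i).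
Proof. by apply: mlt; apply: measurable_funM => //; exact: (measurable_fun_history (@mN _)). Qed.

Let mmain k l : measurable_fun setT (fun w => (X k w)%:R * Delta_from k (k + l) w).
Proof. by apply: measurable_funM => //; exact: mXT. Qed.

(** Either the main term exceeds the threshold lowered by the fraction [e], or the error exceeds
    [e * t] and some event [err] occurs. *)
Lemma tail_upper k l (e t : R) : 0 < e < 1 -> 0 < t ->
  fine (P [set w | t < (X (k + l) w)%:R]) <=
  fine (P [set w | (1 - e) * t < (X k w)%:R * Delta_from k (k + l) w]) +
  \sum_(i < l) fine (P (err k l (e * t) i)).
Proof.
move=> /andP[e0 e1] t0; apply: fine_union_bound; try (apply: mlt; exact: mXT || exact: mmain); first exact: merr.
move=> w /= tX; apply: contrapT => /not_orP[/= /negP + /err_outside].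
rewrite -leNgt => h /(_ (mulr_ge0 (ltW e0) (ltW t0))); rewrite ler_norml => /andP[_].
by move: tX h; lra.
Qed.

Lemma tail_lower k l (e t : R) : 0 < e < 1 -> 0 < t ->
  fine (P [set w | (1 + e) * t < (X k w)%:R * Delta_from k (k + l) w]) <=
  fine (P [set w | t < (X (k + l) w)%:R]) +
  \sum_(i < l) fine (P (err k l (e * t) i)).
Proof.
move=> /andP[e0 e1] t0; apply: fine_union_bound; try (apply: mlt; exact: mXT || exact: mmain); first exact: merr.
move=> w /= tX; apply: contrapT => /not_orP[/= /negP + /err_outside].
rewrite -leNgt => h /(_ (mulr_ge0 (ltW e0) (ltW t0))); rewrite ler_norml => /andP[+ _].
by move: tX h; lra.
Qed.

(** Each noise is tested against its share by the product tail bound. The exponentials cancel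
    exactly and the powers of [u] decide: the noise moment brings [4 * (k + i)] of them, the weight
    takes [i], the quotient of square roots [k + i], and [3 * k + 2 * i] remain. *)
Lemma error_bounded : exists2 K : R, 0 <= K & forall k l s, 0 < s ->
  Num.sqrt (k + l)%:R * expR ((k + l)%:R * I) *
    \sum_(i < l) fine (P (err k l (s * expR (rho * (k + l)%:R)) i)) <=
  K * s `^ (- alpha) * (u ^+ 3) ^+ k.
Proof.
have [B B0 hB] := product_tail_bounded law_P lambda_gt0 alpha_gt0 alpha_int law_Pa
  logM_nonarith rho_def v_gt0 v_def.
have [c c0 hc] := increments_moment law_P lambda_gt0 law_Pa alpha_gt0 Lam_gt0 beta_ge0
  beta_lt D_moment X0_moment.
have wc0 : 0 < wc := weight_const_gt0 alpha_gt0 Lam_gt0 beta_lt.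
have u1' : 0 < 1 - u by rewrite subr_gt0.
have iu0 : 0 <= (1 - u)^-1 by rewrite invr_ge0 ltW.
exists (B * c * wc * (1 - u)^-1 * (1 - u ^+ 2)^-1).
  rewrite !mulr_ge0 ?(ltW wc0)// invr_ge0 subr_ge0 exprn_ile1// ?(ltW u0) ?(ltW u1)//.
move=> k l s s0; set n := (k + l)%N; set z := s * expR (rho * n%:R).
have z0 : 0 < z by rewrite mulr_gt0// expR_gt0.
have term i : (i < l)%N -> Num.sqrt n%:R * expR (n%:R * I) * fine (P (err k l z i)) <=
    B * c * wc * (1 - u)^-1 * s `^ (- alpha) * (u ^+ 3) ^+ k * (u ^+ 2) ^+ i.
  move=> il; have Wi0 : 0 < W i := weight_gt0 alpha_gt0 Lam_gt0 beta_lt i.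
  (* The noise of generation [k + i] is known after [(k + i).+1] generations, and [l - i.+1] factors
     follow it. *)
  have nE : ((k + i).+1 + (l - i.+1) = n)%N by rewrite addSnnS -subSn// subSS /n -addnA subnKC// ltnW.
  have := hB (k + i).+1 (l - i.+1)%N (N (k + i)) (W i * z) (mulr_gt0 Wi0 z0)
    (fun w => normr_ge0 _) (@mN (k + i)%N).
  rewrite nE -/(err k l z i) subnSK//.
  have moment : (\int[P]_w (N (k + i) w `^ alpha)%:E <=
      (expR ((k + i).+1%:R * Lam) * (c * u ^+ (4 * (k + i))))%:E)%E.
    have := hc (k + i)%N; rewrite (increment_moment law_P lambda_gt0 law_Pa (leq0n _) (@pastT _ _ _ _ S 0)).
    by rewrite expRN lee_pdivrMl ?expR_gt0.
  have T : (W i * z) `^ (- alpha) = wc / u ^+ i * (s `^ (- alpha) * expR (- (alpha * rho * n%:R))).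
    rewrite -(inv_powR alpha (mulr_gt0 Wi0 z0)) invfM [X in X `^ _]mulrC.
    rewrite (weight_pow alpha_gt0 Lam_gt0 beta_lt) ?invr_ge0 ?(ltW z0)//.
    rewrite inv_powR// /z powRM ?(ltW s0) ?expR_ge0//; congr (_ * (_ * _)).
    by rewrite /powR gt_eqF ?expR_gt0// expRK; congr expR; ring.
  set b := B * _ * (W i * z) `^ _ / _ => h.
  have b0 : 0 <= b by rewrite /b !mulr_ge0 ?powR_ge0 ?expR_ge0 ?invr_ge0 ?sqrtr_ge0.
  have {h} : fine (P (err k l z i)) <= b * (expR ((k + i).+1%:R * Lam) * (c * u ^+ (4 * (k + i)))).
    rewrite -lee_fin fineK ?fin_num_measure//; apply: le_trans h _.
    by rewrite [leRHS]EFinM lee_wpmul2l.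
  move=> h; have a0 : 0 <= Num.sqrt n%:R * expR (n%:R * I) :> R by rewrite mulr_ge0 ?sqrtr_ge0 ?expR_ge0.
  apply: le_trans (ler_wpM2l a0 h) _.
  have eE : expR (n%:R * I) * expR ((l - i.+1)%:R * Lam) * expR (- (alpha * rho * n%:R)) *
      expR ((k + i).+1%:R * Lam) = 1.
    by rewrite -!expRD -[RHS]expR0 -nE natrD; congr expR; ring.
  have -> : Num.sqrt n%:R * expR (n%:R * I) * (b * (expR ((k + i).+1%:R * Lam) * (c * u ^+ (4 * (k + i))))) =
      B * c * wc * s `^ (- alpha) * (Num.sqrt n%:R / Num.sqrt (l - i)%:R) * (u ^+ (4 * (k + i)) / u ^+ i).
    rewrite -[RHS]mulr1 -[X in _ = _ * X]eE /b T; move: (expR _) (u ^+ (4 * (k + i))) => ? ?; ring.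
  have -> : B * c * wc * (1 - u)^-1 * s `^ (- alpha) * (u ^+ 3) ^+ k * (u ^+ 2) ^+ i =
      B * c * wc * s `^ (- alpha) * (((1 - u)^-1 / u ^+ (k + i)) * (u ^+ (4 * (k + i)) / u ^+ i)).
    rewrite -!exprM; have -> : (4 * (k + i) = 3 * k + 2 * i + (k + i) + i)%N by ring.
    by rewrite !exprD; field; rewrite !expf_neq0 ?gt_eqF.
  rewrite -[leLHS]mulrA ler_wpM2l//; first by rewrite !mulr_ge0 ?powR_ge0 ?(ltW wc0).
  rewrite ler_wpM2r//; first by rewrite divr_ge0 ?exprn_ge0 ?(ltW u0).
  apply: le_trans (sqrt_ratio_le R k il) _.
  by rewrite ler_pdivlMr ?exprn_gt0// natr_exp_le// u0.
apply: (@le_trans _ _ (\sum_(i < l) B * c * wc * (1 - u)^-1 * s `^ (- alpha) * (u ^+ 3) ^+ k * (u ^+ 2) ^+ i)).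
  by rewrite mulr_sumr; apply: ler_sum => i _; exact: term.
rewrite -mulr_sumr.
have -> : B * c * wc * (1 - u)^-1 * (1 - u ^+ 2)^-1 * s `^ (- alpha) * (u ^+ 3) ^+ k =
  B * c * wc * (1 - u)^-1 * s `^ (- alpha) * (u ^+ 3) ^+ k * (1 - u ^+ 2)^-1 by ring.
rewrite ler_wpM2l//.
  by rewrite !mulr_ge0 ?powR_ge0 ?(ltW wc0)// !exprn_ge0// ltW.
by apply: geometric_sum_le; rewrite exprn_ge0 ?(ltW u0)//= exprn_ilt1 ?(ltW u0).
Qed.

(** The double squeeze with [p] the power of exponent [- alpha]: for fixed [k] the main term tends
    to a multiple of the moment of [V k], which in turn tends to [cX]. *)
Lemma process_tail_limit (cX r : R) : 0 < r ->
  (\int[Pa]_w (V n w `^ alpha)%:E)%E @[n --> \oo] --> cX%:E ->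
  Num.sqrt n%:R * expR (n%:R * I) *
    fine (P [set w | r * expR (rho * n%:R) < (X n w)%:R]) @[n --> \oo] -->
  r `^ (- alpha) * ((v * Num.sqrt (2 * pi))^-1 / alpha) * cX.
Proof.
move=> r0 Vl; set kap := (_^-1 / alpha).
have [K K0 hK] := error_bounded.
have [L [_ _ _ [Vfin _] _]] := process_limit law_P lambda_gt0 law_Pa alpha_gt0 Lam_gt0 beta_ge0
  beta_lt D_moment X0_moment.
pose t n := r * expR (rho * n%:R); have t0 n : 0 < t n by rewrite mulr_gt0 ?expR_gt0.
pose a n : R := Num.sqrt n%:R * expR (n%:R * I).
have a0 n : 0 <= a n by rewrite mulr_ge0 ?sqrtr_ge0 ?expR_ge0.
pose g (x : R) k l := a (k + l)%N *
  fine (P [set w | x * t (k + l)%N < (X k w)%:R * Delta_from k (k + l) w]).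
pose er (e : R) k := K * (e * r) `^ (- alpha) * (u ^+ 3) ^+ k.
pose mom k := r `^ (- alpha) * kap * fine (\int[Pa]_w (V k w `^ alpha)%:E).
have tE (x : R) n : x * t n = (x * r) * expR (rho * n%:R) by rewrite /t mulrA.
apply: (@cvg_double_squeeze _ _ mom g er (fun x => x `^ (- alpha))).
- have := is_derive_continuous (is_derive1_powR (- alpha) ltr01); exact.
- by rewrite powR1.
- move=> x k x0; have xr0 : 0 < x * r by rewrite mulr_gt0.
  have momE := normalized_moment law_P lambda_gt0 law_Pa (leqnn k) (@pastT _ _ _ _ S k).
  (* Finiteness is carried back from the tilted moment of [V k], the two differing by a positive
     factor. *)
  have Xfin : (\int[P]_w ((X k w)%:R `^ alpha)%:E < +oo)%E.
    rewrite ltNge leye_eq; apply/negP => /eqP E; have := Vfin k.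
    by rewrite momE E gt0_muley ?ltxx// lte_fin expR_gt0.
  have := product_tail_limit law_P lambda_gt0 alpha_gt0 alpha_int law_Pa
    logM_nonarith rho_def v_gt0 v_def xr0 (fun w => ler0n R (X k w)) (@mX k) Xfin.
  have -> : (x * r) `^ (- alpha) * kap * (expR (- (k%:R * Lam)) *
     fine (\int[P]_w ((X k w)%:R `^ alpha)%:E)) = x `^ (- alpha) * mom k.
    rewrite /mom momE fineM//; last by rewrite ge0_fin_numE// integral_ge0// => w _; rewrite lee_fin powR_ge0.
    by rewrite powRM ?(ltW x0) ?(ltW r0)//= !mulrA.
  apply: cvg_trans; apply: near_eq_cvg; apply: nearW => l.
  by rewrite /g /a tE.
- move=> e /andP[e0 _]; rewrite /er -[X in _ --> X](mulr0 (K * (e * r) `^ (- alpha))).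
  apply: cvgM; first exact: cvg_cst.
  apply: cvg_expr; rewrite ger0_norm ?exprn_ge0 ?(ltW u0)//.
  by rewrite exprn_ilt1 ?(ltW u0).
- by apply: cvgM; [exact: cvg_cst|exact: fine_cvg Vl].
- move=> e k l e01; have := tail_lower k l e01 (t0 (k + l)%N).
  move/(ler_wpM2l (a0 (k + l)%N)); rewrite mulrDr => h.
  have := hK k l (e * r); rewrite mulr_gt0//; last by case/andP: e01.
  by move=> /(_ isT); rewrite -tE -/(a _) -/(er e k) -/(g _ _ _); move: h; rewrite -/(g _ _ _); lra.
- move=> e k l e01; have := tail_upper k l e01 (t0 (k + l)%N).
  move/(ler_wpM2l (a0 (k + l)%N)); rewrite mulrDr => h.
  have := hK k l (e * r); rewrite mulr_gt0//; last by case/andP: e01.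
  by move=> /(_ isT); rewrite -tE -/(a _) -/(er e k) -/(g _ _ _); move: h; rewrite -/(g _ _ _); lra.
Qed.

End tail.

Theorem proposition2p1 (R : realType)
    (d : measure_display) (Omega : measurableType d)
    (de : measure_display) (Env : measurableType de)
    (S : cbp Omega Env) (m lambda : R) (P Pa : probability Omega R)
    (alpha mu rho v : R)
    (law_P : cbp_law S m P)
    (lambda_gt0 : 0 < lambda)
    (alpha_gt0 : 0 < alpha)
    (alpha_int : interior (dom_Lambda S m lambda P) alpha)
    (law_Pa : tilted_law S m lambda P alpha Pa)
    (logM_nonarith : nonarithmetic_logM S m lambda P)
    (logM_int : ('E_P[fun w => `|ln (M S m lambda 0 w)|%R] < +oo)%E)
    (mu_def : ('E_P[fun w => ln (M S m lambda 0 w)] = mu%:E)%E)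
    (mu_ge0 : 0 <= mu)
    (rho_def : rho = derive1 (Lambda S m lambda P) alpha)
    (rho_gt_mu : mu < rho)
    (v_gt0 : 0 < v)
    (v_def : v ^+ 2 = derive1n 2 (Lambda S m lambda P) alpha)
    (X0_moment : ('E_P[fun w => ((X0 S w)%:R `^ alpha)%R] < +oo)%E)
    (D_moment : exists C beta : R, [/\ 0 <= beta, beta < alpha &
       forall k : nat,
         ('E_P[fun w => (`|D S m lambda k w| `^ alpha)%R]
            <= (C * (1 + k%:R `^ beta))%R%:E)%E])
    (reach : forall K : nat, (1 <= K)%N ->
       (0 < P [set w | (tau S R K w < +oo)%E])%E) :
  exists (V : {RV Pa >-> R}) (cX : R),
    [/\ (forall w, 0 <= V w) /\ (0 < Pa [set w | (0 < V w)%R])%E,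
        {ae Pa, forall w,
           (fun n : nat => (X S n w)%:R / Delta S m lambda n w) @ \oo --> V w},
        (forall n : nat,
           ('E_Pa[fun w => (((X S n w)%:R / Delta S m lambda n w) `^ alpha)%R]
              < +oo)%E)
        /\ (fun n : nat =>
              ('E_Pa[fun w =>
                 (`|(X S n w)%:R / Delta S m lambda n w - V w| `^ alpha)%R])%E)
             @ \oo --> 0%E,
        ('E_Pa[fun w => (V w `^ alpha)%R] = cX%:E)%E /\ 0 < cX &
        (fun n : nat =>
           ((expR (- (n%:R * Lambda S m lambda P alpha)))%:E
             * 'E_P[fun w => ((X S n w)%:R `^ alpha)%R])%E) @ \oo --> cX%:E
        /\ (forall y : R,
              (fun n : nat =>
                 Num.sqrt n%:R
                 * expR (n%:R * (alpha * rho - Lambda S m lambda P alpha))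
                 * fine (P [set w | expR (rho * n%:R + y) < (X S n w)%:R]))
                @ \oo -->
              cX * expR (- (alpha * y)) / (alpha * v * Num.sqrt (2 * pi)))].
Proof.
have [C [beta [beta_ge0 beta_lt D_mom]]] := D_moment.
have Lam_gt0 : 0 < Lambda S m lambda P alpha :=
  Lambda_gt0 law_P lambda_gt0 alpha_gt0 alpha_int logM_int mu_def mu_ge0 rho_def rho_gt_mu.
have [L [mL L0 VL [Vfin Vdist] [Lfin Vlim]]] := process_limit law_P lambda_gt0 law_Pa alpha_gt0
  Lam_gt0 beta_ge0 beta_lt D_mom X0_moment.
have Lge0 : (0 <= \int[Pa]_w (L w `^ alpha)%:E)%E.
  by apply: integral_ge0 => w _; rewrite lee_fin powR_ge0.
pose cX := fine (\int[Pa]_w (L w `^ alpha)%:E)%E.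
have cXE : (\int[Pa]_w (L w `^ alpha)%:E = cX%:E)%E by rewrite fineK// ge0_fin_numE.
rewrite cXE in Vlim.
have cX_gt0 : 0 < cX := limit_moment_gt0 law_P lambda_gt0 law_Pa alpha_gt0 Lam_gt0 beta_ge0
  beta_lt D_mom X0_moment reach Vlim.
pose V : {RV Pa >-> R} := HB.pack L (isMeasurableFun.Build _ _ _ _ L mL).
exists V, cX; split.
- split; first exact: L0.
  have mpos : measurable [set w | 0 < L w].
    have := mL measurableT _ (measurable_itv `]0, +oo[).
    by rewrite setTI; congr measurable; apply/seteqP; split => w /=; rewrite in_itv/= andbT.
  (* Were [L] almost surely 0, its alpha-th moment would vanish, against [cX_gt0]. *)
  rewrite lt_neqAle measure_ge0 andbT eq_sym; apply/eqP => null.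
  have : (\int[Pa]_w (L w `^ alpha)%:E = 0)%E.
    rewrite -[RHS](integral0 Pa setT); apply: ae_eq_integral => //.
      by apply/measurable_EFinP; apply: (measurableT_comp (measurable_powR alpha)).
    exists [set w | 0 < L w]; split => // w /= /not_implyP[_ /eqP h].
    rewrite lt_neqAle L0 andbT; apply: contra h => /eqP <-.
    by rewrite powR0// gt_eqF.
  by rewrite cXE => -[cX0]; move: cX_gt0; rewrite cX0 ltxx.
- exact: VL.
- split=> [n|]; first by rewrite expectationE; exact: Vfin.
  by under eq_fun do rewrite expectationE; exact: Vdist.
- by split=> //; rewrite expectationE.
- split=> [|y].
    apply: cvg_trans Vlim; apply: near_eq_cvg; apply: nearW => n.
    by rewrite expectationE (normalized_moment law_P lambda_gt0 law_Pa (leqnn n) (@pastT _ _ _ _ S n)).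
  (* The threshold factor is [r = expR y], whose power of exponent [- alpha] is the exponential in
     the limit. *)
  have := process_tail_limit law_P lambda_gt0 alpha_gt0 alpha_int law_Pa logM_nonarith rho_def
    v_gt0 v_def Lam_gt0 beta_ge0 beta_lt D_mom X0_moment (expR_gt0 y) Vlim.
  have -> : expR y `^ (- alpha) * ((v * Num.sqrt (2 * pi))^-1 / alpha) * cX =
      cX * expR (- (alpha * y)) / (alpha * v * Num.sqrt (2 * pi)).
    rewrite /powR gt_eqF ?expR_gt0// expRK mulNr -mulrA [alpha * _ * _]mulrC -mulrA; field.
    by rewrite !gt_eqF// sqrtr_gt0 mulr_gt0 ?pi_gt0.
  apply: cvg_trans; apply: near_eq_cvg; apply: nearW => n.
  by rewrite [rho * _ + y]addrC expRD.
Qed.
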